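(* Let $p\in(1,2)$, $\theta,\gamma\in\mathbb{R}\setminus\{0\}$, $\lambda=\theta+\mathrm{i}\gamma$, and assume $0<|m(\lambda)|<m(\theta)<\infty$. Assume that either (a) $\mathbb{E}|Z_1(\lambda)|^2<\infty$, in which case put $\alpha:=2$; or (b) for some $\alpha\in(1,2)$, $$0<\liminf_{x\to\infty}x^\alpha\,\mathbb{P}\{|Z_1(\lambda)|>x\}\le \limsup_{x\to\infty}x^\alpha\,\mathbb{P}\{|Z_1(\lambda)|>x\}<\infty .$$ Assume further that the martingale $(Z_n(\alpha\theta))_{n\in\mathbb{N}_0}$ is (well defined, i.e. $m(\alpha\theta)<\infty$, and) uniformly integrable. Then the martingale $(Z_n(\lambda))_{n\in\mathbb{N}_0}$ converges in $L^p$ if, and only if, $$p<\alpha\quad\text{and}\quad \frac{m(\alpha\theta)}{|m(\lambda)|^\alpha}<1 .$$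
   Context: Branching random walk. Let $\mathcal{M}=\sum_{i=1}^{J}\delta_{X_i}$ be a random point process on $\mathbb{R}$, where $J=\mathcal{M}(\mathbb{R})$ takes values in $\{0,1,2,\ldots\}\cup\{\infty\}$; no assumption is made on the dependence between $J,X_1,X_2,\ldots$. Let $\mathbb{V}=\bigcup_{n\ge0}\mathbb{N}^n$ and let $(\mathcal{M}(u))_{u\in\mathbb{V}}$, $\mathcal{M}(u)=\sum_{i=1}^{J(u)}\delta_{X_i(u)}$, be i.i.d. copies of $\mathcal{M}$. The ancestor $\varnothing$ is at position $S(\varnothing)=0$; each individual $u$ of generation $n$ has offspring $ui$ ($1\le i\le J(u)$, or $i\in\mathbb{N}$ if $J(u)=\infty$) in generation $n+1$, at positions $S(ui)=S(u)+X_i(u)$. Sums $\sum_{|u|=n}$ run over all individuals of the $n$th generation actually born. Standing assumption (supercriticality): $\mathbb{E}J>1$. For $\lambda\in\mathbb{C}$ with real part $\theta$ set $m(\lambda):=\mathbb{E}\sum_{|u|=1}e^{-\lambda S(u)}$ whenever this converges absolutely, i.e. whenever $m(\theta)<\infty$ (for real $\theta$, $m(\theta)\in(0,\infty]$ is always defined). If $m(\theta)<\infty$ and $m(\lambda)\ne0$, the Biggins martingale is $$Z_n(\lambda):=\frac{1}{m(\lambda)^n}\sum_{|u|=n}e^{-\lambda S(u)},\qquad n\in\mathbb{N}_0,$$ a mean-one (complex-valued) martingale with respect to $\mathcal{F}_n=\sigma(\mathcal{M}(u):u\in\bigcup_{k=0}^{n-1}\mathbb{N}^k)$ ($\mathcal{F}_0$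 trivial).
   Formalization: The formal theorem additionally assumes that Z_1(λ) is not almost surely equal to 1; without this, case (a) fails (e.g. two children at suitable deterministic positions give Z_n(λ)=1 for all n although m(2θ)/|m(λ)|²>1). In case (b) this is automatic. *)

(* Defs.v *)
From mathcomp Require Import all_boot all_order all_algebra.
From mathcomp Require Import all_classical all_reals all_analysis.
From mathcomp Require Import complex.

Set Implicit Arguments.
Unset Strict Implicit.
Unset Printing Implicit Defensive.

Import Order.TTheory GRing.Theory Num.Theory.
Import numFieldNormedType.Exports.
Import ComplexField.Normc.

Local Open Scope classical_set_scope.
Local Open Scope ring_scope.
Local Open Scope complex_scope.

(* A realisation [\sum_(i < J) \delta_(x i)] of the point process, with its
   points numbered from 0.  [None] stands for J = oo; the values [x i] with
   [i >= J] are meaningless. *)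
Definition configuration (R : realType) : Type := (option nat * (nat -> R))%type.

Definition has_child (R : realType) (c : configuration R) (i : nat) : bool :=
  if c.1 is Some k then (i < k)%N else true.

Definition nb_children (R : realType) (c : configuration R) : \bar R :=
  if c.1 is Some k then (k%:R)%:E else +oo%E.

(* These sets generate the events that can be expressed through J and through
   the points x i with i < J only. *)
Definition configuration_events (R : realType) : set (set (configuration R)) :=
  [set C | exists i B, measurable B /\
    C = [set c : configuration R | has_child c i /\ B (c.2 i)]].

Definition point_process_space (R : realType) :=
  g_sigma_algebraType (@configuration_events R).

Section random_elements.
Context d (T : measurableType d) (R : realType) (P : probability T R).

Definition mutually_independent (I : eqType) d' (E : measurableType d')
    (X : I -> T -> E) : Prop :=
  forall (s : seq I) (A : I -> set E), uniq s ->
    (forall i, i \in s -> measurable (A i)) ->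
    P (\bigcap_(i in [set` s]) X i @^-1` A i) =
      (\prod_(i <- s) P (X i @^-1` A i))%E.

Definition iid (I : eqType) d' (E : measurableType d') (X : I -> T -> E) :
    Prop :=
  [/\ forall i, measurable_fun setT (X i),
      forall i j A, measurable A -> P (X i @^-1` A) = P (X j @^-1` A)
    & mutually_independent X].

Definition Cmeasurable (Z : T -> R[i]) : Prop :=
  measurable_fun setT (fun t => complex.Re (Z t)) /\
  measurable_fun setT (fun t => complex.Im (Z t)).

Definition Cexpectation (Z : T -> R[i]) : R[i] :=
  fine 'E_P[fun t => complex.Re (Z t)] +i* fine 'E_P[fun t => complex.Im (Z t)].

Definition CLnorm (p : R) (Z : T -> R[i]) : \bar R :=
  Lnorm P p%:E (fun t => (normc (Z t))%:E).

Definition in_Lp (p : R) (Z : T -> R[i]) : Prop :=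
  Cmeasurable Z /\ (CLnorm p Z < +oo)%E.

Definition converges_in_Lp (p : R) (Z : nat -> T -> R[i]) : Prop :=
  (forall n, in_Lp p (Z n)) /\
  exists2 Zoo : T -> R[i], in_Lp p Zoo &
    CLnorm p (fun t => Z n t - Zoo t) @[n --> \oo] --> 0%E.

Definition uniformly_integrable (Z : nat -> T -> R[i]) : Prop :=
  ereal_sup [set (\int[P]_(t in [set t | (a < normc (Z n t))%R])
                    (normc (Z n t))%:E)%E | n in [set: nat]]
    @[a --> (+oo)%R] --> 0%E.

End random_elements.

Definition cexp (R : realType) (z : R[i]) : R[i] :=
  let: x +i* y := z in (expR x * cos y) +i* (expR x * sin y).

(* The two sums below are the usual ones when the family is absolutely
   summable, and have no meaning otherwise. *)
Definition rsum (R : realType) (I : choiceType) (D : set I) (f : I -> R) : R :=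
  fine (\esum_(i in D) (Num.max (f i) 0)%:E) -
  fine (\esum_(i in D) (Num.max (- f i) 0)%:E).

Definition csum (R : realType) (I : choiceType) (D : set I) (f : I -> R[i]) :
    R[i] :=
  rsum D (fun i => complex.Re (f i)) +i* rsum D (fun i => complex.Im (f i)).

Section branching_random_walk.
Context d (T : measurableType d) (R : realType) (P : probability T R).

(* Individuals are finite words; [M u] is the point process of the children
   [rcons u i], i < J(u), of [u]. *)
Variable M : seq nat -> T -> point_process_space R.

Definition born (u : seq nat) (t : T) : bool :=
  [forall k : 'I_(size u), has_child (M (take k u) t) (nth 0%N u k)].

Definition position (u : seq nat) (t : T) : R :=
  \sum_(k < size u) (M (take k u) t).2 (nth 0%N u k).

Lemma born_nil t : born [::] t.
Proof. by apply/forallP; case. Qed.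

Lemma position_nil t : position [::] t = 0.
Proof. exact: big_ord0. Qed.

Lemma born_rcons u i t : born (rcons u i) t = born u t && has_child (M u t) i.
Proof.
have tk k : (k <= size u)%N -> take k (rcons u i) = take k u.
  by move=> ku; rewrite -cats1 takel_cat.
have last_lt : (size u < size (rcons u i))%N by rewrite size_rcons.
apply/forallP/andP => [h|[/forallP hu hi] [k kui] /=].
  split.
    apply/forallP => -[k ku] /=.
    have := h (Ordinal (ltn_trans ku last_lt)).
    by rewrite /= nth_rcons ku tk // ltnW.
  by have := h (Ordinal last_lt); rewrite /= nth_rcons ltnn eqxx tk // take_size.
have := kui; rewrite size_rcons ltnS leq_eqVlt => /predU1P[-> | ku].
  by rewrite nth_rcons ltnn eqxx tk // take_size.
by rewrite nth_rcons ku tk ?(ltnW ku) //; exact: (hu (Ordinal ku)).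
Qed.

Lemma position_rcons u i t :
  position (rcons u i) t = position u t + (M u t).2 i.
Proof.
rewrite /position size_rcons big_ord_recr /= nth_rcons ltnn eqxx -cats1.
rewrite take_size_cat //; congr (_ + _); apply: eq_bigr => k _.
by rewrite nth_cat ltn_ord takel_cat // ltnW.
Qed.

Definition generation (n : nat) (t : T) : set (seq nat) :=
  [set u | size u = n /\ born u t].

Definition mean_offspring : \bar R :=
  (\int[P]_t nb_children (M [::] t))%E.

Definition mR (theta : R) : \bar R :=
  (\int[P]_t \esum_(u in generation 1 t)
     (expR (- theta * position u t))%:E)%E.

(* The mean of an absolutely convergent sum when [mR (complex.Re lambda) < +oo];
   meaningless otherwise. *)
Definition mC (lambda : R[i]) : R[i] :=
  Cexpectation P (fun t =>
    csum (generation 1 t) (fun u => cexp (- lambda * (position u t)%:C))).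

Definition biggins (lambda : R[i]) (n : nat) (t : T) : R[i] :=
  (mC lambda ^+ n)^-1 *
  csum (generation n t) (fun u => cexp (- lambda * (position u t)%:C)).

End branching_random_walk.

(* Main.v *)
(* Write Y_u = e^(- lambda S(u)) / m(lambda)^n for |u| = n, and xi_u for the copy
   of Z_1(lambda) - 1 read off M(u).  Then Z_(n+1) - Z_n = \sum_(|u| = n) Y_u xi_u,
   where the xi_u are i.i.d., centered and independent of generation n.  Given
   generation n, its p-th moment is therefore comparable with that of the square
   function (\sum |Y_u xi_u|^2)^(1/2) (Marcinkiewicz-Zygmund, from independence
   and Khintchine's inequality).

   Sufficiency: interpolation between theta and alpha theta gives an exponent q,
   p <= q <= alpha, with E |xi|^q < oo and m(q theta) < |m(lambda)|^q, so that
   E |Z_(n+1) - Z_n|^q <= C E \sum |Y_u|^q decays geometrically.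

   Necessity: E |Z_1|^alpha = oo in case (b), so that p < alpha.  If m(alpha theta)
   >= |m(lambda)|^alpha, then \sum_(|u| = n) |Y_u|^alpha stays away from 0 with a
   probability bounded from below, as Z_n(alpha theta) is uniformly integrable
   with mean 1; then so does the square function: in case (a) because xi is not
   0 a.s., in case (b) because some |Y_u xi_u| exceeds 1 with a probability
   bounded from below.  Hence E |Z_(n+1) - Z_n|^p does not tend to 0. *)
From HB Require Import structures.
Require Import Defs.
From mathcomp Require Import all_boot all_order all_algebra.
From mathcomp Require Import all_classical all_reals all_analysis.
From mathcomp Require Import measurable_realfun complex ring lra.

Set Implicit Arguments.
Unset Strict Implicit.
Unset Printing Implicit Defensive.

Import Order.TTheory GRing.Theory Num.Theory.
Import numFieldNormedType.Exports.
Import ComplexField.Normc.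

Local Open Scope classical_set_scope.
Local Open Scope ring_scope.
Local Notation abs_summable D f := (summable D (EFin \o f)).

(** * Inequalities for real powers *)

Section powR_inequalities.
Context {R : realType}.
Implicit Types a b p q r t x y : R.

Lemma powR_bernoulli q t : 1 <= q -> 0 <= t -> 1 + q * (t - 1) <= t `^ q.
Proof.
rewrite le_eqVlt => /predU1P[<-|q1] t0; first by rewrite powRr1//; lra.
have q0 : 0 < q by lra.
have h : 0 < q / (q - 1) by rewrite divr_gt0// subr_gt0.
have hc : q^-1 + (q / (q - 1))^-1 = 1.
  by field; rewrite subr_eq0 !gt_eqF.
have := conjugate_powR t0 ler01 q0 h hc.
rewrite mulr1 powR1 mul1r => H.
have hv : (q / (q - 1))^-1 = 1 - q^-1.
  by rewrite [RHS]addrC; exact: (canRL (addKr _) hc).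
have : q * t <= q * (t `^ q / q + (q / (q - 1))^-1).
  by rewrite ler_pM2l.
have -> : q * (t `^ q / q + (q / (q - 1))^-1) = t `^ q + (q - 1).
  by rewrite hv; field; rewrite gt_eqF.
lra.
Qed.

Lemma powR_tangent q a x : 1 <= q -> 0 <= a -> 0 <= x ->
  a `^ q + q * a `^ (q - 1) * (x - a) <= x `^ q.
Proof.
move=> q1; rewrite le_eqVlt => /predU1P[<-|a0] x0.
  have q0 : q != 0 by rewrite gt_eqF// (lt_le_trans ltr01).
  rewrite powR0// add0r subr0.
  have [->|q1'] := eqVneq q 1; first by rewrite subrr powRr0 mul1r powRr1// mul1r.
  by rewrite powR0 ?subr_eq0// mulr0 mul0r powR_ge0.
have -> : x = a * (x / a) by rewrite mulrC divfK ?gt_eqF.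
have xa : 0 <= x / a by rewrite divr_ge0// ltW.
rewrite (powRM _ (ltW a0) xa) // -(@mulr_powRB1 _ a q (ltW a0)) ?(lt_le_trans ltr01)//.
have := powR_bernoulli q1 xa.
have := @powR_gt0 _ a (q - 1) a0.
set u := a `^ (q - 1); set t := x / a; move=> u0 H.
have au : 0 <= a * u by rewrite mulr_ge0 ?ltW.
have := ler_wpM2l au H.
lra.
Qed.

Lemma powR_norm_subgradient q a : 1 <= q ->
  exists c, forall b, `|a| `^ q + c * b <= `|a + b| `^ q.
Proof.
move=> q1; exists (q * `|a| `^ (q - 1) * Num.sg a) => b.
apply: le_trans (powR_tangent q1 (normr_ge0 a) (normr_ge0 (a + b))).
rewrite lerD2l -mulrA ler_wpM2l//.
  by rewrite mulr_ge0 ?powR_ge0// (le_trans ler01).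
rewrite lerBrDr; have := lexx (Num.sg a * (a + b)).
rewrite [in leLHS]mulrDr -normrEsg addrC => /le_trans; apply.
have [->|a0] := eqVneq a 0; first by rewrite sgr0 mul0r.
apply: le_trans (ler_norm _) _.
by rewrite normrM normr_sg a0 mul1r.
Qed.

Lemma powR_le1D q r t : 0 <= q <= r -> 0 <= t -> t `^ q <= 1 + t `^ r.
Proof.
move=> /andP[q0 qr] t0; have [t1|t1] := leP t 1.
  apply: (@le_trans _ _ 1); last by rewrite lerDl powR_ge0.
  have := @ge0_ler_powR _ q q0 t 1; rewrite powR1; apply; rewrite ?nnegrE//.
apply: (@le_trans _ _ (t `^ r)); last by rewrite lerDr.
by rewrite ler_powR// ltW.
Qed.

Lemma powR_ge_quartic q t : 1 <= q <= 2 -> 0 <= t ->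
  t ^+ 2 / 2 - t ^+ 4 / 54 <= t `^ q.
Proof.
move=> /andP[q1 q2] t0; have [t1|t1] := leP t 1.
  have [->|tn0] := eqVneq t 0.
    by rewrite !expr0n /= !mul0r subr0 powR_ge0.
  have tp : 0 < t by rewrite lt_neqAle eq_sym tn0.
  apply: (@le_trans _ _ (t `^ 2)).
    rewrite powR_mulrn//.
    have : 0 <= t ^+ 4 by rewrite exprn_ge0.
    have : 0 <= t ^+ 2 by rewrite exprn_ge0.
    lra.
  by rewrite ger_powR// tp.
apply: (@le_trans _ _ (t `^ 1)); last by rewrite ler_powR// ltW.
rewrite powRr1// -subr_ge0.
have -> : t - (t ^+ 2 / 2 - t ^+ 4 / 54) = t * (t - 3) ^+ 2 * (t + 6) / 54 by field.
have t6 : 0 <= t + 6 by lra.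
by rewrite divr_ge0 ?ler0n// mulr_ge0// mulr_ge0// sqr_ge0.
Qed.

Lemma powR_subadditive r x y : 0 <= r <= 1 -> 0 <= x -> 0 <= y ->
  (x + y) `^ r <= x `^ r + y `^ r.
Proof.
move=> /andP[r0 r1] x0 y0.
have [r00|rn0] := eqVneq r 0; first by rewrite r00 !powRr0; lra.
have [xy0|xyn0] := eqVneq (x + y) 0.
  by rewrite xy0 powR0// addr_ge0 ?powR_ge0.
have xyp : 0 < x + y by rewrite lt_neqAle eq_sym xyn0 addr_ge0.
have H z : 0 <= z -> z <= x + y -> z / (x + y) * (x + y) `^ r <= z `^ r.
  move=> z0 zxy; have [->|zn0] := eqVneq z 0; first by rewrite !mul0r powR_ge0.
  rewrite -[in leRHS](divfK xyn0 z) powRM ?divr_ge0 ?(ltW xyp)//.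
  rewrite ler_wpM2r ?powR_ge0// ger1_powR//.
  rewrite divr_gt0//=; last by rewrite lt_neqAle eq_sym zn0.
  by rewrite ler_pdivrMr// mul1r.
have Hx : x <= x + y by lra.
have Hy : y <= x + y by lra.
have := lerD (H x x0 Hx) (H y y0 Hy).
by rewrite -mulrDl -mulrDl divff// mul1r.
Qed.

Lemma powR_sum_le r (s : seq R) : 0 < r <= 1 -> (forall x, x \in s -> 0 <= x) ->
  (\sum_(x <- s) x) `^ r <= \sum_(x <- s) x `^ r.
Proof.
move=> /andP[r0 r1]; elim: s => [|x s IH] s0.
  by rewrite !big_nil powR0// gt_eqF.
rewrite !big_cons.
apply: le_trans (@powR_subadditive r x _ _ _ _) _.
- by rewrite r1 ltW.
- by rewrite s0// mem_head.
- by rewrite big_seq sumr_ge0// => y ys; rewrite s0// in_cons ys orbT.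
by rewrite lerD2l IH// => y ys; rewrite s0// in_cons ys orbT.
Qed.

Lemma powR_exprn q x n : 0 <= x -> (x ^+ n) `^ q = (x `^ q) ^+ n.
Proof.
move=> x0; rewrite -(powR_mulrn n x0) -(powR_mulrn n (powR_ge0 x q)).
by rewrite -!powRrM mulrC.
Qed.

Lemma powRD_le q x y : 0 <= q -> 0 <= x -> 0 <= y ->
  (x + y) `^ q <= 2 `^ q * (x `^ q + y `^ q).
Proof.
move=> q0 x0 y0; wlog xy : x y x0 y0 / x <= y.
  move=> H; have [xy|/ltW yx] := leP x y; first exact: H.
  by rewrite addrC [x `^ q + _]addrC; exact: H.
apply: (@le_trans _ _ ((2 * y) `^ q)).
  by apply: ge0_ler_powR; rewrite ?nnegrE//; lra.
rewrite powRM//.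
by rewrite ler_wpM2l ?powR_ge0// lerDr powR_ge0.
Qed.

End powR_inequalities.

(* [rademacher_mean f a s] is the mean of [f (a + \sum_i eps_i x_i)], where s
   lists the x_i and the eps_i are independent fair signs. *)
Fixpoint rademacher_mean {R : realType} (f : R -> R) (a : R) (s : seq R) : R :=
  if s is x :: s' then
    (rademacher_mean f (a + x) s' + rademacher_mean f (a - x) s') / 2
  else f a.

Section rademacher.
Context {R : realType}.
Implicit Types (f g : R -> R) (a : R) (s : seq R).

Lemma rademacher_mean_le f g a s : (forall x, f x <= g x) ->
  rademacher_mean f a s <= rademacher_mean g a s.
Proof.
move=> fg; elim: s a => [|x s IH] a //=.
by rewrite ler_pM2r// lerD.
Qed.

Lemma rademacher_mean_linear f g (b c : R) a s :
  rademacher_mean (fun x => b * f x + c * g x) a s =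
  b * rademacher_mean f a s + c * rademacher_mean g a s.
Proof. by elim: s a => [|x s IH] a //=; rewrite !IH; field. Qed.

Lemma rademacher_mean_cst (c : R) a s : rademacher_mean (fun=> c) a s = c.
Proof. by elim: s a => [|x s IH] a //=; rewrite !IH; field. Qed.

Lemma rademacher_mean_sqr a s :
  rademacher_mean (fun x => x ^+ 2) a s = a ^+ 2 + \sum_(x <- s) x ^+ 2.
Proof.
elim: s a => [|x s IH] a /=; first by rewrite big_nil addr0.
by rewrite !IH big_cons; field.
Qed.

Lemma rademacher_mean_quartic a s (S := \sum_(x <- s) x ^+ 2) :
  rademacher_mean (fun x => x ^+ 4) a s <=
  a ^+ 4 + 6 * a ^+ 2 * S + 3 * S ^+ 2.
Proof.
rewrite {}/S; elim: s a => [|x s IH] a /=.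
  by rewrite big_nil; lra.
rewrite big_cons; set S := \sum_(_ <- s) _.
have S0 : 0 <= S by rewrite sumr_ge0// => i _; rewrite sqr_ge0.
have := lerD (IH (a + x)) (IH (a - x)); rewrite -/S => H.
rewrite ler_pdivrMr//; apply: le_trans H _; rewrite -subr_ge0.
have -> : (a ^+ 4 + 6 * a ^+ 2 * (x ^+ 2 + S) + 3 * (x ^+ 2 + S) ^+ 2) * 2 -
  ((a + x) ^+ 4 + 6 * (a + x) ^+ 2 * S + 3 * S ^+ 2 +
   ((a - x) ^+ 4 + 6 * (a - x) ^+ 2 * S + 3 * S ^+ 2)) = 4 * (x ^+ 2) ^+ 2 by ring.
by rewrite mulr_ge0// sqr_ge0.
Qed.

Lemma rademacher_mean_scale (q c : R) a s : 0 <= c ->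
  rademacher_mean (fun x => `|x| `^ q) (c * a) [seq c * x | x <- s] =
  c `^ q * rademacher_mean (fun x => `|x| `^ q) a s.
Proof.
move=> c0; elim: s a => [|x s IH] a /=.
  by rewrite normrM powRM// ger0_norm.
by rewrite -mulrDr -mulrBr !IH; field.
Qed.

Lemma rademacher_mean_ge0 f a s : (forall x, 0 <= f x) ->
  0 <= rademacher_mean f a s.
Proof.
by move=> f0; elim: s a => [|x s IH] a //=; rewrite divr_ge0// addr_ge0.
Qed.

(* By homogeneity the sum of squares may be taken to be 1; then compare
   [t `^ q] with polynomials of which all Rademacher means are explicit. *)
Lemma khintchine_unit (q : R) s : 1 <= q <= 2 -> \sum_(x <- s) x ^+ 2 = 1 ->
  4 / 9 <= rademacher_mean (fun x => `|x| `^ q) 0 s <= 2.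
Proof.
move=> /andP[q1 q2] s1; apply/andP; split.
  pose g (x : R) := 2^-1 * x ^+ 2 + (- (54^-1)) * x ^+ 4.
  apply: le_trans (@rademacher_mean_le g _ _ _ _); last first.
    move=> x; rewrite /g.
    have := @powR_ge_quartic _ q `|x|; rewrite q1 q2 normr_ge0 => /(_ erefl erefl).
    have e2 : `|x| ^+ 2 = x ^+ 2 by rewrite real_normK ?num_real.
    have e4 : `|x| ^+ 4 = x ^+ 4 by rewrite (exprM `|x| 2 2) e2 -exprM.
    rewrite e2 e4; lra.
  rewrite /g rademacher_mean_linear rademacher_mean_sqr s1.
  have := rademacher_mean_quartic 0 s; rewrite s1.
  rewrite !expr0n /= !(mulr0, mul0r, add0r, addr0, expr1n, mulr1); set K := rademacher_mean _ _ _ => K3.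
  lra.
pose g (x : R) := 1 * (fun=> 1) x + 1 * x ^+ 2.
apply: le_trans (@rademacher_mean_le _ g _ _ _) _.
  move=> x; rewrite /g !mul1r -[x ^+ 2]real_normK ?num_real//.
  rewrite -(powR_mulrn _ (normr_ge0 x)); apply: powR_le1D => //.
  by rewrite q2 andbT; lra.
rewrite /g rademacher_mean_linear rademacher_mean_cst rademacher_mean_sqr s1.
lra.
Qed.

Lemma khintchine (q : R) s (S := \sum_(x <- s) x ^+ 2) : 1 <= q <= 2 ->
  4 / 9 * S `^ (q / 2) <= rademacher_mean (fun x => `|x| `^ q) 0 s
    <= 2 * S `^ (q / 2).
Proof.
move=> q12; have /andP[q1 q2] := q12.
have S0 : 0 <= S by rewrite sumr_ge0// => i _; rewrite sqr_ge0.
have q20 : q / 2 != 0 by lra.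
have [Se|Sn0] := eqVneq S 0.
  rewrite Se powR0// !mulr0.
  suff -> : rademacher_mean (fun x => `|x| `^ q) 0 s = 0 by rewrite lexx.
  have {Se}: all (fun x => x == 0) s.
    apply/allP => x xs; have /eqP := Se; rewrite psumr_eq0; last first.
      by move=> i _; rewrite sqr_ge0.
    by move=> /allP /(_ x xs); rewrite /= sqrf_eq0.
  clear S S0; elim: s => [|x s IH] /=; first by move=> _; rewrite normr0 powR0//; lra.
  move=> /andP[/eqP-> s0].
  by rewrite addr0 subr0 IH// addr0 mul0r.
have Sp : 0 < S by rewrite lt_neqAle eq_sym Sn0.
pose r := Num.sqrt S.
have rp : 0 < r by rewrite sqrtr_gt0.
have -> : S `^ (q / 2) = r `^ q.
  by rewrite mulrC powRrM powR12_sqrt.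
have sE : s = [seq r * x | x <- [seq x / r | x <- s]].
  rewrite -map_comp -[LHS]map_id; apply: eq_map => x /=.
  by rewrite mulrC divfK// gt_eqF.
have -> : rademacher_mean (fun x => `|x| `^ q) 0 s =
    r `^ q * rademacher_mean (fun x => `|x| `^ q) 0 [seq x / r | x <- s].
  by rewrite {1}sE -{1}(mulr0 r) rademacher_mean_scale// ltW.
have /(@khintchine_unit q) : \sum_(x <- [seq x / r | x <- s]) x ^+ 2 = 1.
  rewrite big_map; under eq_bigr do rewrite exprMn.
  by rewrite -mulr_suml exprVn sqr_sqrtr// divff.
move=> /(_ q12) /andP[h1 h2].
by rewrite mulrC [2 * _]mulrC !ler_wpM2l ?powR_ge0.
Qed.

End rademacher.

(** * Unconditional sums *)

Section real_sums.
Context {R : realType} {I : choiceType}.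
Implicit Types (D : set I) (f g h : I -> R).

Lemma le_abs_summable D f g : (forall i, D i -> `|f i| <= g i) ->
  (\esum_(i in D) (g i)%:E < +oo)%E -> abs_summable D f.
Proof.
by move=> fg; apply: le_lt_trans; apply: le_esum => i Di; rewrite lee_fin fg.
Qed.

Lemma ge0_summable D g : (forall i, D i -> 0 <= g i) ->
  (\esum_(i in D) (g i)%:E < +oo)%E -> summable D (EFin \o g).
Proof.
move=> g0; rewrite /summable; congr (_ < _)%E.
by apply: eq_esum => i Di; rewrite /= ger0_norm// g0.
Qed.

Lemma rsumE D f g h : (forall i, D i -> f i = g i - h i) ->
  (forall i, D i -> 0 <= g i) -> (forall i, D i -> 0 <= h i) ->
  (\esum_(i in D) (g i)%:E < +oo)%E -> (\esum_(i in D) (h i)%:E < +oo)%E ->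
  rsum D f = fine (\esum_(i in D) (g i)%:E) - fine (\esum_(i in D) (h i)%:E).
Proof.
move=> fE g0 h0 gf hf.
have sg := ge0_summable g0 gf; have sh := ge0_summable h0 hf.
have gfin : \esum_(i in D) (g i)%:E \is a fin_num.
  by rewrite ge0_fin_numE// esum_ge0.
have hfin : \esum_(i in D) (h i)%:E \is a fin_num.
  by rewrite ge0_fin_numE// esum_ge0.
have pE : \esum_(i in D) (Num.max (f i) 0)%:E =
    esum D ((EFin \o g) \- (EFin \o h))^\+%E.
  by apply: eq_esum => i Di; rewrite funeposE /= fE// EFin_max.
have nE : \esum_(i in D) (Num.max (- f i) 0)%:E =
    esum D ((EFin \o g) \- (EFin \o h))^\-%E.
  by apply: eq_esum => i Di; rewrite funenegE /= fE// EFin_max.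
have pf : esum D ((EFin \o g) \- (EFin \o h))^\+%E \is a fin_num.
  rewrite ge0_fin_numE ?esum_ge0//.
  apply: le_lt_trans gf; apply: le_esum => i Di.
  rewrite funeposE /= -EFinB ge_max !lee_fin g0// andbT.
  by rewrite lerBlDr lerDl h0.
have nf : esum D ((EFin \o g) \- (EFin \o h))^\-%E \is a fin_num.
  rewrite ge0_fin_numE ?esum_ge0//.
  apply: le_lt_trans hf; apply: le_esum => i Di.
  rewrite funenegE /= ge_max !lee_fin h0// andbT.
  by rewrite opprB lerBlDr lerDl g0.
have := esumB sg sh (fun i Di => g0 i Di : (0 <= (EFin \o g) i)%E) h0.
rewrite /rsum pE nE -fineB// => ->.
by rewrite fineB.
Qed.

Lemma eq_rsum D f g : (forall i, D i -> f i = g i) -> rsum D f = rsum D g.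
Proof.
by move=> fg; rewrite /rsum; congr (fine _ - fine _);
  apply: eq_esum => i Di; rewrite fg.
Qed.

Let pos f i : R := Num.max (f i) 0.
Let neg f i : R := Num.max (- f i) 0.

Let pos_ge0 f i : 0 <= pos f i. Proof. by rewrite /pos le_max lexx orbT. Qed.
Let neg_ge0 f i : 0 <= neg f i. Proof. by rewrite /neg le_max lexx orbT. Qed.

Let posneg f i : f i = pos f i - neg f i.
Proof.
rewrite /pos /neg; have [f0|f0] := leP 0 (f i).
  by rewrite max_r ?subr0// oppr_le0.
by rewrite max_l ?oppr_ge0 ?ltW// sub0r opprK.
Qed.

Let pos_fin D f : abs_summable D f -> (\esum_(i in D) (pos f i)%:E < +oo)%E.
Proof.
apply: le_lt_trans; apply: le_esum => i Di.
by rewrite lee_fin /pos ge_max normr_ge0 ler_norm.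
Qed.

Let neg_fin D f : abs_summable D f -> (\esum_(i in D) (neg f i)%:E < +oo)%E.
Proof.
apply: le_lt_trans; apply: le_esum => i Di.
by rewrite lee_fin /neg ge_max normr_ge0 -normrN ler_norm.
Qed.

Let fineDe D g h : (forall i, D i -> 0 <= g i) -> (forall i, D i -> 0 <= h i) ->
  (\esum_(i in D) (g i)%:E < +oo)%E -> (\esum_(i in D) (h i)%:E < +oo)%E ->
  fine (\esum_(i in D) (g i + h i)%:E) =
  fine (\esum_(i in D) (g i)%:E) + fine (\esum_(i in D) (h i)%:E).
Proof.
move=> g0 h0 gf hf; rewrite -fineD ?ge0_fin_numE ?esum_ge0//.
by congr fine; rewrite -esumD.
Qed.

Let ltyD D g h : (forall i, D i -> 0 <= g i) -> (forall i, D i -> 0 <= h i) ->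
  (\esum_(i in D) (g i)%:E < +oo)%E -> (\esum_(i in D) (h i)%:E < +oo)%E ->
  (\esum_(i in D) (g i + h i)%:E < +oo)%E.
Proof.
move=> g0 h0 gf hf.
have -> : \esum_(i in D) (g i + h i)%:E =
  (\esum_(i in D) (g i)%:E + \esum_(i in D) (h i)%:E)%E by rewrite -esumD.
exact: lte_add_pinfty.
Qed.

Lemma abs_summableD D f g : abs_summable D f -> abs_summable D g ->
  abs_summable D (fun i => f i + g i).
Proof.
move=> sf sg; apply: (@le_abs_summable _ _ (fun i => `|f i| + `|g i|)).
  by move=> i _; exact: ler_normD.
exact: ltyD.
Qed.

Lemma abs_summableN D f : abs_summable D f -> abs_summable D (fun i => - f i).
Proof.
rewrite /summable; congr (_ < _)%E.
by apply: eq_esum => i _; rewrite /= normrN.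
Qed.

Lemma rsumD D f g : abs_summable D f -> abs_summable D g ->
  rsum D (fun i => f i + g i) = rsum D f + rsum D g.
Proof.
move=> sf sg.
have [pf nf pg ng] := And4 (pos_fin sf) (neg_fin sf) (pos_fin sg) (neg_fin sg).
rewrite (@rsumE D (fun i => f i + g i) (fun i => pos f i + pos g i)
                  (fun i => neg f i + neg g i)).
- rewrite (fineDe _ _ pf pg)// (fineDe _ _ nf ng)// /rsum opprD.
  by rewrite addrACA.
- by move=> i Di; rewrite {1}(posneg f) {1}(posneg g); ring.
- by move=> i Di; rewrite addr_ge0.
- by move=> i Di; rewrite addr_ge0.
- exact: ltyD.
- exact: ltyD.
Qed.

Lemma rsumN D f : rsum D (fun i => - f i) = - rsum D f.
Proof.
rewrite /rsum opprB; congr (fine _ - fine _).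
by apply: eq_esum => i _; rewrite opprK.
Qed.

Lemma rsumB D f g : abs_summable D f -> abs_summable D g ->
  rsum D (fun i => f i - g i) = rsum D f - rsum D g.
Proof. by move=> sf sg; rewrite rsumD ?rsumN//; exact: abs_summableN. Qed.

Lemma esumZl D (c : R) (a : I -> \bar R) : 0 <= c -> (forall i, 0 <= a i)%E ->
  \esum_(i in D) (c%:E * a i)%E = (c%:E * \esum_(i in D) a i)%E.
Proof.
move=> c0 a0; rewrite /esum -ereal_supZl//; last first.
  by apply/set0P; eexists; exists set0; [exact: fsets_set0|].
congr ereal_sup; rewrite image_comp; apply: eq_imagel => A _ /=.
by rewrite ge0_mule_fsumr.
Qed.

Lemma abs_summableZ D (c : R) f : abs_summable D f ->
  abs_summable D (fun i => c * f i).
Proof.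
rewrite /summable => fs.
have -> : (\esum_(i in D) `|(c * f i)%:E|)%E =
    (`|c%:E| * \esum_(i in D) `|(f i)%:E|)%E.
  rewrite -[`|c%:E|%E]/(`|c|%R)%:E -esumZl//; apply: eq_esum => i _.
  by rewrite /= normrM.
by apply: lte_mul_pinfty => //; rewrite lee_fin.
Qed.

Lemma rsumZ D (c : R) f : abs_summable D f ->
  rsum D (fun i => c * f i) = c * rsum D f.
Proof.
move=> fs; wlog c0 : c / 0 <= c.
  move=> H; have [/H//|c0] := leP 0 c.
  rewrite -[c]opprK [RHS]mulNr -H ?oppr_ge0 ?(ltW c0)// -rsumN.
  by apply: eq_rsum => i _; rewrite !mulNr.
have cz (g : I -> R) : (forall i, 0 <= g i) ->
    \esum_(i in D) (c * g i)%:E = (c%:E * \esum_(i in D) (g i)%:E)%E.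
  by move=> g0; rewrite -esumZl.
have fz (g : I -> R) : (forall i, 0 <= g i) ->
    fine (\esum_(i in D) (c * g i)%:E) = c * fine (\esum_(i in D) (g i)%:E).
  move=> g0; rewrite cz//.
  have [->|c0'] := eqVneq c 0; first by rewrite mul0e mul0r.
  have : (0 <= \esum_(i in D) (g i)%:E)%E.
    by apply: esum_ge0 => i _; rewrite lee_fin.
  case: (\esum_(i in D) (g i)%:E) => [r|_|]//=.
  by rewrite gt0_muley ?mulr0// lte_fin lt_neqAle eq_sym c0'.
rewrite (@rsumE D _ (fun i => c * pos f i) (fun i => c * neg f i)).
- by rewrite (fz _ (pos_ge0 f)) (fz _ (neg_ge0 f)) -mulrBr.
- by move=> i _; rewrite -mulrBr -posneg.
- by move=> i _; rewrite mulr_ge0.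
- by move=> i _; rewrite mulr_ge0.
- by rewrite cz//; apply: lte_mul_pinfty; rewrite ?lee_fin//; exact: pos_fin.
- by rewrite cz//; apply: lte_mul_pinfty; rewrite ?lee_fin//; exact: neg_fin.
Qed.

Lemma rsum_norm_le D f :
  (`|(rsum D f)%:E| <= \esum_(i in D) `|(f i)%:E|)%E.
Proof.
have fle (x : \bar R) : (0 <= x -> (fine x)%:E <= x)%E.
  by case: x => //= [r|] _; rewrite ?leey.
have p0 : (0 <= \esum_(i in D) (pos f i)%:E)%E.
  by apply: esum_ge0 => i _; exact: pos_ge0.
have n0 : (0 <= \esum_(i in D) (neg f i)%:E)%E.
  by apply: esum_ge0 => i _; exact: neg_ge0.
have -> : (\esum_(i in D) `|(f i)%:E|)%E =
    (\esum_(i in D) (pos f i)%:E + \esum_(i in D) (neg f i)%:E)%E.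
  rewrite -esumD; [|by move=> i _; exact: pos_ge0|by move=> i _; exact: neg_ge0].
  apply: eq_esum => i _; rewrite -EFinD; congr EFin.
  by rewrite /pos /neg; case: (leP 0 (f i)) => [f0|/ltW f0];
    [rewrite max_r ?addr0 ?oppr_le0 ?ger0_norm|
     rewrite max_l ?oppr_ge0// add0r ler0_norm].
apply: le_trans (leeD (fle _ p0) (fle _ n0)).
rewrite -EFinD abse_EFin lee_fin; apply: le_trans (ler_normB _ _) _.
by rewrite !ger0_norm// fine_ge0.
Qed.

Lemma rsum_mkcond D f :
  rsum D f = rsum setT (fun i => if i \in D then f i else 0).
Proof.
by rewrite /rsum; congr (fine _ - fine _); rewrite esum_mkcond;
  apply: eq_esum => i _; case: ifPn; rewrite ?oppr0 ?maxxx.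
Qed.

Lemma abs_summable_mkcond D f :
  abs_summable setT f -> abs_summable setT (fun i => if i \in D then f i else 0).
Proof.
apply: le_lt_trans; apply: le_esum => i _; rewrite lee_fin.
by case: ifPn; rewrite ?normr0.
Qed.

Lemma rsumID D f : abs_summable setT f ->
  rsum setT f = rsum D f + rsum (~` D) f.
Proof.
move=> fs; rewrite (rsum_mkcond D) (rsum_mkcond (~` D)) -rsumD;
  [|exact: abs_summable_mkcond..].
apply: eq_rsum => i _; rewrite in_setC.
by case: ifPn; rewrite ?addr0 ?add0r.
Qed.

Lemma rsum_set1 (i : I) f : rsum [set i] f = f i.
Proof.
rewrite /rsum !esum_set1 ?lee_fin ?le_max ?lexx ?orbT//=.
Qed.

End real_sums.

Lemma rsum_reindex {R : realType} {I J : choiceType} (P : set I) (Q : set J)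
    (e : I -> J) (f : J -> R) :
  set_bij P Q e -> rsum Q f = rsum P (f \o e).
Proof. by move=> Pe; rewrite /rsum !(reindex_esum P Q e _ Pe). Qed.

Lemma abs_summable_rsum {R : realType} {I J : choiceType} (P : set I)
    (Q : I -> set J) (f : I -> J -> R) :
  abs_summable (P `*`` Q) (fun k => f k.1 k.2) ->
  [/\ forall i, P i -> abs_summable (Q i) (f i),
      abs_summable P (fun i => rsum (Q i) (f i)) &
      rsum P (fun i => rsum (Q i) (f i)) = rsum (P `*`` Q) (fun k => f k.1 k.2)].
Proof.
move=> fs.
have E (g : I -> J -> R) : (forall i j, 0 <= g i j) ->
    (\esum_(k in P `*`` Q) (g k.1 k.2)%:E < +oo)%E ->
    (forall i, P i -> \esum_(j in Q i) (g i j)%:E < +oo)%E /\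
    \esum_(i in P) (fine (\esum_(j in Q i) (g i j)%:E))%:E =
      \esum_(k in P `*`` Q) (g k.1 k.2)%:E.
  move=> g0; rewrite -(@esum_esum _ _ _ P Q (fun i j => (g i j)%:E)); last first.
    by move=> i j _ _; rewrite lee_fin.
  move=> gf; have H i : P i -> (\esum_(j in Q i) (g i j)%:E < +oo)%E.
    move=> Pi; apply: le_lt_trans gf.
    rewrite -[leLHS](@esum_set1 _ _ i (fun i => \esum_(j in Q i) (g i j)%:E)%E);
      last by rewrite esum_ge0// => j _; rewrite lee_fin.
    rewrite esum_mkcond [leRHS]esum_mkcond; apply: le_esum => k _.
    case: ifPn => [/set_mem ->|_]; first by rewrite mem_set.
    by case: ifPn => // _; rewrite esum_ge0// => j _; rewrite lee_fin.
  split=> //; apply: eq_esum => i Pi; rewrite fineK// ge0_fin_numE ?H//.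
  by rewrite esum_ge0// => j _; rewrite lee_fin.
pose p i j : R := Num.max (f i j) 0; pose n i j : R := Num.max (- f i j) 0.
have p0 i j : 0 <= p i j by rewrite le_max lexx orbT.
have n0 i j : 0 <= n i j by rewrite le_max lexx orbT.
have pf : (\esum_(k in P `*`` Q) (p k.1 k.2)%:E < +oo)%E.
  apply: le_lt_trans fs; apply: le_esum => -[i j] _.
  by rewrite lee_fin /p ge_max normr_ge0 ler_norm.
have nf : (\esum_(k in P `*`` Q) (n k.1 k.2)%:E < +oo)%E.
  apply: le_lt_trans fs; apply: le_esum => -[i j] _.
  by rewrite lee_fin /n ge_max normr_ge0 -normrN ler_norm.
have [ap Ep] := E _ p0 pf; have [an En] := E _ n0 nf.
have [aa Ea] := E (fun i j => `|f i j|) (fun i j => normr_ge0 _) fs.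
have fp i : P i -> 0 <= fine (\esum_(j in Q i) (p i j)%:E).
  by move=> _; rewrite fine_ge0// esum_ge0// => j _; rewrite lee_fin.
have fn i : P i -> 0 <= fine (\esum_(j in Q i) (n i j)%:E).
  by move=> _; rewrite fine_ge0// esum_ge0// => j _; rewrite lee_fin.
split=> //.
  apply: (@le_abs_summable _ _ _ _ (fun i => fine (\esum_(j in Q i) `|(f i j)%:E|)%E)).
    move=> i Pi; rewrite -lee_fin fineK; first exact: rsum_norm_le.
    by rewrite ge0_fin_numE ?aa// esum_ge0.
  by rewrite Ea.
rewrite (@rsumE _ _ P _ (fun i => fine (\esum_(j in Q i) (p i j)%:E))
  (fun i => fine (\esum_(j in Q i) (n i j)%:E))) ?Ep ?En//.
Qed.

Section sums_over_nat.
Context {R : realType}.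
Implicit Types f : nat -> R.

Lemma esum_I (a : nat -> \bar R) N : (forall k, 0 <= a k)%E ->
  \esum_(k in `I_N) a k = (\sum_(k < N) a k)%E.
Proof.
move=> a0; rewrite esum_fset; [|exact: finite_II|by move=> k _; exact: a0].
by rewrite -fsbig_ord.
Qed.

Lemma rsum_I f N : rsum `I_N f = \sum_(k < N) f k.
Proof.
rewrite /rsum !esum_I; try by move=> k; rewrite lee_fin le_max lexx orbT.
rewrite !sumEFin /= -sumrB; apply: eq_bigr => k _.
by case: (leP 0 (f k)) => [f0|/ltW f0];
  [rewrite max_r ?oppr_le0// subr0|rewrite max_l ?oppr_ge0// sub0r opprK].
Qed.

Lemma cvg_rsum f : abs_summable setT f ->
  \sum_(k < n) f k @[n --> \oo] --> rsum setT f.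
Proof.
move=> fs.
have H (g : nat -> R) : (forall k, 0 <= g k) -> (forall k, g k <= `|f k|) ->
    \sum_(k < n) g k @[n --> \oo] --> fine (\esum_(k in setT) (g k)%:E).
  move=> g0 gf; rewrite -nneseries_esumT; last by move=> k; rewrite lee_fin.
  have -> : (fun n => \sum_(k < n) g k) =
      fine \o (fun n => (\sum_(0 <= k < n) (g k)%:E)%E).
    by apply/funext => n /=; rewrite big_mkord sumEFin.
  apply: fine_cvg; rewrite fineK; first by apply: is_cvg_nneseries => k _ _; rewrite lee_fin.
  rewrite nneseries_esumT; last by move=> k; rewrite lee_fin.
  rewrite ge0_fin_numE; last by apply: esum_ge0 => k _; rewrite lee_fin.
  by apply: le_lt_trans fs; apply: le_esum => k _; rewrite lee_fin.
have -> : (fun n => \sum_(k < n) f k) = (fun n =>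
    \sum_(k < n) Num.max (f k) 0 - \sum_(k < n) Num.max (- f k) 0).
  apply/funext => n; rewrite -sumrB; apply: eq_bigr => k _.
  by case: (leP 0 (f k)) => [f0|/ltW f0];
    [rewrite max_r ?oppr_le0// subr0|rewrite max_l ?oppr_ge0// sub0r opprK].
apply: cvgB; apply: H => k; rewrite ?le_max ?lexx ?orbT// ge_max normr_ge0.
  by rewrite ler_norm.
by rewrite -normrN ler_norm.
Qed.

End sums_over_nat.

Section measurable_sums.
Context d (T : measurableType d) (R : realType) (P : {measure set T -> \bar R}).

Lemma measurable_esum (D : set nat) (a : nat -> T -> \bar R) :
  (forall k t, 0 <= a k t)%E -> (forall k, measurable_fun setT (a k)) ->
  measurable_fun setT (fun t => \esum_(k in D) a k t).
Proof.
move=> a0 ma; rewrite (_ : (fun _ => _) =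
    fun t => (\sum_(0 <= k <oo) (if k \in D then a k t else 0))%E); last first.
  by apply/funext => t; rewrite esum_mkcond nneseries_esumT// => k; case: ifP.
apply: (@ge0_emeasurable_sum _ _ _ _ (fun k t => if k \in D then a k t else 0%E)).
  by move=> k t _ _ /=; case: ifP.
by move=> k _; case: (k \in D); [exact: ma|exact: measurable_cst].
Qed.

Lemma integral_esum (D : set nat) (a : nat -> T -> \bar R) :
  (forall k t, 0 <= a k t)%E -> (forall k, measurable_fun setT (a k)) ->
  (\int[P]_t (\esum_(k in D) a k t) = \esum_(k in D) \int[P]_t a k t)%E.
Proof.
move=> a0 ma.
rewrite (eq_integral
    (fun t => \sum_(0 <= k <oo) (if k \in D then a k t else 0))%E); last first.
  by move=> t _; rewrite esum_mkcond nneseries_esumT// => k; case: ifP.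
rewrite integral_nneseries//; last 2 first.
  by move=> k; case: (k \in D); [exact: ma|exact: measurable_cst].
  by move=> k t _; case: ifP.
rewrite esum_mkcond nneseries_esumT; last first.
  by move=> k; apply: integral_ge0 => t _; case: ifP.
apply: eq_esum => k _; case: ifP => // _; exact: integral0.
Qed.

Lemma measurable_rsum (D : set nat) (f : nat -> T -> R) :
  (forall k, measurable_fun setT (f k)) ->
  measurable_fun setT (fun t => rsum D (f ^~ t)).
Proof.
move=> mf; apply: measurable_funB; apply: measurableT_comp => //.
  apply: measurable_esum => [k t|k]; first by rewrite lee_fin le_max lexx orbT.
  by apply/measurable_EFinP; apply: measurable_maxr.
apply: measurable_esum => [k t|k]; first by rewrite lee_fin le_max lexx orbT.
by apply/measurable_EFinP; apply: measurable_maxr => //; exact: measurable_funN.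
Qed.

Lemma ae_abs_summable (D : set nat) (f : nat -> T -> R) :
  (forall k, measurable_fun setT (f k)) ->
  (\esum_(k in D) \int[P]_t `|(f k t)%:E| < +oo)%E ->
  {ae P, forall t, abs_summable D (f ^~ t)}.
Proof.
move=> mf fs.
have ma k : measurable_fun setT (fun t => `|(f k t)%:E|)%E.
  by apply: measurableT_comp => //; exact/measurable_EFinP.
have mi : measurable_fun setT (fun t => \esum_(k in D) `|(f k t)%:E|)%E.
  exact: measurable_esum.
have /integrable_ae : P.-integrable setT (fun t => \esum_(k in D) `|(f k t)%:E|)%E.
  apply/integrableP; split=> //.
  under eq_integral => t _ do rewrite gee0_abs ?esum_ge0//.
  by rewrite integral_esum.
move=> /(_ measurableT); apply: filterS => t /(_ I).
by rewrite /summable ge0_fin_numE// esum_ge0.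
Qed.

Lemma integral_rsum0 (D : set nat) (f : nat -> T -> R) :
  (forall k, measurable_fun setT (f k)) ->
  (\esum_(k in D) \int[P]_t `|(f k t)%:E| < +oo)%E ->
  (forall k, D k -> \int[P]_t (f k t)%:E = 0)%E ->
  P.-integrable setT (fun t => (rsum D (f ^~ t))%:E) /\
  (\int[P]_t (rsum D (f ^~ t))%:E = 0)%E.
Proof.
move=> mf fs f0.
have ma k : measurable_fun setT (fun t => `|(f k t)%:E|)%E.
  by apply: measurableT_comp => //; exact/measurable_EFinP.
pose p k t : \bar R := (Num.max (f k t) 0)%:E.
pose n k t : \bar R := (Num.max (- f k t) 0)%:E.
have p0 k t : (0 <= p k t)%E by rewrite lee_fin le_max lexx orbT.
have n0 k t : (0 <= n k t)%E by rewrite lee_fin le_max lexx orbT.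
have mp k : measurable_fun setT (p k).
  by apply/measurable_EFinP; apply: measurable_maxr.
have mn k : measurable_fun setT (n k).
  by apply/measurable_EFinP; apply: measurable_maxr => //; exact: measurable_funN.
have pa k t : (p k t <= `|(f k t)%:E|)%E.
  by rewrite lee_fin ge_max normr_ge0 ler_norm.
have na k t : (n k t <= `|(f k t)%:E|)%E.
  by rewrite lee_fin ge_max normr_ge0 -normrN ler_norm.
have pf : (\int[P]_t (\esum_(k in D) p k t) < +oo)%E.
  rewrite integral_esum//; apply: le_lt_trans fs; apply: le_esum => k Dk.
  exact: ge0_le_integral.
have nf : (\int[P]_t (\esum_(k in D) n k t) < +oo)%E.
  rewrite integral_esum//; apply: le_lt_trans fs; apply: le_esum => k Dk.
  exact: ge0_le_integral.
have pn : (\int[P]_t (\esum_(k in D) p k t) = \int[P]_t (\esum_(k in D) n k t))%E.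
  rewrite !integral_esum//; apply: eq_esum => k Dk.
  have fk := f0 _ Dk; have fint : P.-integrable setT (EFin \o f k).
    apply/integrableP; split; first exact/measurable_EFinP.
    apply: le_lt_trans fs.
    rewrite -[leLHS](@esum_set1 _ _ k (fun k => \int[P]_t `|(f k t)%:E|)%E);
      last exact: integral_ge0.
    rewrite esum_mkcond [leRHS]esum_mkcond; apply: le_esum => i _.
    case: ifPn => [/set_mem ->|_]; first by rewrite mem_set.
    by case: ifPn => // _; exact: integral_ge0.
  have := fk; rewrite integralE.
  have -> : (fun t => (f k t)%:E)^\+%E = p k.
    by apply/funext => t; rewrite funeposE /p EFin_max.
  have -> : (fun t => (f k t)%:E)^\-%E = n k.
    by apply/funext => t; rewrite funenegE /n EFin_max.
  have pkf : (\int[P]_t p k t \is a fin_num)%E.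
    rewrite ge0_fin_numE; last exact: integral_ge0.
    move/integrableP: fint => [_]; apply: le_lt_trans.
    by apply: ge0_le_integral => //; exact: ma.
  have nkf : (\int[P]_t n k t \is a fin_num)%E.
    rewrite ge0_fin_numE; last exact: integral_ge0.
    move/integrableP: fint => [_]; apply: le_lt_trans.
    by apply: ge0_le_integral => //; exact: ma.
  by move=> /eqP; rewrite sube_eq ?add0e ?fin_num_adde_defr// => /eqP.
have ip : P.-integrable setT (fun t => \esum_(k in D) p k t).
  apply/integrableP; split; first exact: measurable_esum.
  by under eq_integral => t _ do rewrite gee0_abs ?esum_ge0//.
have iN : P.-integrable setT (fun t => \esum_(k in D) n k t).
  apply/integrableP; split; first exact: measurable_esum.
  by under eq_integral => t _ do rewrite gee0_abs ?esum_ge0//.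
have E : ae_eq P setT (fun t => (rsum D (f ^~ t))%:E)
    (fun t => \esum_(k in D) p k t - \esum_(k in D) n k t)%E.
  have [ap an] := (integrable_ae measurableT ip, integrable_ae measurableT iN).
  apply: filterS2 ap an => t /(_ I) pt /(_ I) nt _.
  by rewrite /rsum EFinB !fineK.
have mr : measurable_fun setT (fun t => (rsum D (f ^~ t))%:E).
  by apply/measurable_EFinP; exact: measurable_rsum.
split.
  have fle (x : \bar R) : (0 <= x -> (fine x)%:E <= x)%E.
    by case: x => //= [r|] _; rewrite ?leey.
  apply: (le_integrable measurableT mr _ (integrableD measurableT ip iN)) => t _.
  have pt : (0 <= \esum_(k in D) p k t)%E by exact: esum_ge0.
  have nt : (0 <= \esum_(k in D) n k t)%E by exact: esum_ge0.
  rewrite [leRHS]gee0_abs ?adde_ge0// /rsum.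
  apply: le_trans (leeD (fle _ pt) (fle _ nt)).
  rewrite -EFinD lee_fin; apply: le_trans (ler_normB _ _) _.
  by rewrite !ger0_norm// fine_ge0.
transitivity (\int[P]_t (\esum_(k in D) p k t - \esum_(k in D) n k t))%E.
  apply: ae_eq_integral => //.
  by apply: emeasurable_funB; exact: measurable_esum.
rewrite integralB// pn subee// ge0_fin_numE ?nf//.
by apply: integral_ge0 => t _; exact: esum_ge0.
Qed.

End measurable_sums.

(** * Independence *)

Section decoupling.
Context d d1 d2 (T : measurableType d) (E1 : measurableType d1)
  (E2 : measurableType d2) (R : realType) (P : probability T R).

Lemma integral_indep_pair (X : {mfun T >-> E1}) (V : {mfun T >-> E2})
    (f : E1 * E2 -> \bar R) :
  (forall A B, measurable A -> measurable B ->
    P (X @^-1` A `&` V @^-1` B) = (P (X @^-1` A) * P (V @^-1` B))%E) ->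
  measurable_fun setT f -> (forall z, 0 <= f z)%E ->
  (\int[P]_t f (X t, V t) = \int[P]_s (\int[P]_t f (X s, V t)))%E.
Proof.
move=> XV mf f0.
pose m1 := distribution P X; pose m2 := distribution P V.
have mXV : measurable_fun setT (fun t => (X t, V t)).
  exact/measurable_fun_pair.
pose XV' : {mfun T >-> (E1 * E2)%type} :=
  HB.pack (fun t => (X t, V t)) (isMeasurableFun.Build _ _ _ _ _ mXV).
pose m := distribution P XV'.
transitivity (\int[m]_z f z)%E.
  by rewrite ge0_integral_pushforward.
have mE A : measurable A -> m A = (m1 \x m2)%E A.
  by move=> mA; apply/esym/product_measure_unique.
rewrite (eq_measure_integral (m1 \x m2)%E); last first.
  by move=> A mA _; exact: mE.
rewrite fubini_tonelli1// ge0_integral_pushforward//; last 2 first.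
- exact: measurable_fun_fubini_tonelli_F.
- by move=> x _; apply: integral_ge0.
apply: eq_integral => s _ /=.
rewrite /fubini_F ge0_integral_pushforward//.
by apply: measurableT_comp => //; exact: measurable_pair1.
Qed.

End decoupling.

Section generated_sigma_algebra.
Context d d' (T : measurableType d) (E : measurableType d') (R : realType)
  (P : probability T R) (I : eqType) (M : I -> T -> E).

Definition sigma_events (D : set I) : set (set T) :=
  [set A | exists i B, [/\ D i, measurable B & A = M i @^-1` B]].

Definition sigma_space (D : set I) := g_sigma_algebraType (sigma_events D).

Lemma measurable_sigma_space d3 (E' : measurableType d3) (D : set I) i
    (g : E -> E') : D i -> measurable_fun setT g ->
  measurable_fun setT ((fun t => g (M i t)) : sigma_space D -> E').
Proof.
move=> Di mg; have mM : measurable_fun setT (M i : sigma_space D -> E).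
  move=> _ B mB; rewrite setTI; apply: sub_sigma_algebra.
  by exists i, B.
exact: measurableT_comp mg mM.
Qed.

Lemma measurable_id_sigma_space (D : set I) :
  (forall i, D i -> measurable_fun setT (M i)) ->
  measurable_fun setT (id : T -> sigma_space D).
Proof.
move=> mM; apply: (@measurability _ _ _ (sigma_space D) _ _ (sigma_events D)) => //.
move=> _ [_ [i [B [Di mB ->]]] <-].
exact: (mM i Di measurableT B mB).
Qed.

Lemma sub_sigma_space_id (D D' : set I) : D `<=` D' ->
  measurable_fun setT (id : sigma_space D' -> sigma_space D).
Proof.
move=> DD'; apply: (@measurability _ _ _ (sigma_space D) _ _ (sigma_events D)) => //.
move=> _ [_ [i [B [Di mB ->]]] <-]; rewrite setTI.
by apply: sub_sigma_algebra; exists i, B; split=> //; exact: DD'.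
Qed.

Hypothesis mM : forall i, measurable_fun setT (M i).
Hypothesis indepM : mutually_independent P M.

Let cylinders (D : set I) : set (set T) :=
  [set C | exists (s : seq I) (A : I -> set E), [/\ uniq s,
    forall i, measurable (A i), forall i, i \in s -> D i &
    C = \bigcap_(i in [set` s]) M i @^-1` A i]].

Let cylinders_setI D : setI_closed (cylinders D).
Proof.
move=> _ _ [s1 [A1 [u1 mA1 D1 ->]]] [s2 [A2 [u2 mA2 D2 ->]]].
exists (undup (s1 ++ s2)), (fun i => (if i \in s1 then A1 i else setT) `&`
  (if i \in s2 then A2 i else setT)); split.
- exact: undup_uniq.
- by move=> i; apply: measurableI; case: ifP.
- by move=> i; rewrite mem_undup mem_cat => /orP[/D1|/D2].
apply/seteqP; split=> [t [h1 h2] i /= _|t h].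
  by split; case: ifPn => // ?; [exact: h1|exact: h2].
by split=> i /= is_; have /= := h i; rewrite mem_undup mem_cat is_ ?orbT;
  move=> /(_ isT) [].
Qed.

Let cylinders_setT D : cylinders D setT.
Proof.
exists [::], (fun=> setT); split=> //.
by apply/seteqP; split.
Qed.

Let sub_cylinders D : <<s sigma_events D >> `<=` <<s cylinders D >>.
Proof.
apply: sub_smallest2r => //= A [i [B [Di mB ->]]].
exists [:: i], (fun=> B); split=> //.
  by move=> j; rewrite inE => /eqP->.
apply/seteqP; split=> [t ? j /=|t h]; first by rewrite inE => /eqP->.
by apply: (h i); rewrite /= inE.
Qed.

Let cylinders_measurable D : cylinders D `<=` measurable.
Proof.
move=> _ [s [A [_ mA _ ->]]]; apply: fin_bigcap_measurable => // i _.
by rewrite -[X in measurable X]setTI; exact: mM.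
Qed.

Lemma indep_sigma_space (D1 D2 : set I) : D1 `&` D2 = set0 ->
  forall A B, <<s sigma_events D1 >> A -> <<s sigma_events D2 >> B ->
  P (A `&` B) = (P A * P B)%E.
Proof.
move=> D12.
have step (C D : set (set T)) : setI_closed C -> C setT -> C `<=` measurable ->
    D `<=` measurable ->
    (forall A B, C A -> D B -> P (A `&` B) = (P A * P B)%E) ->
    forall A B, <<s C >> A -> D B -> P (A `&` B) = (P A * P B)%E.
  move=> CI CT Cm Dm CD A B sA DB.
  have mB := Dm _ DB.
  have PB0 : 0 <= fine (P B) by rewrite fine_ge0.
  pose m1 : {measure set T -> \bar R} := mrestr P mB.
  pose m2 : {measure set T -> \bar R} := mscale (NngNum PB0) P.
  have m1E X : m1 X = P (X `&` B) by [].
  have m2E X : m2 X = (P B * P X)%E.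
    by rewrite -[in RHS](fineK (fin_num_measure P B mB)).
  suff : m1 A = m2 A by rewrite m1E m2E muleC.
  apply: (g_sigma_algebra_measure_unique C Cm (fun=> setT)) => //.
  - by rewrite bigcup_const.
  - by move=> X CX; rewrite m1E m2E CD// muleC.
  - move=> _; rewrite m1E setTI.
    by rewrite (le_lt_trans (probability_le1 P mB)) ?ltry.
have base B1 B2 : cylinders D1 B1 -> cylinders D2 B2 -> P (B1 `&` B2) = (P B1 * P B2)%E.
  move=> [s1 [A1 [u1 mA1 h1 ->]]] [s2 [A2 [u2 mA2 h2 ->]]].
  have dis i : i \in s1 -> i \in s2 -> False.
    move=> /h1 i1 /h2 i2; have : (D1 `&` D2) i by [].
    by rewrite D12.
  pose A i := if i \in s1 then A1 i else A2 i.
  have e1 : \bigcap_(i in [set` s1]) M i @^-1` A1 i =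
      \bigcap_(i in [set` s1]) M i @^-1` A i.
    by apply: eq_bigcapr => i /= is1; rewrite /A is1.
  have e2 : \bigcap_(i in [set` s2]) M i @^-1` A2 i =
      \bigcap_(i in [set` s2]) M i @^-1` A i.
    apply: eq_bigcapr => i /= is2; rewrite /A; case: ifPn => // is1.
    by case: (dis i).
  have mA i : measurable (A i) by rewrite /A; case: ifP.
  have -> : \bigcap_(i in [set` s1]) M i @^-1` A1 i `&`
      \bigcap_(i in [set` s2]) M i @^-1` A2 i =
      \bigcap_(i in [set` s1 ++ s2]) M i @^-1` A i.
    rewrite e1 e2 -bigcap_setU; congr bigcap.
    by apply/seteqP; split=> i /=; rewrite mem_cat => /orP.
  rewrite e1 e2 !indepM// ?big_cat//=.
  rewrite cat_uniq u1 u2 andbT /=; apply/hasPn => i is2.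
  by apply/negP => is1; exact: (dis i).
move=> A B /sub_cylinders sA /sub_cylinders sB.
have sm D : <<s cylinders D >> `<=` measurable.
  apply: smallest_sub; first exact: sigma_algebra_measurable.
  exact: cylinders_measurable.
apply: (step (cylinders D1) <<s cylinders D2 >>) => // {A B sA sB}.
move=> A B cA sB; rewrite setIC muleC.
by apply: (step (cylinders D2) (cylinders D1)) => // B' A' cB' cA';
  rewrite setIC muleC base.
Qed.

Lemma integral_decoupling (D1 D2 : set I) (f : T -> T -> \bar R) :
  D1 `&` D2 = set0 ->
  measurable_fun setT
    ((fun z => f z.1 z.2) : sigma_space D1 * sigma_space D2 -> \bar R) ->
  (forall s t, 0 <= f s t)%E ->
  (\int[P]_t f t t = \int[P]_s (\int[P]_t f s t))%E.
Proof.
move=> D12 mf f0.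
have m1 := @measurable_id_sigma_space D1 (fun i _ => mM i).
have m2 := @measurable_id_sigma_space D2 (fun i _ => mM i).
pose X1 : {mfun T >-> sigma_space D1} :=
  HB.pack (id : T -> sigma_space D1) (isMeasurableFun.Build _ _ _ _ _ m1).
pose X2 : {mfun T >-> sigma_space D2} :=
  HB.pack (id : T -> sigma_space D2) (isMeasurableFun.Build _ _ _ _ _ m2).
rewrite -(@integral_indep_pair _ _ _ _ _ _ _ P X1 X2 (fun z => f z.1 z.2))//.
by move=> A B mA mB; exact: (indep_sigma_space D12).
Qed.

Lemma measurable_integral_decoupling (D1 D2 : set I) (f : T -> T -> \bar R) :
  measurable_fun setT
    ((fun z => f z.1 z.2) : sigma_space D1 * sigma_space D2 -> \bar R) ->
  (forall s t, 0 <= f s t)%E ->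
  measurable_fun setT (fun s => \int[P]_t f s t)%E.
Proof.
move=> mf f0.
have m1 := @measurable_id_sigma_space D1 (fun i _ => mM i).
have m2 := @measurable_id_sigma_space D2 (fun i _ => mM i).
have mf' : measurable_fun setT (fun z : T * T => f z.1 z.2).
  apply: (measurableT_comp mf (g := fun z : T * T =>
    (z.1, z.2) : sigma_space D1 * sigma_space D2)).
  apply/measurable_fun_pair.
    exact: (measurableT_comp m1 measurable_fst).
  exact: (measurableT_comp m2 measurable_snd).
exact: (measurable_fun_fubini_tonelli_F (m2 := P)
  (fun z : T * T => f z.1 z.2) mf' (fun z => f0 _ _)).
Qed.

End generated_sigma_algebra.

Lemma cvg_powR (R : realType) (u : nat -> R) (l q : R) : 1 <= q ->
  (forall n, 0 <= u n) -> u @ \oo --> l -> u n `^ q @[n --> \oo] --> l `^ q.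
Proof.
move=> q1 u0 ul; have q0 : 0 <= q by rewrite (le_trans ler01).
have l0 : 0 <= l.
  by rewrite -(cvg_lim _ ul)//; apply: limr_ge; [exact: cvgP ul|near=> n].
have dl : (fun n => `|u n - l|) @ \oo --> (0 : R).
  by rewrite -(normr0 R) -(subrr l); apply: cvg_norm; apply: cvgB => //; exact: cvg_cst.
have low : (fun n => l `^ q - q * l `^ (q - 1) * `|u n - l|) @ \oo --> l `^ q.
  rewrite -[X in _ --> X]subr0 -[X in _ --> _ - X](mulr0 (q * l `^ (q - 1))).
  by apply: cvgB; [exact: cvg_cst|apply: cvgMr].
have upp : (fun n => l `^ q + q * (l + 1) `^ (q - 1) * `|u n - l|) @ \oo --> l `^ q.
  rewrite -[X in _ --> X]addr0 -[X in _ --> _ + X](mulr0 (q * (l + 1) `^ (q - 1))).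
  by apply: cvgD; [exact: cvg_cst|apply: cvgMr].
apply: (squeeze_cvgr _ low upp); near=> n; apply/andP; split.
  apply: le_trans (powR_tangent q1 l0 (u0 n)).
  rewrite lerD2l -mulrN ler_wpM2l// ?mulr_ge0 ?powR_ge0//.
  by rewrite lerNl -normrN ler_norm.
have ul1 : u n <= l + 1.
  have : `|u n - l| < 1.
    by near: n; move/cvgrPdist_lt : dl => /(_ 1 ltr01); apply: filterS => n /=;
      rewrite sub0r normrN normr_id.
  by move=> h; have := ler_norm (u n - l); lra.
have := powR_tangent q1 (u0 n) l0.
have : q * u n `^ (q - 1) * (u n - l) <= q * (l + 1) `^ (q - 1) * `|u n - l|.
  apply: (@le_trans _ _ (q * u n `^ (q - 1) * `|u n - l|)).
    by rewrite ler_wpM2l ?ler_norm// mulr_ge0 ?powR_ge0.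
  rewrite ler_wpM2r// ler_wpM2l// ge0_ler_powR ?nnegrE ?subr_ge0//.
  by rewrite addr_ge0.
set a := q * u n `^ (q - 1); set b := q * _ * _; rewrite !mulrBr.
lra.
Unshelve. all: by end_near. Qed.

Section integral_inequalities.
Context d (T : measurableType d) (R : realType) (P : probability T R).

Lemma measurable_powR_EFin (X : T -> R) q : measurable_fun setT X ->
  measurable_fun setT (fun t => (X t `^ q)%:E).
Proof.
by move=> mX; apply/measurable_EFinP; exact: (measurableT_comp (measurable_powR q)).
Qed.

Lemma ge0_le_integral_integrable (f g : T -> \bar R) :
  P.-integrable setT g -> measurable_fun setT f -> (forall t, 0 <= f t)%E ->
  (forall t, g t <= f t)%E -> (\int[P]_t g t <= \int[P]_t f t)%E.
Proof.
move=> ig mf f0 gf.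
have [foo|] := eqVneq (\int[P]_t f t)%E +oo%E; first by rewrite foo leey.
rewrite -ltey => fy.
apply: le_integral => //; apply/integrableP; split=> //.
by under eq_integral => t _ do rewrite gee0_abs//.
Qed.

Lemma le_integral_norm_translate (q a : R) (B : T -> R) : 1 <= q ->
  P.-integrable setT (EFin \o B) -> (\int[P]_t (B t)%:E = 0)%E ->
  ((`|a| `^ q)%:E <= \int[P]_t (`|a + B t| `^ q)%:E)%E.
Proof.
move=> q1 iB B0; have [c hc] := powR_norm_subgradient a q1.
have mB : measurable_fun setT B by apply/measurable_EFinP; exact: measurable_int iB.
have icB : P.-integrable setT (fun t => (c%:E * (B t)%:E)%E).
  exact: integrableZl.
have iA : P.-integrable setT (fun=> (`|a| `^ q)%:E).
  exact: finite_measure_integrable_cst.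
apply: (@le_trans _ _ (\int[P]_t ((`|a| `^ q)%:E + c%:E * (B t)%:E))%E).
  rewrite integralD// integralZl// B0 mule0 adde0 integral_cst//.
  by rewrite [X in (_ * X)%E]probability_setT mule1.
apply: ge0_le_integral_integrable => //.
- exact: integrableD.
- apply: measurable_powR_EFin.
  by apply: measurableT_comp => //; exact: measurable_funD.
- by move=> t; rewrite -EFinM -EFinD lee_fin.
Qed.

Lemma fatou_bound (f : (T -> R)^nat) (g : T -> R) (C : \bar R) :
  (forall n, measurable_fun setT (f n)) -> measurable_fun setT g ->
  (forall n t, 0 <= f n t) -> (forall t, 0 <= g t) ->
  {ae P, forall t, f ^~ t @ \oo --> g t} ->
  (forall n, \int[P]_t (f n t)%:E <= C)%E -> (\int[P]_t (g t)%:E <= C)%E.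
Proof.
move=> mf mg f0 g0 fg fC.
have mef n : measurable_fun setT (fun t => (f n t)%:E) by exact/measurable_EFinP.
apply: (@le_trans _ _ (limn_einf (fun n => \int[P]_t (f n t)%:E)%E)); last first.
  rewrite limn_einf_lim; apply: lime_le; first exact: is_cvg_einfs.
  near=> n; apply: le_trans (fC n); apply: ereal_inf_lbound.
  by exists n => /=.
apply: le_trans (fatou P measurableT mef (fun n t _ => f0 n t)).
apply: ae_ge0_le_integral => //.
- by move=> t _; rewrite lee_fin.
- exact/measurable_EFinP.
- move=> t _; rewrite limn_einf_lim; apply: lime_ge; first exact: is_cvg_einfs.
  by near=> n; apply: le_ereal_inf_tmp => _ [k _ <-]; rewrite lee_fin.
- rewrite (_ : (fun _ => _) =
    fun t => (- limn_esup (fun n => - (f n t)%:E))%E); last exact/funext.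
  apply: measurableT_comp => //; apply: measurable_fun_limn_esup => n.
  exact: measurableT_comp.
apply: filterS fg => t ft _.
have ft' : (f n t)%:E @[n --> \oo] --> (g t)%:E by apply: cvg_EFin => //; near=> n.
rewrite is_cvg_limn_einfE; last by apply/cvg_ex; exists (g t)%:E.
by rewrite (cvg_lim _ ft').
Unshelve. all: by end_near. Qed.

End integral_inequalities.

(** * Marcinkiewicz-Zygmund inequalities *)

Section randomized_signs.
Context d (T : measurableType d) (R : realType) (P : probability T R).
Implicit Types (X : nat -> T -> R) (a : T -> R) (s : seq nat).

Definition signed X (e : nat -> bool) k t : R := if e k then X k t else - X k t.

Lemma measurable_norm_powR (q : R) a : measurable_fun setT a ->
  measurable_fun setT (fun t => (`|a t| `^ q)%:E).
Proof.
move=> ma; apply: measurable_powR_EFin.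
exact: measurableT_comp.
Qed.

Lemma measurable_rademacher_mean (q : R) X a s : measurable_fun setT a ->
  (forall k, measurable_fun setT (X k)) ->
  measurable_fun setT (fun t =>
    rademacher_mean (fun x => `|x| `^ q) (a t) [seq X k t | k <- s]).
Proof.
move=> ma mX; elim: s a ma => [|k s IH] a ma /=.
  by apply/measurable_EFinP; exact: measurable_norm_powR.
apply: measurable_funM => //; apply: measurable_funD.
  by apply: (IH (fun t => a t + X k t)); exact: measurable_funD.
by apply: (IH (fun t => a t - X k t)); exact: measurable_funB.
Qed.

Let mean_half (f g : T -> R) : measurable_fun setT f -> measurable_fun setT g ->
  (forall t, 0 <= f t) -> (forall t, 0 <= g t) ->
  (\int[P]_t ((f t + g t) / 2)%:E =
   2^-1%:E * (\int[P]_t (f t)%:E + \int[P]_t (g t)%:E))%E.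
Proof.
move=> mf mg f0 g0.
rewrite -ge0_integralD//; last 4 first.
- by move=> t _; rewrite lee_fin.
- exact/measurable_EFinP.
- by move=> t _; rewrite lee_fin.
- exact/measurable_EFinP.
rewrite -ge0_integralZl_EFin//.
- by apply: eq_integral => t _; rewrite -EFinD -EFinM mulrC.
- by move=> t _; rewrite -EFinD lee_fin addr_ge0.
- by apply/measurable_EFinP; exact: measurable_funD.
Qed.

Let half_le (x y B : \bar R) : (0 <= x)%E -> (0 <= y)%E ->
  (x <= B)%E -> (y <= B)%E -> (2^-1%:E * (x + y) <= B)%E.
Proof.
case: B => [b| |]; last 2 first.
- by move=> *; rewrite leey.
- by move=> x0 y0 /(le_trans x0).
case: x => // x x0; case: y => // y y0; rewrite -EFinD -EFinM !lee_fin; lra.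
Qed.

Let half_ge (x y B : \bar R) : (0 <= B)%E ->
  (B <= x)%E -> (B <= y)%E -> (B <= 2^-1%:E * (x + y))%E.
Proof.
case: B => [b| |]//.
  move=> b0; case: x => // [x|]; case: y => // [y|] bx; rewrite ?addey// ?addye//.
  - by rewrite -EFinD -EFinM; move: bx; rewrite !lee_fin; lra.
  - by rewrite gt0_muley// leey.
  - by rewrite gt0_muley// leey.
  - by rewrite gt0_muley// leey.
by move=> _; rewrite !leye_eq => /eqP-> /eqP->; rewrite addey// gt0_muley.
Qed.

Let split_signs X a k s e : k \notin s -> forall b t,
  a t + \sum_(j <- k :: s) signed X (fun j => if j == k then b else e j) j t =
  (a t + (if b then X k t else - X k t)) + \sum_(j <- s) signed X e j t.
Proof.
move=> ks b t; rewrite big_cons addrA /signed eqxx; congr (_ + _).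
rewrite !big_seq; apply: eq_bigr => j js.
by case: eqP js => // ->; rewrite (negbTE ks).
Qed.

Lemma integral_rademacher_mean_le (q : R) X a s (B : \bar R) :
  measurable_fun setT a -> (forall k, measurable_fun setT (X k)) -> uniq s ->
  (forall e, \int[P]_t (`|a t + \sum_(k <- s) signed X e k t| `^ q)%:E <= B)%E ->
  (\int[P]_t (rademacher_mean (fun x => `|x| `^ q) (a t)
     [seq X k t | k <- s])%:E <= B)%E.
Proof.
move=> + mX; elim: s a => [|k s IH] a ma /= us H.
  by have := H xpredT; under eq_integral => t _ do rewrite big_nil addr0.
have /andP[ks us'] := us.
have r0 b t : 0 <= rademacher_mean (fun x => `|x| `^ q) b [seq X k t | k <- s].
  by apply: rademacher_mean_ge0 => x; exact: powR_ge0.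
rewrite mean_half//; last 2 first.
- by apply: measurable_rademacher_mean => //; exact: measurable_funD.
- by apply: measurable_rademacher_mean => //; exact: measurable_funB.
apply: half_le; [by apply: integral_ge0 => t _; rewrite lee_fin..| |].
  apply: (IH (fun t => a t + X k t) (measurable_funD ma (mX k)) us').
  move=> e; have := H (fun j => if j == k then true else e j).
  by under eq_integral => t _ do rewrite split_signs//.
apply: (IH (fun t => a t - X k t) (measurable_funB ma (mX k)) us').
move=> e; have := H (fun j => if j == k then false else e j).
by under eq_integral => t _ do rewrite split_signs//.
Qed.

Lemma integral_rademacher_mean_ge (q : R) X a s (B : \bar R) : (0 <= B)%E ->
  measurable_fun setT a -> (forall k, measurable_fun setT (X k)) -> uniq s ->
  (forall e, B <= \int[P]_t (`|a t + \sum_(k <- s) signed X e k t| `^ q)%:E)%E ->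
  (B <= \int[P]_t (rademacher_mean (fun x => `|x| `^ q) (a t)
     [seq X k t | k <- s])%:E)%E.
Proof.
move=> B0 + mX; elim: s a => [|k s IH] a ma /= us H.
  by have := H xpredT; under eq_integral => t _ do rewrite big_nil addr0.
have /andP[ks us'] := us.
have r0 b t : 0 <= rademacher_mean (fun x => `|x| `^ q) b [seq X k t | k <- s].
  by apply: rademacher_mean_ge0 => x; exact: powR_ge0.
rewrite mean_half//; last 2 first.
- by apply: measurable_rademacher_mean => //; exact: measurable_funD.
- by apply: measurable_rademacher_mean => //; exact: measurable_funB.
apply: half_ge => //.
  apply: (IH (fun t => a t + X k t) (measurable_funD ma (mX k)) us').
  move=> e; have := H (fun j => if j == k then true else e j).
  by under eq_integral => t _ do rewrite split_signs//.
apply: (IH (fun t => a t - X k t) (measurable_funB ma (mX k)) us').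
move=> e; have := H (fun j => if j == k then false else e j).
by under eq_integral => t _ do rewrite split_signs//.
Qed.

End randomized_signs.

Section marcinkiewicz_zygmund.
Context d d' (T : measurableType d) (E : measurableType d') (R : realType)
  (P : probability T R) (M : nat -> T -> E).
Hypothesis mM : forall i, measurable_fun setT (M i).
Hypothesis indepM : mutually_independent P M.

Lemma measurable_sigma_spaceT d3 (E' : measurableType d3) (D : set nat)
    (f : T -> E') :
  measurable_fun setT (f : sigma_space M D -> E') -> measurable_fun setT f.
Proof.
move=> mf; have mid := @measurable_id_sigma_space _ _ _ _ _ M D (fun i _ => mM i).
exact: measurableT_comp mf mid.
Qed.

Lemma measurable_sigma_spaceS d3 (E' : measurableType d3) (D D' : set nat)
    (f : T -> E') : D `<=` D' ->
  measurable_fun setT (f : sigma_space M D -> E') ->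
  measurable_fun setT (f : sigma_space M D' -> E').
Proof.
move=> DD' mf; have mid := @sub_sigma_space_id _ _ _ _ _ M D D' DD'.
exact: measurableT_comp mf mid.
Qed.

Lemma le_integral_norm_add_indep (q : R) (D1 D2 : set nat) (A B : T -> R) :
  1 <= q -> D1 `&` D2 = set0 ->
  measurable_fun setT (A : sigma_space M D1 -> R) ->
  measurable_fun setT (B : sigma_space M D2 -> R) ->
  P.-integrable setT (EFin \o B) -> (\int[P]_t (B t)%:E = 0)%E ->
  (\int[P]_t (`|A t| `^ q)%:E <= \int[P]_t (`|A t + B t| `^ q)%:E)%E.
Proof.
move=> q1 D12 mA mB iB B0.
have mT := measurable_sigma_spaceT.
have mf : measurable_fun setT ((fun z => (`|A z.1 + B z.2| `^ q)%:E) :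
    sigma_space M D1 * sigma_space M D2 -> \bar R).
  apply: measurable_norm_powR; apply: measurable_funD.
    exact: (measurableT_comp mA (@measurable_fst _ _ (sigma_space M D1) (sigma_space M D2))).
  exact: (measurableT_comp mB (@measurable_snd _ _ (sigma_space M D1) (sigma_space M D2))).
rewrite (@integral_decoupling _ _ _ _ _ P _ M mM indepM D1 D2
  (fun s t => (`|A s + B t| `^ q)%:E))//.
apply: ge0_le_integral => //.
- by apply: measurable_norm_powR; exact: mT mA.
- exact: (@measurable_integral_decoupling _ _ _ _ _ P _ M mM D1 D2
    (fun s t => (`|A s + B t| `^ q)%:E) mf).
by move=> s _; exact: le_integral_norm_translate.
Qed.

Variable X : nat -> T -> R.
Hypothesis mX : forall k,
  measurable_fun setT (X k : sigma_space M [set k] -> R).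
Hypothesis iX : forall k, P.-integrable setT (EFin \o X k).
Hypothesis X0 : forall k, (\int[P]_t (X k t)%:E = 0)%E.

Let mXT k : measurable_fun setT (X k) := measurable_sigma_spaceT (@mX k).

Let msum N (D : set nat) : measurable_fun setT
  ((fun t => \sum_(k < N) (if (k : nat) \in D then X k t else 0)) :
    sigma_space M D -> R).
Proof.
apply: measurable_sum => k; case: (boolP ((k : nat) \in D)) => [/set_mem kD|_].
  by apply: measurable_sigma_spaceS (@mX k) => _ ->.
exact: measurable_cst.
Qed.

Let isum N (D : set nat) : P.-integrable setT
  (EFin \o (fun t => \sum_(k < N) (if (k : nat) \in D then X k t else 0))).
Proof.
rewrite (_ : _ \o _ = fun t => (\sum_(k < N)
    (if (k : nat) \in D then X k t else 0)%:E)%E); last first.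
  by apply/funext => t /=; rewrite sumEFin.
apply: integrable_sum => // k _.
by case: ((k : nat) \in D); [exact: iX|exact: integrable0].
Qed.

Let sum0 N (D : set nat) :
  (\int[P]_t (\sum_(k < N) (if (k : nat) \in D then X k t else 0))%:E = 0)%E.
Proof.
under eq_integral => t _ do rewrite -sumEFin.
rewrite integral_sum//; last first.
  by move=> k; case: ((k : nat) \in D); [exact: iX|exact: integrable0].
rewrite big1// => k _; case: ((k : nat) \in D); first exact: X0.
exact: integral0.
Qed.

(* Each of the two parts of the sum, over the positive and over the negative
   signs, has by independence a norm at most that of the whole sum. *)
Lemma integral_signed_sum_le (q : R) (e : nat -> bool) N : 1 <= q ->
  (\int[P]_t (`|\sum_(k < N) signed X e k t| `^ q)%:E <=
   (2 `^ (q + 1))%:E * \int[P]_t (`|\sum_(k < N) X k t| `^ q)%:E)%E.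
Proof.
move=> q1; have q0 : 0 <= q by rewrite (le_trans ler01).
pose D := [set k | e k].
pose A t := \sum_(k < N) (if (k : nat) \in D then X k t else 0).
pose B t := \sum_(k < N) (if (k : nat) \in ~` D then X k t else 0).
have AB t : \sum_(k < N) X k t = A t + B t.
  rewrite -big_split; apply: eq_bigr => k _ /=.
  by rewrite in_setC; case: ifP; rewrite ?addr0 ?add0r.
have AmB t : \sum_(k < N) signed X e k t = A t - B t.
  rewrite -sumrB; apply: eq_bigr => k _; rewrite in_setC /signed.
  have -> : ((k : nat) \in D) = e k by apply/idP/idP => [/set_mem|/mem_set].
  by case: (e k); rewrite ?subr0 ?sub0r.
have mA := measurable_sigma_spaceT (@msum N D).
have mB := measurable_sigma_spaceT (@msum N (~` D)).
have S0 : (0 <= \int[P]_t (`|\sum_(k < N) X k t| `^ q)%:E)%E.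
  by apply: integral_ge0 => t _; rewrite lee_fin powR_ge0.
have hA : (\int[P]_t (`|A t| `^ q)%:E <=
    \int[P]_t (`|\sum_(k < N) X k t| `^ q)%:E)%E.
  under [leRHS]eq_integral => t _ do rewrite AB.
  exact: (@le_integral_norm_add_indep q D (~` D) A B q1 (setICr D) (@msum N D)
    (@msum N (~` D)) (isum N (~` D)) (sum0 N (~` D))).
have hB : (\int[P]_t (`|B t| `^ q)%:E <=
    \int[P]_t (`|\sum_(k < N) X k t| `^ q)%:E)%E.
  under [leRHS]eq_integral => t _ do rewrite AB addrC.
  exact: (@le_integral_norm_add_indep q (~` D) D B A q1 (setICl D)
    (@msum N (~` D)) (@msum N D) (isum N D) (sum0 N D)).
apply: (@le_trans _ _
  (\int[P]_t ((2 `^ q)%:E * ((`|A t| `^ q)%:E + (`|B t| `^ q)%:E))))%E.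
  apply: ge0_le_integral => //.
  - apply: measurable_norm_powR; rewrite (_ : (fun _ => _) = fun t => A t - B t).
      exact: measurable_funB.
    exact/funext.
  - apply: measurable_funeM; apply: emeasurable_funD;
      exact: measurable_norm_powR.
  move=> t _; rewrite AmB -EFinD -EFinM lee_fin.
  apply: le_trans (powRD_le q0 (normr_ge0 _) (normr_ge0 _)).
  by apply: ge0_ler_powR; rewrite ?nnegrE ?addr_ge0// ler_normB.
have mAq := measurable_norm_powR q mA; have mBq := measurable_norm_powR q mB.
rewrite ge0_integralZl_EFin ?powR_ge0//; last 2 first.
- by move=> t _; rewrite adde_ge0// lee_fin powR_ge0.
- exact: emeasurable_funD.
rewrite ge0_integralD//.
have -> : 2 `^ (q + 1) = 2 `^ q * 2 :> R.
  by rewrite powRD ?powRr1// pnatr_eq0 implybT.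
rewrite EFinM -muleA; apply: lee_wpmul2l; first by rewrite lee_fin powR_ge0.
rewrite mule_natl mule2n; exact: (leeD hA hB).
Qed.

Lemma integral_sqr_sum_powR_le (q : R) N : 1 <= q <= 2 ->
  ((4 / 9)%:E * \int[P]_t ((\sum_(k < N) X k t ^+ 2) `^ (q / 2))%:E <=
   (2 `^ (q + 1))%:E * \int[P]_t (`|\sum_(k < N) X k t| `^ q)%:E)%E.
Proof.
move=> q12; have /andP[q1 q2] := q12.
have mS : measurable_fun setT (fun t => (\sum_(k < N) X k t ^+ 2) `^ (q / 2)).
  apply: (measurableT_comp (measurable_powR (q / 2))).
  by apply: measurable_sum => k; exact: measurable_funX.
rewrite -ge0_integralZl_EFin//; last 2 first.
- by move=> t _; rewrite lee_fin powR_ge0.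
- exact/measurable_EFinP.
apply: le_trans (integral_rademacher_mean_le (q := q) (X := X) (a := cst 0)
  (s := iota 0 N) _ _ _ _); last 4 first.
- exact: measurable_cst.
- exact: mXT.
- exact: iota_uniq.
- move=> e; apply: le_trans (integral_signed_sum_le e N q1).
  rewrite le_eqVlt; apply/orP; left; apply/eqP; apply: eq_integral => t _.
  by rewrite add0r -[in LHS](subn0 N) big_mkord.
apply: ge0_le_integral => //.
- by move=> t _; rewrite -EFinM lee_fin mulr_ge0// powR_ge0.
- by apply: measurable_funeM; exact/measurable_EFinP.
- by apply/measurable_EFinP; apply: measurable_rademacher_mean => //; exact: mXT.
move=> t _; rewrite -EFinM lee_fin.
have /andP[+ _] := khintchine [seq X k t | k <- iota 0 N] q12.
by rewrite big_map -(big_mkord xpredT (fun k => X k t ^+ 2)) /index_iota subn0.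
Qed.

Lemma abs_summable_integral (D : set nat) :
  (\esum_(k in setT) \int[P]_t `|(X k t)%:E| < +oo)%E ->
  (\esum_(k in D) \int[P]_t `|(X k t)%:E| < +oo)%E.
Proof.
apply: le_lt_trans; rewrite esum_mkcond; apply: le_esum => k _.
by case: ifPn => // _; exact: integral_ge0.
Qed.

Lemma integral_sqr_rsum_powR_le (q : R) N : 1 <= q <= 2 ->
  (\esum_(k in setT) \int[P]_t `|(X k t)%:E| < +oo)%E ->
  ((4 / 9)%:E * \int[P]_t ((\sum_(k < N) X k t ^+ 2) `^ (q / 2))%:E <=
   (2 `^ (q + 1))%:E * \int[P]_t (`|rsum setT (X ^~ t)| `^ q)%:E)%E.
Proof.
move=> q12 sX; apply: le_trans (integral_sqr_sum_powR_le N q12) _.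
apply: lee_wpmul2l; first by rewrite lee_fin powR_ge0.
have /andP[q1 q2] := q12.
pose B t := rsum (~` `I_N) (X ^~ t).
have mB : measurable_fun setT (B : sigma_space M (~` `I_N) -> R).
  rewrite /B (_ : (fun _ => _) = fun t => rsum setT
      (fun k => if k \in ~` `I_N then X k t else 0)); last first.
    by apply/funext => t; rewrite rsum_mkcond.
  apply: measurable_rsum => k.
  case: (boolP (k \in _)) => [/set_mem kN|_]; last exact: measurable_cst.
  by apply: measurable_sigma_spaceS (@mX k) => _ ->.
have mA : measurable_fun setT
    ((fun t => \sum_(k < N) X k t) : sigma_space M `I_N -> R).
  apply: measurable_sum => k.
  by apply: measurable_sigma_spaceS (@mX k) => _ ->; exact: ltn_ord.
have [iB B0] := integral_rsum0 mXT (abs_summable_integral (~` `I_N) sX)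
  (fun k _ => X0 k).
apply: le_trans (le_integral_norm_add_indep q1 (setICr `I_N) mA mB iB B0) _.
rewrite le_eqVlt; apply/orP; left; apply/eqP.
have mBT := measurable_sigma_spaceT mB; have mAT := measurable_sigma_spaceT mA.
apply: ae_eq_integral => //.
- by apply: measurable_norm_powR; exact: measurable_funD.
- by apply: measurable_norm_powR; exact: measurable_rsum.
apply: filterS (ae_abs_summable mXT sX) => t st _.
by rewrite (rsumID `I_N st) rsum_I.
Qed.

End marcinkiewicz_zygmund.

Section marcinkiewicz_zygmund_upper.
Context d d' (T : measurableType d) (E : measurableType d') (R : realType)
  (P : probability T R) (M : nat -> T -> E).
Hypothesis mM : forall i, measurable_fun setT (M i).
Hypothesis indepM : mutually_independent P M.
Variable X : nat -> T -> R.
Hypothesis mX : forall k,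
  measurable_fun setT (X k : sigma_space M [set k] -> R).
Hypothesis iX : forall k, P.-integrable setT (EFin \o X k).
Hypothesis X0 : forall k, (\int[P]_t (X k t)%:E = 0)%E.

Let mXT k : measurable_fun setT (X k) := measurable_sigma_spaceT mM (@mX k).

Lemma integral_sum_powR_le (q : R) N : 1 <= q <= 2 ->
  (\int[P]_t (`|\sum_(k < N) X k t| `^ q)%:E <=
   (2 `^ (q + 2))%:E * \sum_(k < N) \int[P]_t (`|X k t| `^ q)%:E)%E.
Proof.
move=> q12; have /andP[q1 q2] := q12.
have q0 : 0 <= q by rewrite (le_trans ler01).
pose L := (\int[P]_t (`|\sum_(k < N) X k t| `^ q)%:E)%E.
have L0 : (0 <= L)%E by apply: integral_ge0 => t _; rewrite lee_fin powR_ge0.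
pose c : R := 2 `^ (q + 1).
have c0 : 0 < c by rewrite powR_gt0.
have H e : (c^-1%:E * L <= \int[P]_t (`|\sum_(k < N) signed X e k t| `^ q)%:E)%E.
  have mY k : measurable_fun setT (signed X e k : sigma_space M [set k] -> R).
    rewrite /signed; case: (e k); first exact: mX.
    exact: measurable_funN (@mX k).
  have iY k : P.-integrable setT (EFin \o signed X e k).
    rewrite /signed; case: (e k); first exact: iX.
    exact: integrableN (iX k).
  have Y0 k : (\int[P]_t (signed X e k t)%:E = 0)%E.
    rewrite /signed; case: (e k); first exact: X0.
    rewrite (eq_integral (fun t => (-1)%:E * (X k t)%:E)%E); last first.
      by move=> t _; rewrite -EFinM mulN1r.
    by rewrite integralZl ?X0 ?mule0//; exact: iX.
  have := integral_signed_sum_le mM indepM mY iY Y0 e N q1.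
  have -> : (\int[P]_t (`|\sum_(k < N) signed (signed X e) e k t| `^ q)%:E)%E = L.
    apply: eq_integral => t _; congr (`|_| `^ q)%:E; apply: eq_bigr => k _.
    by rewrite /signed; case: (e k); rewrite ?opprK.
  move=> Le; apply: le_trans (lee_wpmul2l _ Le) _.
    by rewrite lee_fin invr_ge0 ltW.
  by rewrite muleA -EFinM (mulVf (lt0r_neq0 c0)) mul1e lexx.
have : (c^-1%:E * L <= \int[P]_t (rademacher_mean (fun x => `|x| `^ q) 0
    [seq X k t | k <- iota 0 N])%:E)%E.
  have B0 : (0 <= c^-1%:E * L)%E.
    by apply: mule_ge0 => //; rewrite lee_fin invr_ge0 ltW.
  apply: (@integral_rademacher_mean_ge _ _ _ P q X (cst 0) _ _ B0
    (measurable_cst _) mXT (iota_uniq 0 N)) => e.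
  apply: le_trans (H e) _.
  rewrite le_eqVlt; apply/orP; left; apply/eqP; apply: eq_integral => t _.
  by rewrite add0r -[in RHS](subn0 N) big_mkord.
have mS : measurable_fun setT (fun t => (\sum_(k < N) X k t ^+ 2) `^ (q / 2)).
  apply: (measurableT_comp (measurable_powR (q / 2))).
  by apply: measurable_sum => k; exact: measurable_funX.
have : (\int[P]_t (rademacher_mean (fun x => `|x| `^ q) 0
    [seq X k t | k <- iota 0 N])%:E <=
    2%:E * \sum_(k < N) \int[P]_t (`|X k t| `^ q)%:E)%E.
  rewrite -ge0_integral_sum//; last first.
    by move=> k; exact: measurable_norm_powR.
  rewrite -ge0_integralZl_EFin//; last 2 first.
  - by move=> t _; apply: sume_ge0 => k _; rewrite lee_fin powR_ge0.
  - by apply: emeasurable_sum => k; exact: measurable_norm_powR.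
  apply: ge0_le_integral => //.
  - by move=> t _; rewrite lee_fin rademacher_mean_ge0// => x; exact: powR_ge0.
  - by apply/measurable_EFinP; exact: (@measurable_rademacher_mean _ _ _ q X (cst 0) _
      (measurable_cst _) mXT).
  - apply: measurable_funeM; apply: emeasurable_sum => k.
    exact: measurable_norm_powR.
  move=> t _; rewrite sumEFin -EFinM lee_fin.
  have /andP[_] := khintchine [seq X k t | k <- iota 0 N] q12.
  move=> /le_trans; apply; rewrite ler_pM2l//.
  rewrite big_map -(big_mkord xpredT (fun k => `|X k t| `^ q)) /index_iota subn0.
  rewrite -(big_map (fun k => X k t ^+ 2) xpredT id).
  apply: le_trans (@powR_sum_le _ (q / 2) _ _ _) _.
  - by apply/andP; split; lra.
  - by move=> x /mapP[k _ ->]; rewrite sqr_ge0.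
  rewrite big_map; apply: ler_sum => k _.
  by rewrite -[X k t ^+ 2]real_normK ?num_real// -powR_mulrn// -powRrM mulrC divfK.
move=> h1 h2; have := le_trans h2 h1.
rewrite lee_pdivrMl// muleA -EFinM => /le_trans; apply.
by rewrite /c -[X in 2 `^ _ * X](@powRr1 R)// -powRD ?pnatr_eq0 ?implybT// -addrA.
Qed.

Lemma integral_rsum_powR_le (q : R) : 1 <= q <= 2 ->
  (\esum_(k in setT) \int[P]_t `|(X k t)%:E| < +oo)%E ->
  (\int[P]_t (`|rsum setT (X ^~ t)| `^ q)%:E <=
   (2 `^ (q + 2))%:E * \esum_(k in setT) \int[P]_t (`|X k t| `^ q)%:E)%E.
Proof.
move=> q12 sX; have /andP[q1 q2] := q12.
apply: (@fatou_bound _ _ _ _ (fun n t => `|\sum_(k < n) X k t| `^ q)) => //.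
- move=> n; apply/measurable_EFinP; apply: measurable_norm_powR.
  exact: measurable_sum.
- apply/measurable_EFinP; apply: measurable_norm_powR.
  exact: measurable_rsum.
- apply: filterS (ae_abs_summable mXT sX) => t st.
  by apply: cvg_powR => //; apply: cvg_norm; exact: cvg_rsum.
move=> n; apply: le_trans (integral_sum_powR_le n q12) _.
apply: lee_wpmul2l; first by rewrite lee_fin powR_ge0.
rewrite -(@esum_I _ (fun k => \int[P]_t (`|X k t| `^ q)%:E)%E); last first.
  by move=> k; apply: integral_ge0.
rewrite esum_mkcond; apply: le_esum => k _; case: ifPn => // _.
exact: integral_ge0.
Qed.

End marcinkiewicz_zygmund_upper.

Section complex_numbers.
Context {R : realType}.
Implicit Types z w : R[i].

Lemma Re_mulc z w : complex.Re (z * w) =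
  complex.Re z * complex.Re w - complex.Im z * complex.Im w.
Proof. by case: z w => [a b] [c e]. Qed.

Lemma Im_mulc z w : complex.Im (z * w) =
  complex.Re z * complex.Im w + complex.Im z * complex.Re w.
Proof. by case: z w => [a b] [c e] /=. Qed.

Lemma Re_subc z w : complex.Re (z - w) = complex.Re z - complex.Re w.
Proof. by case: z w => [a b] [c e]. Qed.

Lemma Im_subc z w : complex.Im (z - w) = complex.Im z - complex.Im w.
Proof. by case: z w => [a b] [c e]. Qed.

Lemma sqr_normcE z : normc z ^+ 2 = complex.Re z ^+ 2 + complex.Im z ^+ 2.
Proof. by case: z => a b /=; rewrite sqr_sqrtr// addr_ge0// sqr_ge0. Qed.

Lemma normc_ge0 z : 0 <= normc z.
Proof. by case: z => a b; exact: sqrtr_ge0. Qed.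

Lemma norm_Re_le z : `|complex.Re z| <= normc z.
Proof.
by case: z => a b /=; rewrite -sqrtr_sqr ler_sqrt ?addr_ge0 ?sqr_ge0// lerDl sqr_ge0.
Qed.

Lemma norm_Im_le z : `|complex.Im z| <= normc z.
Proof.
by case: z => a b /=; rewrite -sqrtr_sqr ler_sqrt ?addr_ge0 ?sqr_ge0// lerDr sqr_ge0.
Qed.

Lemma normc_le_ReIm z : normc z <= `|complex.Re z| + `|complex.Im z|.
Proof.
rewrite -[leRHS]ger0_norm ?addr_ge0// -sqrtr_sqr.
case: z => a b /=; rewrite ler_sqrt ?sqr_ge0// sqrrD !real_normK ?num_real//.
by rewrite -addrA [X in _ <= _ + X]addrC addrA lerDl mulrn_wge0// mulr_ge0.
Qed.

End complex_numbers.

Section complex_measurability.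
Context d (T : measurableType d) (R : realType).
Implicit Types Z W : T -> R[i].

Lemma measurable_normc Z : Cmeasurable Z ->
  measurable_fun setT (fun t => normc (Z t)).
Proof.
move=> [mr mi].
rewrite (_ : (fun _ => _) = fun t =>
    (complex.Re (Z t) ^+ 2 + complex.Im (Z t) ^+ 2) `^ 2^-1); last first.
  apply/funext => t; rewrite powR12_sqrt ?addr_ge0 ?sqr_ge0//.
  by case: (Z t).
apply: (measurableT_comp (measurable_powR 2^-1)).
by apply: measurable_funD; exact: measurable_funX.
Qed.

Lemma Cmeasurable_cst (z : R[i]) : Cmeasurable (fun _ : T => z).
Proof. by split; exact: measurable_cst. Qed.

Lemma CmeasurableD Z W : Cmeasurable Z -> Cmeasurable W ->
  Cmeasurable (fun t => Z t + W t).
Proof.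
move=> [r1 i1] [r0 i0]; split.
  rewrite (_ : (fun _ => _) = fun t => complex.Re (Z t) + complex.Re (W t)).
    exact: measurable_funD.
  by apply/funext => t; case: (Z t) (W t) => [a b] [a' b'].
rewrite (_ : (fun _ => _) = fun t => complex.Im (Z t) + complex.Im (W t)).
  exact: measurable_funD.
by apply/funext => t; case: (Z t) (W t) => [a b] [a' b'].
Qed.

Lemma CmeasurableM Z W : Cmeasurable Z -> Cmeasurable W ->
  Cmeasurable (fun t => Z t * W t).
Proof.
move=> [r1 i1] [r0 i0]; split.
  rewrite (_ : (fun _ => _) = fun t => complex.Re (Z t) * complex.Re (W t) -
      complex.Im (Z t) * complex.Im (W t)).
    by apply: measurable_funB; exact: measurable_funM.
  by apply/funext => t; exact: Re_mulc.
rewrite (_ : (fun _ => _) = fun t => complex.Re (Z t) * complex.Im (W t) +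
    complex.Im (Z t) * complex.Re (W t)).
  by apply: measurable_funD; exact: measurable_funM.
by apply/funext => t; exact: Im_mulc.
Qed.

Lemma CmeasurableB Z W : Cmeasurable Z -> Cmeasurable W ->
  Cmeasurable (fun t => Z t - W t).
Proof.
move=> mZ mW; rewrite (_ : (fun _ => _) = fun t => Z t + (-1) * W t).
  by apply: CmeasurableD => //; apply: CmeasurableM => //; exact: Cmeasurable_cst.
by apply/funext => t; rewrite mulN1r.
Qed.

Lemma Cmeasurable_csum (D : set nat) (f : nat -> T -> R[i]) :
  (forall k, Cmeasurable (f k)) -> Cmeasurable (fun t => csum D (f ^~ t)).
Proof.
by move=> mf; split; apply: measurable_rsum => k; [exact: (mf k).1|exact: (mf k).2].
Qed.

Lemma Cmeasurable_comp d' (T' : measurableType d') (f : T' -> T) Z :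
  Cmeasurable Z -> measurable_fun setT f -> Cmeasurable (Z \o f).
Proof.
by move=> [mr mi] mf; split;
  [exact: (measurableT_comp mr mf)|exact: (measurableT_comp mi mf)].
Qed.

End complex_measurability.

Lemma integral_le_cD d (T : measurableType d) (R : realType)
    (P : {measure set T -> \bar R}) (g f1 f2 : T -> R) (c : R) (B1 B2 : \bar R) :
  0 <= c -> (forall t, 0 <= g t) -> (forall t, 0 <= f1 t) ->
  (forall t, 0 <= f2 t) -> measurable_fun setT g -> measurable_fun setT f1 ->
  measurable_fun setT f2 -> (forall t, g t <= c * (f1 t + f2 t)) ->
  (\int[P]_t (f1 t)%:E <= B1)%E -> (\int[P]_t (f2 t)%:E <= B2)%E ->
  (\int[P]_t (g t)%:E <= c%:E * (B1 + B2))%E.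
Proof.
move=> c0 g0 f10 f20 /measurable_EFinP mg /measurable_EFinP m1
  /measurable_EFinP m2 gf h1 h2.
have m12 := emeasurable_funD m1 m2.
apply: le_trans (lee_wpmul2l _ (leeD h1 h2)); last by rewrite lee_fin.
rewrite -ge0_integralD//; [|by move=> t _; rewrite lee_fin..].
rewrite -ge0_integralZl_EFin//; last first.
  by move=> t _; rewrite adde_ge0 ?lee_fin.
apply: ge0_le_integral => //.
- by move=> t _; rewrite lee_fin.
- exact: measurable_funeM.
by move=> t _; rewrite -EFinD -EFinM lee_fin.
Qed.

Section weighted_sums.
Context d d' (T : measurableType d) (E : measurableType d') (R : realType)
  (P : probability T R) (M : nat -> T -> E).
Hypothesis mM : forall i, measurable_fun setT (M i).
Hypothesis indepM : mutually_independent P M.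
Variable xi : nat -> T -> R[i].
Hypothesis mRe : forall k, measurable_fun setT
  ((fun t => complex.Re (xi k t)) : sigma_space M [set k] -> R).
Hypothesis mIm : forall k, measurable_fun setT
  ((fun t => complex.Im (xi k t)) : sigma_space M [set k] -> R).
Variable K : R.
Hypothesis xiK : forall k, (\int[P]_t (normc (xi k t))%:E <= K%:E)%E.
Hypothesis Re0 : forall k, (\int[P]_t (complex.Re (xi k t))%:E = 0)%E.
Hypothesis Im0 : forall k, (\int[P]_t (complex.Im (xi k t))%:E = 0)%E.
Variable y : nat -> R[i].
Hypothesis sy : (\esum_(k in setT) (normc (y k))%:E < +oo)%E.

Let mReT k : measurable_fun setT (fun t => complex.Re (xi k t)) :=
  measurable_sigma_spaceT mM (@mRe k).
Let mImT k : measurable_fun setT (fun t => complex.Im (xi k t)) :=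
  measurable_sigma_spaceT mM (@mIm k).
Let mxi k : measurable_fun setT (fun t => normc (xi k t)) :=
  measurable_normc (conj (@mReT k) (@mImT k)).

Let integrable_part (f : T -> R) k : measurable_fun setT f ->
  (forall t, `|f t| <= normc (xi k t)) -> P.-integrable setT (EFin \o f).
Proof.
move=> /measurable_EFinP mf fle; apply/integrableP; split=> //.
apply: le_lt_trans (ltry K); apply: le_trans (xiK k).
apply: ge0_le_integral => //.
- exact: measurableT_comp.
- exact/measurable_EFinP/mxi.
by move=> t _; rewrite lee_fin fle.
Qed.

Let iRe k : P.-integrable setT (EFin \o (fun t => complex.Re (xi k t))) :=
  integrable_part (@mReT k) (fun t => norm_Re_le _).
Let iIm k : P.-integrable setT (EFin \o (fun t => complex.Im (xi k t))) :=
  integrable_part (@mImT k) (fun t => norm_Im_le _).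

Definition weighted_Re k t := complex.Re (y k * xi k t).
Definition weighted_Im k t := complex.Im (y k * xi k t).

Let mwRe k : measurable_fun setT (weighted_Re k : sigma_space M [set k] -> R).
Proof.
rewrite /weighted_Re (_ : (fun _ => _) = fun t : sigma_space M [set k] =>
  complex.Re (y k) * complex.Re (xi k t) -
  complex.Im (y k) * complex.Im (xi k t)); last by apply/funext => t; exact: Re_mulc.
by apply: measurable_funB; apply: measurable_funM.
Qed.

Let mwIm k : measurable_fun setT (weighted_Im k : sigma_space M [set k] -> R).
Proof.
rewrite /weighted_Im (_ : (fun _ => _) = fun t : sigma_space M [set k] =>
  complex.Re (y k) * complex.Im (xi k t) +
  complex.Im (y k) * complex.Re (xi k t)); last by apply/funext => t; exact: Im_mulc.
by apply: measurable_funD; apply: measurable_funM.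
Qed.

Let mr k : measurable_fun setT (weighted_Re k) :=
  measurable_sigma_spaceT mM (@mwRe k).
Let mi k : measurable_fun setT (weighted_Im k) :=
  measurable_sigma_spaceT mM (@mwIm k).

Let iZ (c : R) (f : T -> R) : P.-integrable setT (EFin \o f) ->
  (\int[P]_t (f t)%:E = 0)%E ->
  P.-integrable setT (EFin \o (fun t => c * f t)) /\
  (\int[P]_t (c * f t)%:E = 0)%E.
Proof.
move=> fi f0; split.
  exact: (integrableZl measurableT c fi).
under eq_integral do rewrite EFinM.
by rewrite integralZl ?f0 ?mule0.
Qed.

Let iwRe k : P.-integrable setT (EFin \o weighted_Re k) /\
  (\int[P]_t (weighted_Re k t)%:E = 0)%E.
Proof.
have [i1 e1] := iZ (complex.Re (y k)) (iRe k) (Re0 k).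
have [i2 e2] := iZ (complex.Im (y k)) (iIm k) (Im0 k).
have E1 t : (weighted_Re k t)%:E = ((complex.Re (y k) * complex.Re (xi k t))%:E -
  (complex.Im (y k) * complex.Im (xi k t))%:E)%E.
  by rewrite -EFinB /weighted_Re Re_mulc.
split.
  apply: eq_integrable (integrableB measurableT i1 i2) => // t _.
  exact/esym/E1.
under eq_integral do rewrite E1.
by rewrite integralB// e1 e2 sube0.
Qed.

Let iwIm k : P.-integrable setT (EFin \o weighted_Im k) /\
  (\int[P]_t (weighted_Im k t)%:E = 0)%E.
Proof.
have [i1 e1] := iZ (complex.Re (y k)) (iIm k) (Im0 k).
have [i2 e2] := iZ (complex.Im (y k)) (iRe k) (Re0 k).
have E1 t : (weighted_Im k t)%:E = ((complex.Re (y k) * complex.Im (xi k t))%:E +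
  (complex.Im (y k) * complex.Re (xi k t))%:E)%E.
  by rewrite -EFinD /weighted_Im Im_mulc.
split.
  apply: eq_integrable (integrableD measurableT i1 i2) => // t _.
  exact/esym/E1.
under eq_integral do rewrite E1.
by rewrite integralD// e1 e2 adde0.
Qed.

Let sum_le (f : nat -> T -> R) : (forall k, measurable_fun setT (f k)) ->
  (forall k t, `|f k t| <= normc (y k * xi k t)) ->
  (\esum_(k in setT) \int[P]_t `|(f k t)%:E| < +oo)%E.
Proof.
move=> mf fle.
have K0 : 0 <= K.
  by rewrite -lee_fin; apply: le_trans (xiK 0%N); apply: integral_ge0 => t _;
     rewrite lee_fin normc_ge0.
apply: (@le_lt_trans _ _ (\esum_(k in setT) (K%:E * (normc (y k))%:E)))%E.
  apply: le_esum => k _.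
  apply: (@le_trans _ _ (\int[P]_t ((normc (y k))%:E * (normc (xi k t))%:E)))%E.
    apply: ge0_le_integral => //.
    - by apply: measurableT_comp => //; exact/measurable_EFinP.
    - by apply: measurable_funeM; exact/measurable_EFinP/mxi.
    by move=> t _; rewrite -EFinM lee_fin -normcM fle.
  rewrite ge0_integralZl_EFin ?normc_ge0//.
  - by rewrite muleC lee_wpmul2r// lee_fin normc_ge0.
  - by move=> t _; rewrite lee_fin normc_ge0.
  - exact/measurable_EFinP/mxi.
rewrite esumZl//; last by move=> k; rewrite lee_fin normc_ge0.
by apply: lte_mul_pinfty; rewrite ?lee_fin.
Qed.

Let sRe : (\esum_(k in setT) \int[P]_t `|(weighted_Re k t)%:E| < +oo)%E.
Proof.
exact: (sum_le mr (fun k t => norm_Re_le _)).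
Qed.

Let sIm : (\esum_(k in setT) \int[P]_t `|(weighted_Im k t)%:E| < +oo)%E.
Proof.
exact: (sum_le mi (fun k t => norm_Im_le _)).
Qed.

Let mcsum : measurable_fun setT
  (fun t => normc (csum setT (fun k => y k * xi k t))).
Proof.
by apply: measurable_normc; split; apply: measurable_rsum => k; [exact: mr|exact: mi].
Qed.

Lemma integral_csum_powR_le (q : R) : 1 <= q <= 2 ->
  (\int[P]_t (normc (csum setT (fun k => y k * xi k t)) `^ q)%:E <=
   (2 `^ q * 2 `^ (q + 3))%:E *
   \esum_(k in setT) ((normc (y k) `^ q)%:E * \int[P]_t (normc (xi k t) `^ q)%:E))%E.
Proof.
move=> q12; have /andP[q1 q2] := q12.
have q0 : 0 <= q by rewrite (le_trans ler01).
pose S := (\esum_(k in setT) ((normc (y k) `^ q)%:E *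
  \int[P]_t (normc (xi k t) `^ q)%:E))%E.
have S0 : (0 <= S)%E.
  apply: esum_ge0 => k _; apply: mule_ge0; first by rewrite lee_fin powR_ge0.
  by apply: integral_ge0 => t _; rewrite lee_fin powR_ge0.
have part (f : nat -> T -> R) : (forall k, measurable_fun setT (f k)) ->
    (forall k t, `|f k t| <= normc (y k * xi k t)) ->
    (\esum_(k in setT) \int[P]_t (`|f k t| `^ q)%:E <= S)%E.
  move=> mf fle; apply: le_esum => k _.
  rewrite -ge0_integralZl_EFin ?powR_ge0//; last 2 first.
  - by move=> t _; rewrite lee_fin powR_ge0.
  - by apply: measurable_powR_EFin; exact: mxi.
  apply: ge0_le_integral => //.
  - exact: measurable_norm_powR.
  - apply: measurable_funeM; apply: measurable_powR_EFin; exact: mxi.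
  move=> t _; rewrite -EFinM lee_fin -powRM ?normc_ge0// -normcM.
  by apply: ge0_ler_powR; rewrite ?nnegrE ?normc_ge0// fle.
have hr := integral_rsum_powR_le mM indepM (@mwRe) (fun k => (iwRe k).1)
  (fun k => (iwRe k).2) q12 sRe.
have hi := integral_rsum_powR_le mM indepM (@mwIm) (fun k => (iwIm k).1)
  (fun k => (iwIm k).2) q12 sIm.
have hr' := le_trans hr (lee_wpmul2l (_ : (0 <= (2 `^ (q + 2))%:E)%E)
  (part _ mr (fun k t => norm_Re_le _))).
have hi' := le_trans hi (lee_wpmul2l (_ : (0 <= (2 `^ (q + 2))%:E)%E)
  (part _ mi (fun k t => norm_Im_le _))).
have -> : 2 `^ (q + 3) = 2 `^ (q + 2) + 2 `^ (q + 2) :> R.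
  rewrite (_ : q + 3 = q + 2 + 1); last by lra.
  by rewrite powRD ?pnatr_eq0 ?implybT// powRr1// mulr_natr mulr2n.
rewrite EFinM EFinD -muleA [X in (_ <= _ * X)%E]ge0_muleDl ?lee_fin ?powR_ge0//.
apply: (@integral_le_cD _ _ _ P _ (fun t => `|rsum setT (weighted_Re ^~ t)| `^ q)
  (fun t => `|rsum setT (weighted_Im ^~ t)| `^ q)).
- exact: powR_ge0.
- by move=> t; exact: powR_ge0.
- by move=> t; exact: powR_ge0.
- by move=> t; exact: powR_ge0.
- by apply: (measurableT_comp (measurable_powR q)); exact: mcsum.
- exact/measurable_EFinP/(measurable_norm_powR q (measurable_rsum setT mr)).
- exact/measurable_EFinP/(measurable_norm_powR q (measurable_rsum setT mi)).
- move=> t; apply: le_trans (powRD_le q0 (normr_ge0 _) (normr_ge0 _)).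
  apply: ge0_ler_powR; rewrite ?nnegrE ?normc_ge0 ?addr_ge0//.
  exact: normc_le_ReIm.
- by apply: hr'; rewrite lee_fin powR_ge0.
- by apply: hi'; rewrite lee_fin powR_ge0.
Qed.

Lemma integral_csum_powR_ge (p : R) N : 1 <= p <= 2 ->
  ((4 / 9)%:E * \int[P]_t ((\sum_(k < N) normc (y k * xi k t) ^+ 2) `^ (p / 2))%:E <=
   (2 `^ (p + 2))%:E *
   \int[P]_t (normc (csum setT (fun k => y k * xi k t)) `^ p)%:E)%E.
Proof.
move=> p12; have /andP[p1 p2] := p12.
have p0 : 0 <= p by rewrite (le_trans ler01).
have mc : measurable_fun setT
    (fun t => (normc (csum setT (fun k => y k * xi k t)) `^ p)%:E).
  by apply: measurable_powR_EFin.
pose S (f : nat -> T -> R) t := (\sum_(k < N) f k t ^+ 2) `^ (p / 2).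
have mS f : (forall k, measurable_fun setT (f k)) ->
    measurable_fun setT (fun t => (S f t)%:E).
  move=> mf; apply: measurable_powR_EFin.
  by apply: measurable_sum => k; exact: measurable_funX.
have S0 f t : (0 <= (S f t)%:E)%E by rewrite lee_fin powR_ge0.
have hr := integral_sqr_rsum_powR_le mM indepM (@mwRe) (fun k => (iwRe k).1)
  (fun k => (iwRe k).2) N p12 sRe.
have hi := integral_sqr_rsum_powR_le mM indepM (@mwIm) (fun k => (iwIm k).1)
  (fun k => (iwIm k).2) N p12 sIm.
have c0 (c : R) : (0 <= (2 `^ c)%:E :> \bar R)%E by rewrite lee_fin powR_ge0.
have hr' : ((4 / 9)%:E * \int[P]_t (S weighted_Re t)%:E <= (2 `^ (p + 1))%:E *
   \int[P]_t (normc (csum setT (fun k => y k * xi k t)) `^ p)%:E)%E.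
  apply: le_trans hr _; apply: lee_wpmul2l => //.
  apply: ge0_le_integral => //.
  - exact: measurable_norm_powR (measurable_rsum setT mr).
  move=> t _; rewrite lee_fin; apply: ge0_ler_powR; rewrite ?nnegrE ?normc_ge0//.
  exact: (norm_Re_le (csum setT (fun k => y k * xi k t))).
have hi' : ((4 / 9)%:E * \int[P]_t (S weighted_Im t)%:E <= (2 `^ (p + 1))%:E *
   \int[P]_t (normc (csum setT (fun k => y k * xi k t)) `^ p)%:E)%E.
  apply: le_trans hi _; apply: lee_wpmul2l => //.
  apply: ge0_le_integral => //.
  - exact: measurable_norm_powR (measurable_rsum setT mi).
  move=> t _; rewrite lee_fin; apply: ge0_ler_powR; rewrite ?nnegrE ?normc_ge0//.
  exact: (norm_Im_le (csum setT (fun k => y k * xi k t))).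
have -> : 2 `^ (p + 2) = 2 `^ (p + 1) + 2 `^ (p + 1) :> R.
  rewrite (_ : p + 2 = p + 1 + 1); last by lra.
  by rewrite [LHS]powRD ?pnatr_eq0 ?implybT// powRr1// mulr_natr mulr2n.
rewrite EFinD ge0_muleDl ?c0//.
apply: le_trans (leeD hr' hi').
rewrite -ge0_muleDr; [|by apply: integral_ge0|by apply: integral_ge0].
apply: lee_wpmul2l; first by rewrite lee_fin divr_ge0.
rewrite -ge0_integralD//; [|exact: mS|exact: mS].
apply: ge0_le_integral => //.
- by move=> t _; rewrite lee_fin powR_ge0.
- apply: measurable_powR_EFin.
  apply: measurable_sum => k; apply: measurable_funX.
  by apply: measurable_normc; split; [exact: mr|exact: mi].
- by apply: emeasurable_funD; exact: mS.
move=> t _; rewrite -EFinD lee_fin /S.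
under eq_bigr do rewrite sqr_normcE.
rewrite big_split /=; apply: powR_subadditive.
- by apply/andP; split; lra.
- by apply: sumr_ge0 => k _; rewrite sqr_ge0.
- by apply: sumr_ge0 => k _; rewrite sqr_ge0.
Qed.

End weighted_sums.

Section square_function_lower_bounds.
Context d (T : measurableType d) (R : realType) (P : probability T R).

Lemma integral_square_function_ge (p eps pi0 : R) (r : nat -> R)
    (z : nat -> T -> R) N (S := \sum_(k < N) r k ^+ 2) :
  1 <= p <= 2 -> 0 < eps -> 0 <= pi0 ->
  (forall k, measurable_fun setT (z k)) ->
  (forall k, pi0%:E <= P [set t | (eps < z k t)%R])%E ->
  ((eps `^ p * S `^ (p / 2) * pi0)%:E <=
   \int[P]_t ((\sum_(k < N) (r k * z k t) ^+ 2) `^ (p / 2))%:E)%E.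
Proof.
move=> /andP[p1 p2] eps0 pi00 mz zpi.
have p20 : 0 <= p / 2 by lra.
have mi : measurable_fun setT
    (fun t => ((\sum_(k < N) (r k * z k t) ^+ 2) `^ (p / 2))%:E).
  apply: measurable_powR_EFin.
  by apply: measurable_sum => k; apply: measurable_funX; exact: measurable_funM.
have S0 : 0 <= S by apply: sumr_ge0 => k _; rewrite sqr_ge0.
have [Se|Sn0] := eqVneq S 0.
  rewrite Se powR0 ?mulr0 ?mul0r; last lra.
  by apply: integral_ge0 => t _; rewrite lee_fin powR_ge0.
have Sp : 0 < S by rewrite lt_neqAle eq_sym Sn0.
pose A k := [set t | (eps < z k t)%R].
have mA k : measurable (A k).
  rewrite -[A k]setTI; apply: measurable_fun_ltr => //; exact: measurable_cst.
pose c : R := eps `^ p * S `^ (p / 2).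
have c0 : 0 <= c by rewrite mulr_ge0 ?powR_ge0.
pose w k : R := r k ^+ 2 / S.
have w0 k : 0 <= w k by rewrite divr_ge0 ?sqr_ge0.
have w1 : \sum_(k < N) w k = 1 by rewrite -mulr_suml divff.
pose u t : R := \sum_(k < N) w k * \1_(A k) t.
have u0 t : 0 <= u t by apply: sumr_ge0 => k _; rewrite mulr_ge0.
have u1 t : u t <= 1.
  rewrite -w1; apply: ler_sum => k _.
  by rewrite -[leRHS]mulr1 ler_wpM2l// indicE; case: (t \in _).
have mu : measurable_fun setT u.
  apply: measurable_sum => k; apply: measurable_funM.
    exact: measurable_cst.
  exact: (measurable_indic (mA k)).
have cu : (\int[P]_t (c * u t)%:E = c%:E * \sum_(k < N) ((w k)%:E * P (A k)))%E.
  under eq_integral do rewrite EFinM.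
  rewrite ge0_integralZl_EFin//; [|by move=> t _; rewrite lee_fin|exact/measurable_EFinP].
  congr (_ * _)%E.
  transitivity (\int[P]_t (\sum_(k < N) (w k)%:E * (\1_(A k) t)%:E))%E.
    by apply: eq_integral => t _; rewrite /u -sumEFin; apply: eq_bigr => k _;
      rewrite EFinM.
  rewrite ge0_integral_sum//; last 2 first.
  - by move=> k; apply: measurable_funeM; apply/measurable_EFinP; exact: (measurable_indic (mA k)).
  - by move=> k t _; rewrite -EFinM lee_fin mulr_ge0.
  apply: eq_bigr => k _; rewrite ge0_integralZl_EFin//; last first.
    by apply/measurable_EFinP; exact: (measurable_indic (mA k)).
  by rewrite integral_indic// setIT.
apply: (@le_trans _ _ (\int[P]_t (c * u t)%:E)%E).
  rewrite cu EFinM; apply: lee_wpmul2l; first by rewrite lee_fin.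
  apply: (@le_trans _ _ (\sum_(k < N) ((w k)%:E * pi0%:E))%E).
    under eq_bigr do rewrite -EFinM.
    by rewrite sumEFin -mulr_suml w1 mul1r.
  by apply: lee_sum => k _; apply: lee_wpmul2l; [rewrite lee_fin|exact: zpi].
apply: ge0_le_integral => //.
- by move=> t _; rewrite lee_fin mulr_ge0.
- by apply/measurable_EFinP; exact: measurable_funM.
move=> t _; rewrite lee_fin.
have uu : u t <= u t `^ (p / 2).
  have [->|un0] := eqVneq (u t) 0; first exact: powR_ge0.
  by rewrite ger1_powR ?u1 ?andbT ?lt_neqAle ?u0 1?eq_sym ?un0//; lra.
apply: (@le_trans _ _ (c * u t `^ (p / 2))); first by rewrite ler_wpM2l.
have -> : c * u t `^ (p / 2) = (eps ^+ 2 * (S * u t)) `^ (p / 2).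
  rewrite powRM ?sqr_ge0 ?mulr_ge0// powRM// mulrA; congr (_ * _ * _).
  by rewrite -powR_mulrn ?ltW// -powRrM mulrC divfK.
apply: ge0_ler_powR; rewrite ?nnegrE//.
- by rewrite mulr_ge0 ?sqr_ge0// mulr_ge0.
- by apply: sumr_ge0 => k _; rewrite sqr_ge0.
rewrite /u mulr_sumr mulr_sumr; apply: ler_sum => k _.
rewrite /w indicE; case: (boolP (t \in A k)) => [/set_mem tA|_]; last first.
  by rewrite !mulr0 sqr_ge0.
have -> : eps ^+ 2 * (S * (r k ^+ 2 / S * true%:R)) = r k ^+ 2 * eps ^+ 2.
  by rewrite mulr1; field.
rewrite exprMn ler_wpM2l ?sqr_ge0// ler_pXn2r ?nnegrE ?ltW//.
exact: lt_trans eps0 tA.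
Qed.

Lemma prod_one_minus_le (I : Type) (s : seq I) (a : I -> R) :
  (forall i, 0 <= a i <= 1) ->
  \prod_(i <- s) (1 - a i) <= (1 + \sum_(i <- s) a i)^-1.
Proof.
move=> a01; elim: s => [|i s IH]; first by rewrite !big_nil addr0 invr1.
rewrite !big_cons; set b := \sum_(_ <- _) _ in IH *.
have b0 : 0 <= b by apply: sumr_ge0 => j _; case/andP: (a01 j).
have /andP[a0 a1] := a01 i.
apply: (@le_trans _ _ ((1 - a i) * (1 + b)^-1)).
  by rewrite ler_wpM2l// subr_ge0.
rewrite ler_pdivrMr; last lra.
rewrite mulrC ler_pdivlMr; last lra.
have : 0 <= a i * b by rewrite mulr_ge0.
have : 0 <= a i * a i by rewrite mulr_ge0.
nra.
Qed.

Lemma min_sum_le (I : Type) (s : seq I) (a : I -> R) (b : R) : 0 <= b ->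
  (forall i, 0 <= a i) ->
  Num.min (\sum_(i <- s) a i) b <= \sum_(i <- s) Num.min (a i) b.
Proof.
move=> b0 a0; elim: s => [|i s IH]; first by rewrite !big_nil ge_min lexx.
rewrite !big_cons; apply: le_trans (lerD (lexx _) IH).
set x := a i; set w := \sum_(_ <- _) _.
have x0 : 0 <= x := a0 i.
have w0 : 0 <= w by apply: sumr_ge0 => j _; exact: a0.
rewrite ge_min; case: (leP x b) => xb; case: (leP w b) => wb.
- by rewrite lexx.
- by apply/orP; right; lra.
- by apply/orP; right; lra.
- by apply/orP; right; lra.
Qed.

Context d' (E : measurableType d') (M : nat -> T -> E).
Hypothesis mM : forall i, measurable_fun setT (M i).
Hypothesis indepM : mutually_independent P M.

Lemma integral_square_function_ge_tail (p al c b : R) (r : nat -> R)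
    (h : E -> R) N :
  1 <= p -> measurable_fun setT h -> (forall k, 0 <= r k) ->
  0 <= c -> 0 <= b -> c * b <= 1 ->
  (forall k, (c * Num.min (r k `^ al) b)%:E <=
     P [set t | (1 < r k * h (M k t))%R])%E ->
  ((1 - (1 + c * Num.min (\sum_(k < N) r k `^ al) b)^-1)%:E <=
   \int[P]_t ((\sum_(k < N) (r k * h (M k t)) ^+ 2) `^ (p / 2))%:E)%E.
Proof.
move=> p1 mh r0 c0 b0 cb1 hP.
have mhM k : measurable_fun setT (fun t => r k * h (M k t)).
  by apply: measurable_funM => //; exact: measurableT_comp mh (mM k).
pose F k : set E := [set x | (r k * h x <= 1)%R].
have mF k : measurable (F k).
  rewrite -[F k]setTI; apply: measurable_fun_ler => //.
  by apply: measurable_funM.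
pose B := \bigcap_(k in [set` iota 0 N]) M k @^-1` F k.
have mB : measurable B.
  apply: fin_bigcap_measurable => // k _.
  by rewrite -[X in measurable X]setTI; exact: mM.
have PBc : P (~` B) = (1 - P B)%E by rewrite probability_setC.
have a01 k : 0 <= c * Num.min (r k `^ al) b <= 1.
  apply/andP; split; first by rewrite mulr_ge0// le_min powR_ge0.
  by apply: le_trans cb1; rewrite ler_wpM2l// ge_min lexx orbT.
have PF k : (P (M k @^-1` F k) <= (1 - c * Num.min (r k `^ al) b)%:E)%E.
  have mk : measurable (M k @^-1` F k).
    by rewrite -[X in measurable X]setTI; exact: mM.
  have := hP k; have -> : [set t | (1 < r k * h (M k t))%R] = ~` (M k @^-1` F k).
    by apply/seteqP; split=> t /=; rewrite /F /= ltNge => /negP.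
  rewrite probability_setC// EFinB -(fineK (fin_num_measure P _ mk)) -!EFinB.
  by rewrite !lee_fin; lra.
have PB : (P B <= ((1 + c * Num.min (\sum_(k < N) r k `^ al) b)^-1)%:E)%E.
  rewrite indepM ?iota_uniq//.
  apply: (@le_trans _ _
      (\prod_(k <- iota 0 N) (1 - c * Num.min (r k `^ al) b))%:E)%E.
    rewrite -prodEFin; elim: (iota 0 N) => [|k s IH]; first by rewrite !big_nil.
    rewrite !big_cons; apply: lee_pmul => //.
    by elim: {IH} s => [|j s IH]; rewrite ?big_nil ?big_cons// mule_ge0.
  rewrite lee_fin; apply: le_trans (prod_one_minus_le (iota 0 N) a01) _.
  have lem0 : 0 <= c * Num.min (\sum_(k < N) r k `^ al) b.
    by rewrite mulr_ge0// le_min b0 andbT sumr_ge0// => k _; exact: powR_ge0.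
  rewrite lef_pV2 ?posrE ?ltr_pwDl// ?sumr_ge0//; last first.
    by move=> k _; have /andP[] := a01 k.
  rewrite lerD2l -mulr_sumr ler_wpM2l//.
  rewrite -(big_mkord xpredT (fun k => r k `^ al)) /index_iota subn0.
  by apply: min_sum_le => // k; exact: powR_ge0.
apply: (@le_trans _ _ (P (~` B))).
  by rewrite PBc EFinB; apply: leeB.
have mCB : measurable (~` B) by exact: measurableC.
have <- : (\int[P]_t (\1_(~` B) t)%:E)%E = P (~` B).
  by rewrite integral_indic// setIT.
apply: ge0_le_integral => //.
- by apply/measurable_EFinP; exact: (measurable_indic mCB).
- apply: measurable_powR_EFin.
  by apply: measurable_sum => k; exact: measurable_funX.
move=> t _; rewrite lee_fin indicE; case: (boolP (t \in ~` B)) => [|_]; last first.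
  exact: powR_ge0.
rewrite inE /B setC_bigcap => -[k /= kN /negP]; rewrite /F /= -ltNge => k1.
have p20 : 0 <= p / 2 by lra.
apply: (@le_trans _ _ (1 `^ (p / 2))); first by rewrite powR1.
apply: ge0_ler_powR; rewrite ?nnegrE//.
  by apply: sumr_ge0 => j _; rewrite sqr_ge0.
have kN' : (k < N)%N by move: kN; rewrite mem_iota.
rewrite (bigD1 (Ordinal kN'))//= -[leLHS]addr0; apply: lerD.
  by apply: exprn_ege1; exact: ltW.
by apply: sumr_ge0 => j _; rewrite sqr_ge0.
Qed.

End square_function_lower_bounds.

(** * Weights of the individuals *)

Section complex_sums.
Context {R : realType}.

Definition csummable (I : choiceType) (D : set I) (f : I -> R[i]) : Prop :=
  abs_summable D (fun i => complex.Re (f i)) /\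
  abs_summable D (fun i => complex.Im (f i)).

Lemma normc_csummable (I : choiceType) (D : set I) (f : I -> R[i]) :
  (\esum_(i in D) (normc (f i))%:E < +oo)%E -> csummable D f.
Proof.
move=> fs; split; apply: le_lt_trans fs; apply: le_esum => i _;
  rewrite lee_fin; [exact: norm_Re_le|exact: norm_Im_le].
Qed.

Lemma eq_csummable (I : choiceType) (D : set I) (f g : I -> R[i]) :
  (forall i, D i -> f i = g i) -> csummable D f -> csummable D g.
Proof.
move=> fg [fr fi]; split.
  by apply: le_lt_trans fr; apply: le_esum => i Di; rewrite /= fg.
by apply: le_lt_trans fi; apply: le_esum => i Di; rewrite /= fg.
Qed.

Lemma eq_csum (I : choiceType) (D : set I) (f g : I -> R[i]) :
  (forall i, D i -> f i = g i) -> csum D f = csum D g.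
Proof.
by move=> fg; rewrite /csum; congr (_ +i* _)%C; apply: eq_rsum => i Di; rewrite fg.
Qed.

Lemma csumB (I : choiceType) (D : set I) (f g : I -> R[i]) :
  csummable D f -> csummable D g ->
  csum D (fun i => f i - g i) = csum D f - csum D g.
Proof.
move=> [fr fi] [gr gi]; rewrite /csum.
rewrite (eq_rsum (g := fun i => complex.Re (f i) - complex.Re (g i))); last first.
  by move=> i _; exact: Re_subc.
rewrite [rsum D (fun i => complex.Im (f i - g i))](eq_rsum
    (g := fun i => complex.Im (f i) - complex.Im (g i))); last first.
  by move=> i _; exact: Im_subc.
by rewrite !rsumB.
Qed.

Lemma csummableZ (I : choiceType) (D : set I) (c : R[i]) (f : I -> R[i]) :
  csummable D f -> csummable D (fun i => c * f i).
Proof.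
move=> [fr fi]; split.
  have := abs_summableD (abs_summableZ (complex.Re c) fr)
    (abs_summableZ (- complex.Im c) fi).
  by apply: le_lt_trans; apply: le_esum => i _; rewrite /= Re_mulc mulNr.
have := abs_summableD (abs_summableZ (complex.Re c) fi)
  (abs_summableZ (complex.Im c) fr).
by apply: le_lt_trans; apply: le_esum => i _; rewrite /= Im_mulc.
Qed.

Lemma csumZ (I : choiceType) (D : set I) (c : R[i]) (f : I -> R[i]) :
  csummable D f -> csum D (fun i => c * f i) = c * csum D f.
Proof.
move=> [fr fi]; rewrite /csum.
rewrite (eq_rsum (g := fun i => complex.Re c * complex.Re (f i) +
    (- complex.Im c) * complex.Im (f i))); last first.
  by move=> i _; rewrite Re_mulc mulNr.
rewrite [rsum D (fun i => complex.Im (c * f i))](eq_rsum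
    (g := fun i => complex.Re c * complex.Im (f i) +
      complex.Im c * complex.Re (f i))); last first.
  by move=> i _; rewrite Im_mulc.
rewrite !rsumD; [|exact: abs_summableZ..].
by rewrite !rsumZ// mulNr; case: c => a b; simpc.
Qed.

Lemma csumZ_factor (I : choiceType) (D : set I) (c : R[i]) (f : I -> R[i]) :
  csummable D (fun i => c * f i) -> csum D (fun i => c * f i) = c * csum D f.
Proof.
have [->|c0] := eqVneq c 0.
  move=> _; rewrite mul0r; have H : csummable D (fun=> 0 : R[i]).
    by apply: normc_csummable; rewrite esum1// => i _; rewrite normc0.
  rewrite (eq_csum (g := fun i => 0 * (0 : R[i]))); last by move=> i _; rewrite !mul0r.
  by rewrite csumZ// mul0r.
move=> cf; have fs : csummable D f.
  apply: eq_csummable (csummableZ c^-1 cf) => i _.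
  by rewrite mulrA mulVf// mul1r.
exact: csumZ.
Qed.

Lemma csum_mkcond (I : choiceType) (D : set I) (f : I -> R[i]) :
  csum D f = csum setT (fun i => if i \in D then f i else 0).
Proof.
rewrite /csum (rsum_mkcond D) [rsum D (fun i => complex.Im _)]rsum_mkcond.
by congr (_ +i* _)%C; apply: eq_rsum => i _; case: ifP.
Qed.

Lemma csum_reindex (I J : choiceType) (D : set I) (D' : set J) (e : I -> J)
    (f : J -> R[i]) : set_bij D D' e -> csum D' f = csum D (f \o e).
Proof. by move=> De; rewrite /csum !(rsum_reindex _ De). Qed.

Lemma csum_csum (I J : choiceType) (P : set I) (Q : I -> set J)
    (f : I -> J -> R[i]) :
  csummable (P `*`` Q) (fun k => f k.1 k.2) ->
  [/\ forall i, P i -> csummable (Q i) (f i),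
      csummable P (fun i => csum (Q i) (f i)) &
      csum P (fun i => csum (Q i) (f i)) = csum (P `*`` Q) (fun k => f k.1 k.2)].
Proof.
move=> [fr fi].
have [r1 r2 r3] := abs_summable_rsum (f := fun i j => complex.Re (f i j)) fr.
have [i1 i2 i3] := abs_summable_rsum (f := fun i j => complex.Im (f i j)) fi.
split; [by move=> i Pi; split; [exact: r1|exact: i1]|by []|].
by rewrite [RHS]/csum -r3 -i3.
Qed.

End complex_sums.

Definition word : nat -> seq nat := CodeSeq.decode.

Lemma wordK : cancel word CodeSeq.code. Proof. exact: CodeSeq.decodeK. Qed.

Lemma word_bij (D : set (seq nat)) : set_bij (word @^-1` D) D word.
Proof.
split=> [k //|k l _ _ /(can_inj wordK)//|u Du].
by exists (CodeSeq.code u); rewrite /= /word CodeSeq.codeK.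
Qed.

Lemma rcons_bij n : set_bij ([set u : seq nat | size u = n] `*`` (fun=> [set: nat]))
  [set u | size u = n.+1] (fun z => rcons z.1 z.2).
Proof.
split=> [[u i] /= [<- _]|[u i] [v j] _ _ /= /rcons_inj [-> ->]//|u /= un].
  by rewrite size_rcons.
case/lastP: u un => // u i; rewrite size_rcons => -[un].
by exists (u, i).
Qed.

Section sums_over_words.
Context d (T : measurableType d) (R : realType) (P : {measure set T -> \bar R}).

Lemma measurable_esum_words (D : set (seq nat)) (a : seq nat -> T -> \bar R) :
  (forall u t, 0 <= a u t)%E -> (forall u, measurable_fun setT (a u)) ->
  measurable_fun setT (fun t => \esum_(u in D) a u t).
Proof.
move=> a0 ma; under eq_fun do rewrite (reindex_esum _ _ _ _ (word_bij D)).
exact: measurable_esum.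
Qed.

Lemma integral_esum_words (D : set (seq nat)) (a : seq nat -> T -> \bar R) :
  (forall u t, 0 <= a u t)%E -> (forall u, measurable_fun setT (a u)) ->
  (\int[P]_t (\esum_(u in D) a u t) = \esum_(u in D) \int[P]_t a u t)%E.
Proof.
move=> a0 ma; under eq_integral do rewrite (reindex_esum _ _ _ _ (word_bij D)).
by rewrite integral_esum// [RHS](reindex_esum _ _ _ _ (word_bij D)).
Qed.

Lemma Cmeasurable_csum_words (D : set (seq nat)) (f : seq nat -> T -> R[i]) :
  (forall u, Cmeasurable (f u)) -> Cmeasurable (fun t => csum D (f ^~ t)).
Proof.
move=> mf; rewrite (_ : (fun _ => _) =
    fun t => csum (word @^-1` D) (fun k => f (word k) t)).
  exact: (Cmeasurable_csum _ (fun k => mf (word k))).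
by apply/funext => t; rewrite (csum_reindex _ (word_bij D)).
Qed.

Lemma ae_esum_words_lty (D : set (seq nat)) (a : seq nat -> T -> \bar R) :
  (forall u t, 0 <= a u t)%E -> (forall u, measurable_fun setT (a u)) ->
  (\int[P]_t (\esum_(u in D) a u t) < +oo)%E ->
  {ae P, forall t, (\esum_(u in D) a u t < +oo)%E}.
Proof.
move=> a0 ma af.
have /integrable_ae : P.-integrable setT (fun t => \esum_(u in D) a u t).
  apply/integrableP; split; first exact: measurable_esum_words.
  by under eq_integral => t _ do rewrite gee0_abs ?esum_ge0//.
move=> /(_ measurableT); apply: filterS => t /(_ I).
by rewrite ge0_fin_numE// esum_ge0.
Qed.

End sums_over_words.

Lemma esum_rcons (R : realType) n (a : seq nat -> \bar R) :
  (forall u, 0 <= a u)%E ->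
  \esum_(u in [set u | size u = n.+1]) a u =
  \esum_(u in [set u | size u = n]) \esum_(i in [set: nat]) a (rcons u i).
Proof.
move=> a0; rewrite (reindex_esum _ _ _ _ (rcons_bij n)).
by rewrite (@esum_esum _ _ _ _ _ (fun u i => a (rcons u i))).
Qed.

Lemma esum_size0 (R : realType) (a : seq nat -> \bar R) : (0 <= a [::])%E ->
  \esum_(u in [set u : seq nat | size u = 0%N]) a u = a [::].
Proof.
move=> a0; rewrite (_ : [set u | _] = [set [::]]) ?esum_set1//.
by apply/seteqP; split=> [u /= /size0nil//|u /= ->].
Qed.

Section weights.
Context {R : realType}.

Definition child_weight (l : R[i]) (c : configuration R) (i : nat) : R[i] :=
  if has_child c i then cexp (- l * (c.2 i)%:C%C) else 0.

Definition child_rweight (s : R) (c : configuration R) (i : nat) : R :=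
  if has_child c i then expR (- s * c.2 i) else 0.

Lemma cexpD (z w : R[i]) : cexp (z + w) = cexp z * cexp w.
Proof.
case: z w => [a b] [c e] /=; rewrite expRD cosD sinD; simpc.
by congr (_ +i* _)%C; ring.
Qed.

Lemma cexp0 : cexp (0 : R[i]) = 1.
Proof. by rewrite /cexp /= expR0 cos0 sin0 mulr0 mulr1. Qed.

Lemma normc_cexp (z : R[i]) : normc (cexp z) = expR (complex.Re z).
Proof.
case: z => a b /=; rewrite !exprMn -mulrDr cos2Dsin2 mulr1 sqrtr_sqr.
by rewrite ger0_norm// expR_ge0.
Qed.

Lemma normc_child_weight l c i :
  normc (child_weight l c i) = child_rweight (complex.Re l) c i.
Proof.
rewrite /child_weight /child_rweight; case: ifP => _; last exact: normc0.
by rewrite normc_cexp; case: l => a b /=; rewrite mulr0 subr0.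
Qed.

Lemma child_rweight_ge0 s c i : 0 <= child_rweight s c i.
Proof. by rewrite /child_rweight; case: ifP => // _; exact: expR_ge0. Qed.

Lemma measurable_child (i : nat) (f : R -> R) : measurable_fun setT f ->
  measurable_fun setT
    ((fun c => if has_child c i then f (c.2 i) else 0) :
      point_process_space R -> R).
Proof.
move=> mf _ B mB; rewrite setTI.
have mG (C : set R) : measurable C ->
    measurable ([set c | has_child c i /\ C (c.2 i)] : set (point_process_space R)).
  by move=> mC; apply: sub_sigma_algebra; exists i, C.
have mfB : measurable (f @^-1` B) by rewrite -[X in measurable X]setTI; exact: mf.
have := mG _ mfB; have := mG _ measurableT.
set G1 := [set c | _]; set G2 := [set c | _] => m1 m2.
have [B0|B0] := pselect (B 0).
  rewrite (_ : _ @^-1` _ = G2 `|` ~` G1).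
    by apply: measurableU => //; exact: measurableC.
  apply/seteqP; split=> c /=; rewrite /G1 /G2 /=.
    by case: ifPn => [hc Bc|/negP hc _]; [left|right => -[]].
  by case: ifPn => // hc [[]//|[]].
rewrite (_ : _ @^-1` _ = G2)//; apply/seteqP; split=> c /=; rewrite /G2 /=.
  by case: ifPn => [//|_ /B0].
by case=> -> .
Qed.

Lemma Cmeasurable_child_weight l i :
  Cmeasurable ((fun c => child_weight l c i) : point_process_space R -> R[i]).
Proof.
case: l => a b.
have key (g : R -> R) : continuous g -> measurable_fun setT
    ((fun c => if has_child c i then expR (- a * c.2 i) * g (- b * c.2 i) else 0) :
      point_process_space R -> R).
  move=> /continuous_measurable_fun mg.
  apply: (measurable_child i (f := fun x => expR (- a * x) * g (- b * x))).
  apply: measurable_funM.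
    by apply: measurableT_comp => //; exact: measurable_funM.
  by apply: (measurableT_comp mg); exact: measurable_funM.
split.
  rewrite (_ : (fun _ => _) = fun c : point_process_space R =>
      if has_child c i then expR (- a * c.2 i) * cos (- b * c.2 i) else 0).
    exact: (key _ (@continuous_cos R)).
  apply/funext => c; rewrite /child_weight; case: ifP => //= _.
  by rewrite !mulr0 subr0 add0r.
rewrite (_ : (fun _ => _) = fun c : point_process_space R =>
    if has_child c i then expR (- a * c.2 i) * sin (- b * c.2 i) else 0).
  exact: (key _ (@continuous_sin R)).
apply/funext => c; rewrite /child_weight; case: ifP => //= _.
by rewrite !mulr0 subr0 add0r.
Qed.

Lemma measurable_child_rweight s i : measurable_fun setT
  ((fun c => child_rweight s c i) : point_process_space R -> R).
Proof.
apply: (measurable_child i (f := fun x => expR (- s * x))).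
by apply: measurableT_comp => //; exact: measurable_funM.
Qed.

End weights.

Section word_weights.
Context d (T : measurableType d) (R : realType) (M : seq nat -> T -> point_process_space R).

Definition weight (l : R[i]) (u : seq nat) (t : T) : R[i] :=
  if born M u t then cexp (- l * (position M u t)%:C%C) else 0.

Definition rweight (s : R) (u : seq nat) (t : T) : R :=
  if born M u t then expR (- s * position M u t) else 0.

Lemma weight_nil l t : weight l [::] t = 1.
Proof. by rewrite /weight born_nil position_nil mulr0 cexp0. Qed.

Lemma weight_rcons l u i t :
  weight l (rcons u i) t = weight l u t * child_weight l (M u t) i.
Proof.
rewrite /weight /child_weight born_rcons position_rcons.
case: (born M u t); case: (has_child _ i) => /=; rewrite ?mulr0 ?mul0r//.
by rewrite -cexpD -mulrDr; congr (cexp (_ * _)); simpc.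
Qed.

Lemma rweight_nil s t : rweight s [::] t = 1.
Proof. by rewrite /rweight born_nil position_nil mulr0 expR0. Qed.

Lemma rweight_rcons s u i t :
  rweight s (rcons u i) t = rweight s u t * child_rweight s (M u t) i.
Proof.
rewrite /rweight /child_rweight born_rcons position_rcons.
case: (born M u t); case: (has_child _ i) => /=; rewrite ?mulr0 ?mul0r//.
by rewrite -expRD -mulrDr.
Qed.

Lemma rweight_ge0 s u t : 0 <= rweight s u t.
Proof. by rewrite /rweight; case: ifP => // _; exact: expR_ge0. Qed.

Lemma normc_weight l u t : normc (weight l u t) = rweight (complex.Re l) u t.
Proof.
rewrite /weight /rweight; case: ifP => _; last exact: normc0.
by rewrite normc_cexp; case: l => a b /=; rewrite mulr0 subr0.
Qed.

Lemma rweight_powR (q s : R) u t : q != 0 ->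
  rweight s u t `^ q = rweight (q * s) u t.
Proof.
move=> q0; rewrite /rweight; case: ifP => _; last exact: powR0.
by rewrite -expRM; congr expR; ring.
Qed.

Lemma csum_generation l n t :
  csum (generation M n t) (fun u => cexp (- l * (position M u t)%:C%C)) =
  csum [set u | size u = n] (weight l ^~ t).
Proof.
rewrite csum_mkcond [RHS]csum_mkcond; apply: eq_csum => u _; rewrite /weight.
case: (boolP (u \in generation M n t)) => [/set_mem [/= un bu]|/negP h].
  by rewrite mem_set// bu.
case: ifPn => // /set_mem /= un; case: ifPn => // bu.
by exfalso; apply: h; apply/mem_set.
Qed.

Lemma esum_generation s n t :
  \esum_(u in generation M n t) (expR (- s * position M u t))%:E =
  \esum_(u in [set u | size u = n]) (rweight s u t)%:E.
Proof.
rewrite esum_mkcond [RHS]esum_mkcond; apply: eq_esum => u _; rewrite /rweight.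
case: (boolP (u \in generation M n t)) => [/set_mem [/= un bu]|/negP h].
  by rewrite mem_set// bu.
case: ifPn => // /set_mem /= un; case: ifPn => // bu.
by exfalso; apply: h; apply/mem_set.
Qed.

Let take_rcons_sub u i (D : set (seq nat)) :
  (forall k, (k < size (rcons u i))%N -> D (take k (rcons u i))) ->
  (forall k, (k < size u)%N -> D (take k u)) /\ D u.
Proof.
move=> uD; split=> [k ku|].
  have := uD k; rewrite size_rcons ltnS (ltnW ku) => /(_ isT).
  by rewrite -cats1 takel_cat// ltnW.
have := uD (size u); rewrite size_rcons ltnSn => /(_ isT).
by rewrite -cats1 take_size_cat.
Qed.

Lemma Cmeasurable_weight l u (D : set (seq nat)) :
  (forall k, (k < size u)%N -> D (take k u)) ->
  Cmeasurable (weight l u : sigma_space M D -> R[i]).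
Proof.
elim/last_ind: u => [|u i IH] uD.
  rewrite (_ : weight l [::] = fun=> 1); last by apply/funext => t; exact: weight_nil.
  exact: Cmeasurable_cst.
have [uD' Du] := take_rcons_sub uD.
rewrite (_ : weight l (rcons u i) = fun t => weight l u t *
  child_weight l (M u t) i); last by apply/funext => t; exact: weight_rcons.
have [mr mi] := Cmeasurable_child_weight l i.
apply: (CmeasurableM (T := sigma_space M D)); first exact: IH.
by split; [exact: (measurable_sigma_space Du mr)|exact: (measurable_sigma_space Du mi)].
Qed.

Lemma measurable_rweight s u (D : set (seq nat)) :
  (forall k, (k < size u)%N -> D (take k u)) ->
  measurable_fun setT (rweight s u : sigma_space M D -> R).
Proof.
elim/last_ind: u => [|u i IH] uD.
  rewrite (_ : rweight s [::] = cst 1); last by apply/funext => t; exact: rweight_nil.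
  exact: measurable_cst.
have [uD' Du] := take_rcons_sub uD.
rewrite (_ : rweight s (rcons u i) = fun t => rweight s u t *
  child_rweight s (M u t) i); last by apply/funext => t; exact: rweight_rcons.
apply: measurable_funM; first exact: IH.
exact: (measurable_sigma_space Du (measurable_child_rweight s i) (M := M)).
Qed.

End word_weights.

Section identically_distributed.
Context d d' (T : measurableType d) (E : measurableType d') (R : realType)
  (P : probability T R) (I : eqType) (M : I -> T -> E).
Hypothesis hM : iid P M.

Lemma iid_measurable i : measurable_fun setT (M i).
Proof. by case: hM. Qed.

Lemma integral_iid (f : E -> \bar R) i j : measurable_fun setT f ->
  (forall x, 0 <= f x)%E -> (\int[P]_t f (M i t) = \int[P]_t f (M j t))%E.
Proof.
move=> mf f0; have [mM eM _] := hM.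
pose Xi : {mfun T >-> E} := HB.pack (M i) (isMeasurableFun.Build _ _ _ _ _ (mM i)).
pose Xj : {mfun T >-> E} := HB.pack (M j) (isMeasurableFun.Build _ _ _ _ _ (mM j)).
transitivity (\int[distribution P Xi]_x f x)%E.
  by rewrite ge0_integral_pushforward.
transitivity (\int[distribution P Xj]_x f x)%E; last first.
  by rewrite ge0_integral_pushforward.
by apply: eq_measure_integral => A mA _; exact: eM.
Qed.

Lemma integral_mul_indep (D1 D2 : set I) (f g : T -> R) : D1 `&` D2 = set0 ->
  measurable_fun setT (f : sigma_space M D1 -> R) ->
  measurable_fun setT (g : sigma_space M D2 -> R) ->
  (forall t, 0 <= f t) -> (forall t, 0 <= g t) ->
  (\int[P]_t (f t * g t)%:E = (\int[P]_t (f t)%:E) * (\int[P]_t (g t)%:E))%E.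
Proof.
move=> D12 mf mg f0 g0; have [mM _ indepM] := hM.
have mid D := @measurable_id_sigma_space _ _ _ _ _ M D (fun i _ => mM i).
have mfT : measurable_fun setT f := measurableT_comp mf (mid D1).
have mgT : measurable_fun setT g := measurableT_comp mg (mid D2).
rewrite (@integral_decoupling _ _ _ _ _ P _ M mM indepM D1 D2
  (fun s t => (f s * g t)%:E))//; last 2 first.
- apply/measurable_EFinP; apply: measurable_funM.
    exact: (measurableT_comp mf (@measurable_fst _ _ (sigma_space M D1) (sigma_space M D2))).
  exact: (measurableT_comp mg (@measurable_snd _ _ (sigma_space M D1) (sigma_space M D2))).
- by move=> s t; rewrite lee_fin mulr_ge0.
have g0' : (0 <= \int[P]_t (g t)%:E)%E.
  by apply: integral_ge0 => t _; rewrite lee_fin.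
rewrite (eq_integral (fun s => (f s)%:E * \int[P]_t (g t)%:E))%E; last first.
  move=> s _; under eq_integral do rewrite EFinM.
  rewrite ge0_integralZl_EFin//; first by move=> t _; rewrite lee_fin.
  exact/measurable_EFinP.
rewrite ge0_integralZr//; first exact/measurable_EFinP.
by move=> t _; rewrite lee_fin.
Qed.

End identically_distributed.

Lemma ge0_esumZl (R : realType) (I : choiceType) (D : set I) (c : \bar R)
    (a : I -> \bar R) : (0 <= c)%E -> (forall i, 0 <= a i)%E ->
  \esum_(i in D) (c * a i)%E = (c * \esum_(i in D) a i)%E.
Proof.
move=> c0 a0; case: c c0 => [c|_|//].
  by rewrite lee_fin => c0; exact: esumZl.
have [H|/existsNP[i /not_implyP[Di /eqP ai]]] :=
    pselect (forall i, D i -> a i = 0%E).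
  rewrite !esum1 ?mule0// => i Di; by rewrite H ?mule0.
have aip : (0 < a i)%E by rewrite lt0e ai a0.
have le1 (b : I -> \bar R) : (forall j, 0 <= b j)%E -> (b i <= \esum_(j in D) b j)%E.
  move=> b0; rewrite -[leLHS](@esum_set1 _ _ i b)// esum_mkcond [leRHS]esum_mkcond.
  apply: le_esum => j _; case: ifPn => [/set_mem ->|_]; first by rewrite mem_set.
  by case: ifP.
rewrite gt0_mulye; last exact: lt_le_trans aip (le1 a a0).
apply/eqP; rewrite -leye_eq.
apply: le_trans (le1 (fun j => +oo * a j)%E _); first by rewrite gt0_mulye.
by move=> j; rewrite mule_ge0.
Qed.

Section moments.
Context d (T : measurableType d) (R : realType) (P : probability T R)
  (M : seq nat -> T -> point_process_space R).
Hypothesis hM : iid P M.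

Let mM u : measurable_fun setT (M u) := iid_measurable hM u.

Lemma measurable_rweightT s u : measurable_fun setT (rweight M s u).
Proof.
have m1 := measurable_rweight (M := M) s (u := u) (D := setT) (fun _ _ => I).
have m2 := @measurable_id_sigma_space _ _ _ _ _ M setT (fun i _ => mM i).
exact: measurableT_comp m1 m2.
Qed.

Lemma measurable_esum_child_rweight s u : measurable_fun setT
  (fun t => \esum_(i in setT) (child_rweight s (M u t) i)%:E)%E.
Proof.
apply: measurable_esum => [i t|i]; first by rewrite lee_fin child_rweight_ge0.
apply/measurable_EFinP.
exact: (measurableT_comp (measurable_child_rweight _ i) (iid_measurable hM u)).
Qed.

Lemma measurable_esum_rweight s n : measurable_fun setT
  (fun t => \esum_(u in [set u | size u = n]) (rweight M s u t)%:E)%E.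
Proof.
apply: measurable_esum_words => u; first by move=> t; rewrite lee_fin rweight_ge0.
by apply/measurable_EFinP; exact: measurable_rweightT.
Qed.

Lemma mR_esum s (u : seq nat) :
  mR P M s = (\int[P]_t (\esum_(i in setT) (child_rweight s (M u t) i)%:E))%E.
Proof.
rewrite /mR (@integral_iid _ _ _ _ _ _ _ _ hM
    (fun c => \esum_(i in setT) (child_rweight s c i)%:E)%E u [::]); last 2 first.
- apply: measurable_esum => [k c|k]; first by rewrite lee_fin child_rweight_ge0.
  by apply/measurable_EFinP; exact: measurable_child_rweight.
- by move=> c; apply: esum_ge0 => i _; rewrite lee_fin child_rweight_ge0.
apply: eq_integral => t _; rewrite esum_generation esum_rcons; last first.
  by move=> u'; rewrite lee_fin rweight_ge0.
rewrite esum_size0; last by apply: esum_ge0 => i _; rewrite lee_fin rweight_ge0.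
by apply: eq_esum => i _; rewrite rweight_rcons rweight_nil mul1r.
Qed.

Lemma mR_ge0 s : (0 <= mR P M s)%E.
Proof.
rewrite (mR_esum s [::]); apply: integral_ge0 => t _.
by apply: esum_ge0 => i _; rewrite lee_fin child_rweight_ge0.
Qed.

Lemma integral_rweight_rcons s u i :
  (\int[P]_t (rweight M s (rcons u i) t)%:E =
   (\int[P]_t (rweight M s u t)%:E) * (\int[P]_t (child_rweight s (M u t) i)%:E))%E.
Proof.
rewrite -(integral_mul_indep hM (D1 := [set v | (size v < size u)%N]) (D2 := [set u])).
- by apply: eq_integral => t _; rewrite rweight_rcons.
- by apply/seteqP; split=> // v [/= + vu]; rewrite vu ltnn.
- by apply: measurable_rweight => k ku /=; rewrite size_takel// ltnW.
- exact: (measurable_sigma_space _ (measurable_child_rweight s i)).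
- by move=> t; exact: rweight_ge0.
- by move=> t; exact: child_rweight_ge0.
Qed.

Lemma integral_esum_rweight s n :
  (\int[P]_t (\esum_(u in [set u | size u = n]) (rweight M s u t)%:E) =
   mR P M s ^+ n)%E.
Proof.
have r0 u t : (0 <= (rweight M s u t)%:E)%E by rewrite lee_fin rweight_ge0.
have mr u : measurable_fun setT (fun t => (rweight M s u t)%:E).
  by apply/measurable_EFinP; exact: measurable_rweightT.
rewrite integral_esum_words//; elim: n => [|n IH].
  rewrite esum_size0; last by apply: integral_ge0.
  under eq_integral do rewrite rweight_nil.
  by rewrite integral_cst// mul1e expe0; exact: probability_setT.
rewrite esum_rcons; last by move=> u; apply: integral_ge0.
rewrite expeS -IH -ge0_esumZl//; [|exact: mR_ge0|by move=> u; exact: integral_ge0].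
apply: eq_esum => u _; rewrite muleC (mR_esum s u) integral_esum; last 2 first.
- by move=> i t; rewrite lee_fin child_rweight_ge0.
- move=> i; apply/measurable_EFinP.
  exact: (measurableT_comp (measurable_child_rweight s i) (mM u)).
rewrite -ge0_esumZl.
- by apply: eq_esum => i _; exact: integral_rweight_rcons.
- exact: integral_ge0.
- by move=> i; apply: integral_ge0 => t _; rewrite lee_fin child_rweight_ge0.
Qed.

End moments.

Section normalized_offspring.
Context {R : realType}.

Definition offspring (l : R[i]) (c : configuration R) : R[i] :=
  csum setT (child_weight l c).

Lemma Cmeasurable_offspring l :
  Cmeasurable (offspring l : point_process_space R -> R[i]).
Proof. by apply: Cmeasurable_csum => i; exact: Cmeasurable_child_weight. Qed.

Lemma norm_Re_offspring_le l c : (`|(complex.Re (offspring l c))%:E| <=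
  \esum_(i in setT) (child_rweight (complex.Re l) c i)%:E)%E.
Proof.
apply: le_trans (rsum_norm_le _ _) _; apply: le_esum => i _.
by rewrite lee_fin -normc_child_weight norm_Re_le.
Qed.

Lemma norm_Im_offspring_le l c : (`|(complex.Im (offspring l c))%:E| <=
  \esum_(i in setT) (child_rweight (complex.Re l) c i)%:E)%E.
Proof.
apply: le_trans (rsum_norm_le _ _) _; apply: le_esum => i _.
by rewrite lee_fin -normc_child_weight norm_Im_le.
Qed.

(* The factor by which the normalized contribution of an individual to the sum
   over its generation changes when it is replaced by its children, minus 1. *)
Definition centered_offspring (l m : R[i]) (c : configuration R) : R[i] :=
  m^-1 * offspring l c - 1.

Lemma Cmeasurable_centered l m :
  Cmeasurable (centered_offspring l m : point_process_space R -> R[i]).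
Proof.
apply: CmeasurableB; last exact: Cmeasurable_cst.
apply: CmeasurableM; first exact: Cmeasurable_cst.
exact: Cmeasurable_offspring.
Qed.

End normalized_offspring.

Section martingale_differences.
Context d (T : measurableType d) (R : realType) (P : probability T R)
  (M : seq nat -> T -> point_process_space R).
Hypothesis hM : iid P M.
Variable l : R[i].
Local Notation m := (mC P M l).
Hypothesis m0 : m != 0.
Hypothesis mRfin : (mR P M (complex.Re l) < +oo)%E.

Let mM u : measurable_fun setT (M u) := iid_measurable hM u.
Local Notation xi u t := (centered_offspring l m (M u t)).

Lemma csum_generation1 t :
  csum (generation M 1 t) (fun u => cexp (- l * (position M u t)%:C%C)) =
  offspring l (M [::] t).
Proof.
rewrite csum_generation.
have b1 : set_bij setT [set u : seq nat | size u = 1%N] (fun i => [:: i]).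
  split=> [i //|i j _ _ []//|u /=].
  by case: u => // i [|//] _; exists i.
rewrite (csum_reindex _ b1); apply: eq_csum => i _ /=.
by rewrite -[[:: i]]/(rcons [::] i) weight_rcons weight_nil mul1r.
Qed.

Lemma biggins0 t : biggins P M l 0 t = 1.
Proof.
rewrite /biggins expr0 invr1 mul1r csum_generation.
rewrite (_ : [set u : seq nat | size u = 0%N] = [set [::]]); last first.
  by apply/seteqP; split=> [u /= /size0nil//|u /= ->].
by rewrite /csum !rsum_set1 weight_nil.
Qed.

Lemma biggins1 t : biggins P M l 1 t = m^-1 * offspring l (M [::] t).
Proof. by rewrite /biggins expr1 csum_generation1. Qed.

Lemma biggins1_centered t : biggins P M l 1 t - 1 = xi [::] t.
Proof. by rewrite biggins1. Qed.

Let integrable_part (f : R[i] -> R) :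
  measurable_fun setT (fun t => f (offspring l (M [::] t))) ->
  (forall c, (`|(f (offspring l c))%:E| <=
     \esum_(i in setT) (child_rweight (complex.Re l) c i)%:E)%E) ->
  P.-integrable setT (fun t => (f (offspring l (M [::] t)))%:E).
Proof.
move=> /measurable_EFinP mf fle; apply/integrableP; split=> //.
apply: le_lt_trans mRfin; rewrite (mR_esum hM _ [::]).
apply: ge0_le_integral => //.
- exact: measurableT_comp.
- exact: measurable_esum_child_rweight hM _ _.
Qed.

Let iR : P.-integrable setT (fun t => (complex.Re (offspring l (M [::] t)))%:E).
Proof.
apply: integrable_part; last exact: norm_Re_offspring_le.
exact: (measurableT_comp (Cmeasurable_offspring l).1 (mM [::])).
Qed.

Let iI : P.-integrable setT (fun t => (complex.Im (offspring l (M [::] t)))%:E).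
Proof.
apply: integrable_part; last exact: norm_Im_offspring_le.
exact: (measurableT_comp (Cmeasurable_offspring l).2 (mM [::])).
Qed.

Let mCE : m = Cexpectation P (fun t => offspring l (M [::] t)).
Proof. by congr Cexpectation; apply/funext => t; exact: csum_generation1. Qed.

Lemma integral_Re_offspring :
  (\int[P]_t (complex.Re (offspring l (M [::] t)))%:E = (complex.Re m)%:E)%E.
Proof.
rewrite mCE /Cexpectation [complex.Re (_ +i* _)%C]/(fine _) unlock fineK//.
exact: integrable_fin_num iR.
Qed.

Lemma integral_Im_offspring :
  (\int[P]_t (complex.Im (offspring l (M [::] t)))%:E = (complex.Im m)%:E)%E.
Proof.
rewrite mCE /Cexpectation [complex.Im (_ +i* _)%C]/(fine _) unlock fineK//.
exact: integrable_fin_num iI.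
Qed.

Lemma integral_iid_real (f : point_process_space R -> R) u v :
  measurable_fun setT f ->
  (\int[P]_t (f (M u t))%:E = \int[P]_t (f (M v t))%:E)%E.
Proof.
move=> /measurable_EFinP mf; rewrite integralE [RHS]integralE.
have pE w t : ((fun t => (f (M w t))%:E)^\+ t = (EFin \o f)^\+ (M w t))%E.
  by rewrite !funeposE.
have nE w t : ((fun t => (f (M w t))%:E)^\- t = (EFin \o f)^\- (M w t))%E.
  by rewrite !funenegE.
under eq_integral do rewrite pE.
under [X in (_ - X)%E = _]eq_integral do rewrite nE.
under [X in _ = (X - _)%E]eq_integral do rewrite pE.
under [X in _ = (_ - X)%E]eq_integral do rewrite nE.
rewrite (integral_iid hM (f := (EFin \o f)^\+%E) u v (measurable_funepos mf))//.
by rewrite (integral_iid hM (f := (EFin \o f)^\-%E) u v (measurable_funeneg mf)).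
Qed.

Lemma integral_Re_centered u : (\int[P]_t (complex.Re (xi u t))%:E = 0)%E.
Proof.
rewrite (integral_iid_real u [::] (Cmeasurable_centered l m).1).
have i1 := integrableZl measurableT (complex.Re m^-1) iR.
have i2 := integrableZl measurableT (complex.Im m^-1) iI.
have i3 : P.-integrable setT (cst (1%:E : \bar R)).
  exact: finite_measure_integrable_cst.
rewrite (eq_integral (fun t => (complex.Re m^-1)%:E *
    (complex.Re (offspring l (M [::] t)))%:E - (complex.Im m^-1)%:E *
    (complex.Im (offspring l (M [::] t)))%:E - cst 1%:E t)%E); last first.
  by move=> t _; rewrite /centered_offspring Re_subc Re_mulc.
rewrite integralB//; last exact: integrableB.
rewrite integralB// !integralZl// integral_Re_offspring integral_Im_offspring.
rewrite integral_cst// [X in (_ - 1%:E * X)%E]probability_setT mule1.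
rewrite -!EFinM -!EFinB -Re_mulc mulVf//.
by rewrite subrr.
Qed.

Lemma integral_Im_centered u : (\int[P]_t (complex.Im (xi u t))%:E = 0)%E.
Proof.
rewrite (integral_iid_real u [::] (Cmeasurable_centered l m).2).
have i1 := integrableZl measurableT (complex.Re m^-1) iI.
have i2 := integrableZl measurableT (complex.Im m^-1) iR.
rewrite (eq_integral (fun t => (complex.Re m^-1)%:E *
    (complex.Im (offspring l (M [::] t)))%:E + (complex.Im m^-1)%:E *
    (complex.Re (offspring l (M [::] t)))%:E)%E); last first.
  by move=> t _; rewrite /centered_offspring Im_subc Im_mulc subr0.
rewrite integralD// !integralZl// integral_Re_offspring integral_Im_offspring.
by rewrite -!EFinM -!EFinD -Im_mulc mulVf.
Qed.

Lemma integral_normc_centered_lty :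
  exists K : R, forall u, (\int[P]_t (normc (xi u t))%:E <= K%:E)%E.
Proof.
pose S c := (\esum_(i in setT) (child_rweight (complex.Re l) c i)%:E)%E.
have S0 c : (0 <= S c)%E.
  by apply: esum_ge0 => i _; rewrite lee_fin child_rweight_ge0.
have mS u : measurable_fun setT (fun t => S (M u t)).
  exact: measurable_esum_child_rweight hM _ _.
have key c : ((normc (centered_offspring l m c))%:E <=
    (normc m^-1 * 2)%:E * S c + 1)%E.
  apply: (@le_trans _ _ ((normc (m^-1 * offspring l c))%:E + 1)%E).
    rewrite -EFinD lee_fin; apply: le_trans (le_normcD _ _) _.
    by rewrite normcN normc1.
  apply: leeD => //; rewrite normcM !EFinM -muleA.
  apply: lee_wpmul2l; first by rewrite lee_fin normc_ge0.
  rewrite mule_natl mule2n.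
  apply: le_trans (leeD (norm_Re_offspring_le l c) (norm_Im_offspring_le l c)).
  by rewrite !abse_EFin -EFinD lee_fin normc_le_ReIm.
exists (normc m^-1 * 2 * fine (mR P M (complex.Re l)) + 1) => u.
rewrite EFinD EFinM fineK; last by rewrite ge0_fin_numE// (mR_ge0 hM).
apply: (@le_trans _ _ (\int[P]_t ((normc m^-1 * 2)%:E * S (M u t) + 1))%E).
  apply: ge0_le_integral => //.
  - by move=> t _; rewrite lee_fin normc_ge0.
  - apply/measurable_EFinP.
    exact: (measurableT_comp (measurable_normc (Cmeasurable_centered l m)) (mM u)).
  - by apply: emeasurable_funD => //; apply: measurable_funeM.
have k0 : 0 <= normc m^-1 * 2 by rewrite mulr_ge0// normc_ge0.
rewrite ge0_integralD//; [|by move=> t _; rewrite mule_ge0|exact: measurable_funeM].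
rewrite ge0_integralZl_EFin// -(mR_esum hM) integral_cst// mul1e.
by rewrite [X in (_ + X <= _)%E]probability_setT.
Qed.

End martingale_differences.

(** * Increments of the martingale *)

Section increments.
Context d (T : measurableType d) (R : realType) (P : probability T R)
  (M : seq nat -> T -> point_process_space R).
Hypothesis hM : iid P M.
Variable l : R[i].
Local Notation m := (mC P M l).
Local Notation th := (complex.Re l).
Hypothesis m0 : m != 0.
Hypothesis mRfin : (mR P M th < +oo)%E.

Let mM u : measurable_fun setT (M u) := iid_measurable hM u.
Local Notation xi u t := (centered_offspring l m (M u t)).

Definition normalized_weight n k s : R[i] :=
  if size (word k) == n then (m ^+ n)^-1 * weight M l (word k) s else 0.

Local Notation y := normalized_weight.

Lemma increment_csum n t :
  (\esum_(u in [set u | size u = n]) (rweight M th u t)%:E < +oo)%E ->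
  (\esum_(u in [set u | size u = n.+1]) (rweight M th u t)%:E < +oo)%E ->
  biggins P M l n.+1 t - biggins P M l n t =
  csum setT (fun k => y n k t * xi (word k) t).
Proof.
move=> fn fn1.
have sn : csummable [set u | size u = n] (weight M l ^~ t).
  by apply: normc_csummable; under eq_esum do rewrite normc_weight.
have sp : csummable ([set u : seq nat | size u = n] `*`` (fun=> [set: nat]))
    (fun z => weight M l z.1 t * child_weight l (M z.1 t) z.2).
  apply: normc_csummable.
  have := fn1; rewrite (reindex_esum _ _ _ _ (rcons_bij n)).
  apply: le_lt_trans; apply: le_esum => z _.
  by rewrite -weight_rcons normc_weight.
have [s1 s2 s3] := csum_csum (f := fun u i =>
  weight M l u t * child_weight l (M u t) i) sp.
have off u : size u = n -> csum setT (fun i =>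
    weight M l u t * child_weight l (M u t) i) =
    weight M l u t * offspring l (M u t).
  by move=> un; apply: csumZ_factor; exact: s1.
have s2' : csummable [set u | size u = n]
    (fun u => weight M l u t * offspring l (M u t)).
  by apply: eq_csummable s2 => u /off.
have sn1 := csummableZ (m ^+ n.+1)^-1 s2'.
have sn0 := csummableZ (m ^+ n)^-1 sn.
rewrite /biggins !csum_generation (csum_reindex _ (rcons_bij n)).
rewrite (eq_csum (g := fun z => weight M l z.1 t * child_weight l (M z.1 t) z.2));
  last by move=> z _; rewrite /= weight_rcons.
rewrite -s3 (eq_csum off) -!csumZ// -csumB//.
rewrite csum_mkcond (csum_reindex _ (word_bij setT)) preimage_setT.
apply: eq_csum => k _ /=; rewrite /normalized_weight.
have -> : (word k \in [set u | size u = n]) = (size (word k) == n).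
  by apply/idP/eqP => [/set_mem|/mem_set].
case: ifP => _; last by rewrite mul0r.
rewrite /centered_offspring mulrBr mulr1 -mulrA exprS invfM.
by congr (_ - _); rewrite !mulrA [m^-1 * _]mulrC -!mulrA; congr (_ * _);
  rewrite mulrCA.
Qed.

Lemma ae_esum_rweight_lty s n : (mR P M s < +oo)%E ->
  {ae P, forall t,
    (\esum_(u in [set u | size u = n]) (rweight M s u t)%:E < +oo)%E}.
Proof.
move=> sf; apply: ae_esum_words_lty.
- by move=> u t; rewrite lee_fin rweight_ge0.
- by move=> u; apply/measurable_EFinP; exact: measurable_rweightT hM s u.
rewrite (integral_esum_rweight hM) -(@fineK _ (mR P M s)).
  by rewrite -EFin_expe ltry.
by rewrite ge0_fin_numE// (mR_ge0 hM).
Qed.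

Lemma normc_normalized_weight n k s : normc (y n k s) =
  if size (word k) == n then (normc m ^+ n)^-1 * rweight M th (word k) s else 0.
Proof.
rewrite /normalized_weight; case: ifP => _; last exact: normc0.
rewrite normcM normcV normc_weight; congr (_^-1 * _).
by elim: n => [|n IH]; rewrite ?expr0 ?normc1// !exprS normcM IH.
Qed.

Lemma esum_normalized_weight (r : R) n s : r != 0 ->
  \esum_(k in setT) (normc (y n k s) `^ r)%:E =
  (((normc m `^ r) ^+ n)^-1%:E *
   \esum_(u in [set u | size u = n]) (rweight M (r * th) u s)%:E)%E.
Proof.
move=> r0; rewrite -ge0_esumZl; last 2 first.
- by rewrite lee_fin invr_ge0 exprn_ge0// powR_ge0.
- by move=> u; rewrite lee_fin rweight_ge0.
rewrite (reindex_esum _ _ _ _ (word_bij [set u | size u = n])) [RHS]esum_mkcond.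
apply: eq_esum => k _; rewrite normc_normalized_weight.
have -> : (k \in word @^-1` [set u | size u = n]) = (size (word k) == n).
  by apply/idP/eqP => [/set_mem|/mem_set].
case: ifP => _; last by rewrite powR0.
rewrite powRM ?rweight_ge0 ?invr_ge0 ?exprn_ge0 ?normc_ge0// rweight_powR//.
rewrite EFinM; congr (_%:E * _)%E.
rewrite -(@powR_inv1 _ (normc m ^+ n)) ?exprn_ge0 ?normc_ge0// -powRrM mulN1r powRN.
by rewrite powR_exprn ?normc_ge0.
Qed.

Let measurable_term n (D1 D2 : set (seq nat)) : D1 = [set u | (size u < n)%N] ->
  D2 = [set u | size u = n] ->
  measurable_fun setT ((fun z => normc (csum setT
      (fun k => y n k z.1 * xi (word k) z.2))) :
    sigma_space M D1 * sigma_space M D2 -> R).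
Proof.
move=> D1E D2E.
have fst1 := @measurable_fst _ _ (sigma_space M D1) (sigma_space M D2).
have snd2 := @measurable_snd _ _ (sigma_space M D1) (sigma_space M D2).
apply: measurable_normc.
apply: (@Cmeasurable_csum _ _ _ setT
  (fun k (z : sigma_space M D1 * sigma_space M D2) => y n k z.1 * xi (word k) z.2)) => k.
have [kn|/eqP kn] := eqVneq (size (word k)) n; last first.
  rewrite (_ : (fun _ => _) = fun=> 0); first exact: Cmeasurable_cst.
  by apply/funext => z; rewrite /normalized_weight; case: eqP => // _; rewrite mul0r.
rewrite (_ : (fun _ => _) = fun z : sigma_space M D1 * sigma_space M D2 =>
    (m ^+ n)^-1 * weight M l (word k) z.1 * xi (word k) z.2); last first.
  by apply/funext => z; rewrite /normalized_weight kn eqxx.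
have D2k : D2 (word k) by rewrite D2E.
have mw : Cmeasurable (weight M l (word k) : sigma_space M D1 -> R[i]).
  by apply: Cmeasurable_weight => j jk; rewrite D1E /= size_takel ?(ltnW jk)// -kn.
have [mr mi] := Cmeasurable_centered l m.
apply: (@CmeasurableM _ _ _ (fun z : sigma_space M D1 * sigma_space M D2 =>
    (m ^+ n)^-1 * weight M l (word k) z.1) (fun z => xi (word k) z.2)).
  apply: (@CmeasurableM _ _ _ (fun _ : sigma_space M D1 * sigma_space M D2 =>
    (m ^+ n)^-1) (fun z => weight M l (word k) z.1)).
    exact: Cmeasurable_cst.
  exact: (Cmeasurable_comp mw fst1).
split.
  exact: (measurableT_comp (measurable_sigma_space D2k mr (M := M)) snd2).
exact: (measurableT_comp (measurable_sigma_space D2k mi (M := M)) snd2).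
Qed.

Let D1 n := [set u : seq nat | (size u < n)%N].
Let D2 n := [set u : seq nat | size u = n].

Let mf (q : R) n : measurable_fun setT ((fun z => (normc (csum setT
      (fun k => y n k z.1 * xi (word k) z.2)) `^ q)%:E) :
    sigma_space M (D1 n) * sigma_space M (D2 n) -> \bar R).
Proof.
apply: measurable_powR_EFin.
exact: measurable_term.
Qed.

Lemma measurable_decoupled_increment (q : R) n : measurable_fun setT (fun s =>
  \int[P]_t (normc (csum setT (fun k => y n k s * xi (word k) t)) `^ q)%:E)%E.
Proof.
have f0 s t : (0 <= (normc (csum setT (fun k => y n k s * xi (word k) t)) `^ q)%:E)%E.
  by rewrite lee_fin powR_ge0.
exact: (@measurable_integral_decoupling _ _ _ _ _ P _ M mM (D1 n) (D2 n)
  (fun s t => (normc (csum setT (fun k => y n k s * xi (word k) t)) `^ q)%:E)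
  (@mf q n) f0).
Qed.

Lemma Cmeasurable_biggins n : Cmeasurable (biggins P M l n).
Proof.
have mid := @measurable_id_sigma_space _ _ _ _ _ M setT (fun i _ => mM i).
rewrite (_ : biggins P M l n = fun t => (m ^+ n)^-1 *
    csum [set u | size u = n] (weight M l ^~ t)); last first.
  by apply/funext => t; rewrite /biggins csum_generation.
apply: CmeasurableM; first exact: Cmeasurable_cst.
apply: Cmeasurable_csum_words => u.
exact: (Cmeasurable_comp (@Cmeasurable_weight _ _ _ M l u setT (fun _ _ => I)) mid).
Qed.

(* Generation n is a function of the M(u) with |u| < n, and the offspring of
   generation n one of the M(u) with |u| = n: these are independent. *)
Lemma integral_increment (q : R) n :
  (\int[P]_t (normc (biggins P M l n.+1 t - biggins P M l n t) `^ q)%:E =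
   \int[P]_s (\int[P]_t
     (normc (csum setT (fun k => y n k s * xi (word k) t)) `^ q)%:E))%E.
Proof.
have D12 : D1 n `&` D2 n = set0.
  by apply/seteqP; split=> // u []; rewrite /D1 /D2 /= => + un; rewrite un ltnn.
have [_ _ indepM] := hM.
rewrite -(@integral_decoupling _ _ _ _ _ P _ M mM indepM (D1 n) (D2 n)
  (fun s t => (normc (csum setT (fun k => y n k s * xi (word k) t)) `^ q)%:E) D12
  (@mf q n)); last by move=> s t; rewrite lee_fin powR_ge0.
apply: ae_eq_integral => //.
- apply: measurable_powR_EFin.
  apply: measurable_normc; apply: CmeasurableB; exact: Cmeasurable_biggins.
- have mid1 := @measurable_id_sigma_space _ _ _ _ _ M (D1 n) (fun i _ => mM i).
  have mid2 := @measurable_id_sigma_space _ _ _ _ _ M (D2 n) (fun i _ => mM i).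
  have mp : measurable_fun setT
      ((fun t => (t, t)) : T -> sigma_space M (D1 n) * sigma_space M (D2 n)).
    exact/measurable_fun_pair.
  exact: (measurableT_comp (@mf q n) mp).
apply: filterS2 (ae_esum_rweight_lty n mRfin) (ae_esum_rweight_lty n.+1 mRfin).
by move=> t h0 h1 _; rewrite increment_csum.
Qed.

Lemma mutually_independent_words : mutually_independent P (fun k => M (word k)).
Proof.
move=> s A us mA; have [_ _ indepM] := hM.
pose A' u := A (CodeSeq.code u).
have := indepM [seq word k | k <- s] A'.
rewrite map_inj_uniq; last exact: can_inj wordK.
move=> /(_ us) H; rewrite big_map in H.
have {}H := H (_ : forall i, i \in [seq word k | k <- s] -> measurable (A' i)).
rewrite (eq_bigr (fun k => P (M (word k) @^-1` A' (word k)))); last first.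
  by move=> k _; rewrite /A' wordK.
rewrite -H.
  congr (P _); apply/seteqP; split=> t h k /=.
    by move=> /mapP[j js ->]; rewrite /A' wordK; exact: h.
  by move=> ks; have := h (word k); rewrite /A' wordK; apply; exact: map_f.
by move=> u /mapP[j js ->]; rewrite /A' wordK; exact: mA.
Qed.

Let mMw k : measurable_fun setT (M (word k)) := mM (word k).

Let mRe k : measurable_fun setT ((fun t => complex.Re (xi (word k) t)) :
  sigma_space (fun k => M (word k)) [set k] -> R).
Proof.
exact: (@measurable_sigma_space _ _ _ _ _ (fun k => M (word k)) _ _ [set k] k
  (fun c => complex.Re (centered_offspring l m c)) erefl (Cmeasurable_centered l m).1).
Qed.

Let mIm k : measurable_fun setT ((fun t => complex.Im (xi (word k) t)) :
  sigma_space (fun k => M (word k)) [set k] -> R).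
Proof.
exact: (@measurable_sigma_space _ _ _ _ _ (fun k => M (word k)) _ _ [set k] k
  (fun c => complex.Im (centered_offspring l m c)) erefl (Cmeasurable_centered l m).2).
Qed.

Lemma ae_summable_normalized_weight n :
  {ae P, forall s, (\esum_(k in setT) (normc (y n k s))%:E < +oo)%E}.
Proof.
apply: filterS (ae_esum_rweight_lty n mRfin) => s fs.
have := esum_normalized_weight n s (oner_neq0 R).
under eq_esum do rewrite powRr1 ?normc_ge0//.
move=> ->; rewrite mul1r; apply: lte_mul_pinfty => //.
by rewrite lee_fin invr_ge0 exprn_ge0// powR_ge0.
Qed.

Lemma integral_increment_le (q K : R) n : 1 <= q <= 2 ->
  (mR P M (q * th) < +oo)%E ->
  (\int[P]_t (normc (xi [::] t) `^ q)%:E <= K%:E)%E ->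
  (\int[P]_t (normc (biggins P M l n.+1 t - biggins P M l n t) `^ q)%:E <=
   (2 `^ q * 2 `^ (q + 3) * K *
    (fine (mR P M (q * th)) / normc m `^ q) ^+ n)%:E)%E.
Proof.
move=> q12 qfin xiK; have /andP[q1 q2] := q12.
have q0 : q != 0 by rewrite gt_eqF// (lt_le_trans ltr01).
have mK u : (\int[P]_t (normc (xi u t) `^ q)%:E <= K%:E)%E.
  rewrite (integral_iid hM (f := fun c => (normc (centered_offspring l m c) `^ q)%:E)
    u [::])//.
    apply: measurable_powR_EFin.
    exact: measurable_normc (Cmeasurable_centered l m).
  by move=> c; rewrite lee_fin powR_ge0.
have K0 : 0 <= K.
  rewrite -lee_fin; apply: le_trans xiK; apply: integral_ge0 => t _.
  by rewrite lee_fin powR_ge0.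
have [K1 xiK1] := integral_normc_centered_lty hM mRfin.
pose C : R := 2 `^ q * 2 `^ (q + 3).
have C0 : 0 <= C by rewrite mulr_ge0// powR_ge0.
pose S s := (\esum_(u in [set u | size u = n]) (rweight M (q * th) u s)%:E)%E.
have S0 s : (0 <= S s)%E.
  by apply: esum_ge0 => u _; rewrite lee_fin rweight_ge0.
have mS : measurable_fun setT S.
  exact: measurable_esum_rweight hM _ _.
pose b : R := C * K * ((normc m `^ q) ^+ n)^-1.
have b0 : 0 <= b by rewrite !mulr_ge0// invr_ge0 exprn_ge0// powR_ge0.
rewrite integral_increment.
apply: (@le_trans _ _ (\int[P]_s (b%:E * S s))%E).
  apply: ae_ge0_le_integral => //.
  - move=> s _; apply: integral_ge0 => t _; by rewrite lee_fin powR_ge0.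
  - exact: measurable_decoupled_increment.
  - by move=> s _; rewrite mule_ge0// lee_fin.
  - exact: measurable_funeM.
  apply: filterS (ae_summable_normalized_weight n) => s ys _.
  have := integral_csum_powR_le mMw mutually_independent_words mRe mIm
    (fun k => xiK1 (word k))
    (fun k => integral_Re_centered hM m0 mRfin (word k))
    (fun k => integral_Im_centered hM m0 mRfin (word k)) ys q12.
  move=> /le_trans; apply; rewrite -/C.
  apply: (@le_trans _ _ (C%:E * (K%:E *
      \esum_(k in setT) (normc (y n k s) `^ q)%:E))%E).
    apply: lee_wpmul2l; first by rewrite lee_fin.
    rewrite -esumZl//; last by move=> k; rewrite lee_fin powR_ge0.
    apply: le_esum => k _; rewrite [leLHS]muleC.
    apply: lee_wpmul2r; first by rewrite lee_fin powR_ge0.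
    exact: (mK (word k)).
  by rewrite esum_normalized_weight// !muleA -!EFinM.
rewrite ge0_integralZl_EFin// (integral_esum_rweight hM).
rewrite -(@fineK _ (mR P M (q * th))); last first.
  by rewrite ge0_fin_numE// (mR_ge0 hM).
by rewrite -EFin_expe -EFinM lee_fin /b expr_div_n /C !mulrA mulrAC.
Qed.

Let partial_sum_gt (delta : R) (a : nat -> R) : (forall k, 0 <= a k) ->
  (delta%:E < \esum_(k in setT) (a k)%:E)%E -> exists N, delta < \sum_(k < N) a k.
Proof.
move=> a0; rewrite -nneseries_esumT; last by move=> k; rewrite lee_fin.
move=> h; apply: contrapT => /forallNP H; move: h; apply/negP; rewrite -leNgt.
apply: lime_le; first by apply: is_cvg_nneseries => k _ _; rewrite lee_fin.
apply: nearW => N; rewrite sumEFin lee_fin big_mkord leNgt; exact/negP/H.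
Qed.

Lemma integral_increment_ge (p al delta c : R) n : 1 <= p <= 2 -> al != 0 ->
  0 <= c ->
  (forall N (r : nat -> R), (forall k, 0 <= r k) ->
    delta < \sum_(k < N) r k `^ al ->
    (c%:E <= \int[P]_t
      ((\sum_(k < N) (r k * normc (xi (word k) t)) ^+ 2) `^ (p / 2))%:E)%E) ->
  ((4 / 9 * c)%:E * P [set s | (delta%:E < ((normc m `^ al) ^+ n)^-1%:E *
     \esum_(u in [set u | size u = n]) (rweight M (al * th) u s)%:E)%E] <=
   (2 `^ (p + 2))%:E *
   \int[P]_t (normc (biggins P M l n.+1 t - biggins P M l n t) `^ p)%:E)%E.
Proof.
move=> p12 al0 c0 hc; set A := [set s | _].
have [K1 xiK1] := integral_normc_centered_lty hM mRfin.
have mA : measurable A.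
  rewrite -[A]setTI; apply: emeasurable_fun_o_infty => //.
  apply: measurable_funeM; exact: measurable_esum_rweight hM _ _.
have mI := measurable_decoupled_increment p n.
have I0 s : (0 <= \int[P]_t
    (normc (csum setT (fun k => y n k s * xi (word k) t)) `^ p)%:E)%E.
  by apply: integral_ge0 => t _; rewrite lee_fin powR_ge0.
have c'0 : 0 <= 4 / 9 * c by rewrite mulr_ge0//; lra.
rewrite integral_increment -ge0_integralZl_EFin ?powR_ge0//.
rewrite -integral_cst//.
rewrite [leLHS]integral_mkcond.
apply: ae_ge0_le_integral => //.
- by move=> s _; rewrite patchE; case: ifP => // _; rewrite lee_fin.
- by apply/(measurable_restrictT _ mA); exact: measurable_cst.
- by move=> s _; rewrite mule_ge0// lee_fin powR_ge0.
- exact: measurable_funeM.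
apply: filterS (ae_summable_normalized_weight n) => s ys _.
rewrite patchE; case: ifPn => [/set_mem sA|_]; last first.
  by rewrite mule_ge0// lee_fin powR_ge0.
move: sA; rewrite /A /= -esum_normalized_weight// => /partial_sum_gt.
case=> [k|N /(hc N (fun k => normc (y n k s)) (fun k => normc_ge0 _)) hN].
  exact: powR_ge0.
have h := integral_csum_powR_ge mMw mutually_independent_words mRe mIm
    (fun k => xiK1 (word k))
    (fun k => integral_Re_centered hM m0 mRfin (word k))
    (fun k => integral_Im_centered hM m0 mRfin (word k)) ys N p12.
apply: le_trans h; rewrite EFinM; apply: lee_wpmul2l; first by rewrite lee_fin; lra.
apply: le_trans hN _.
by under eq_integral do under eq_bigr do rewrite -normcM.
Qed.

End increments.

(** * Sufficiency *)

Section Lp_convergence.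
Context d (T : measurableType d) (R : realType) (P : probability T R).

Lemma CLnorm_powR (p : R) (Z : T -> R[i]) : p != 0 ->
  (CLnorm P p Z `^ p = \int[P]_t (normc (Z t) `^ p)%:E)%E.
Proof.
move=> p0; rewrite /CLnorm (powR_Lnorm _ _ p0); apply: eq_integral => t _.
by rewrite abse_EFin poweR_EFin ger0_norm ?normc_ge0.
Qed.

Lemma CLnormE (p : R) (Z : T -> R[i]) : p != 0 ->
  (CLnorm P p Z = (\int[P]_t (normc (Z t) `^ p)%:E) `^ p^-1)%E.
Proof.
move=> p0; rewrite -CLnorm_powR// -poweRrM divff// poweRe1//.
exact: Lnorm_ge0.
Qed.

Lemma powR_weighted_sum_le (p : R) (I : Type) (s : seq I) (w x : I -> R) :
  1 <= p -> (forall i, 0 < w i) -> (forall i, 0 <= x i) ->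
  \sum_(i <- s) w i <= 1 ->
  (\sum_(i <- s) x i) `^ p <= \sum_(i <- s) w i `^ (1 - p) * x i `^ p.
Proof.
move=> p1 w0 x0; set W := \sum_(i <- s) w i => W1.
have W0 : 0 <= W by apply: sumr_ge0 => i _; rewrite ltW.
set a := \sum_(i <- s) x i.
have a0 : 0 <= a by apply: sumr_ge0.
have xw i : 0 <= x i / w i by rewrite divr_ge0// ltW.
apply: (@le_trans _ _ (\sum_(i <- s)
    w i * (a `^ p + p * a `^ (p - 1) * (x i / w i - a)))); last first.
  apply: ler_sum => i _.
  have -> : w i `^ (1 - p) * x i `^ p = w i * (x i / w i) `^ p.
    rewrite powRM// ?invr_ge0 ?(ltW (w0 i))//.
    rewrite -[(w i)^-1]powR_inv1 ?(ltW (w0 i))// -powRrM mulN1r mulrCA mulrC.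
    congr (_ * _); rewrite powRD; last by rewrite (gt_eqF (w0 i)) implybT.
    by rewrite powRr1// ltW.
  by rewrite ler_wpM2l ?(ltW (w0 i))// powR_tangent.
have -> : \sum_(i <- s) w i * (a `^ p + p * a `^ (p - 1) * (x i / w i - a)) =
    W * (a `^ p) + p * a `^ (p - 1) * (a - W * a).
  rewrite (eq_bigr (fun i => w i * a `^ p + p * a `^ (p - 1) * (x i - w i * a))).
    rewrite big_split /= -mulr_suml -mulr_sumr; congr (_ + _ * _).
    by rewrite sumrB -mulr_suml.
  by move=> i _; field; rewrite gt_eqF.
have -> : p * a `^ (p - 1) * (a - W * a) = p * (1 - W) * a `^ p.
  rewrite -(@mulr_powRB1 _ a p)//; first by ring.
  exact: lt_le_trans ltr01 p1.
have ap : 0 <= a `^ p by exact: powR_ge0.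
have : 0 <= (p - 1) * (1 - W) * a `^ p by rewrite !mulr_ge0// subr_ge0.
nra.
Qed.

Lemma geometric_sum_le (s : R) n N : 0 <= s < 1 ->
  \sum_(n <= k < N) s ^+ k <= s ^+ n / (1 - s).
Proof.
move=> /andP[s0 s1]; have s1' : 0 < 1 - s by rewrite subr_gt0.
rewrite ler_pdivlMr//; have [nN|/ltnW Nn] := leqP n N; last first.
  by rewrite big_geq// mul0r exprn_ge0.
rewrite mulr_suml (eq_bigr (fun k => - s ^+ k.+1 - - s ^+ k)); last first.
  by move=> k _; rewrite exprS; ring.
rewrite telescope_sumr// opprK addrC lerBlDr lerDl.
exact: exprn_ge0.
Qed.

Lemma esum_geometric_lty (s : R) : 0 <= s < 1 ->
  (\esum_(k in [set: nat]) (s ^+ k)%:E < +oo)%E.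
Proof.
move=> /[dup] s01 /andP[s0 s1].
rewrite -nneseries_esumT; last by move=> k; rewrite lee_fin exprn_ge0.
apply: (@le_lt_trans _ _ ((1 - s)^-1)%:E); last exact: ltry.
apply: lime_le; first by apply: is_cvg_nneseries => k _ _; rewrite lee_fin exprn_ge0.
apply: nearW => n; rewrite sumEFin lee_fin.
by apply: le_trans (geometric_sum_le 0 n s01) _; rewrite expr0 mul1r.
Qed.

Variables (p C tau : R) (Z : nat -> T -> R[i]).
Hypothesis p12 : 1 <= p <= 2.
Hypothesis C0 : 0 <= C.
Hypothesis tau01 : 0 < tau < 1.
Hypothesis mZ : forall n, Cmeasurable (Z n).
Hypothesis Z0 : in_Lp P p (Z 0%N).
Hypothesis dZ : forall n,
  (\int[P]_t (normc (Z n.+1 t - Z n t) `^ p)%:E <= (C * tau ^+ n)%:E)%E.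

Let s : R := Num.sqrt tau.
Let s0 : 0 < s. Proof. by rewrite sqrtr_gt0; case/andP: tau01. Qed.
Let s1 : s < 1.
Proof.
rewrite -(ltr_pXn2r (n := 2)) ?nnegrE ?(ltW s0)// expr1n sqr_sqrtr.
  by case/andP: tau01.
by apply: ltW; case/andP: tau01.
Qed.
Let ts : tau = s ^+ 2.
Proof. by rewrite sqr_sqrtr//; apply: ltW; case/andP: tau01. Qed.
Let w (k : nat) : R := (1 - s) * s ^+ k.
Let w0 k : 0 < w k.
Proof. by rewrite mulr_gt0 ?exprn_gt0// subr_gt0. Qed.

Let w_sum n N : \sum_(n <= k < N) w k <= 1.
Proof.
rewrite -mulr_sumr mulrC -ler_pdivlMr ?subr_gt0// div1r.
apply: le_trans (geometric_sum_le n N (_ : 0 <= s < 1)) _; first by rewrite (ltW s0) s1.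
by rewrite ler_piMl ?invr_ge0 ?subr_ge0 ?(ltW s1)// exprn_ile1// ltW.
Qed.

Let D k t := normc (Z k.+1 t - Z k t).
Let D0 k t : 0 <= D k t. Proof. exact: normc_ge0. Qed.
Let mD k : measurable_fun setT (D k).
Proof. by apply: measurable_normc; exact: CmeasurableB. Qed.

Let c1 : R := (1 - s) `^ (1 - p).
Let c10 : 0 <= c1. Proof. exact: powR_ge0. Qed.

Let weight_le k : w k `^ (1 - p) * (C * tau ^+ k) <= c1 * C * s ^+ k.
Proof.
have /andP[p1 p2] := p12.
rewrite /w powRM ?subr_ge0 ?(ltW s1) ?exprn_ge0 ?(ltW s0)// -/c1 -mulrA.
rewrite -[leRHS]mulrA ler_wpM2l// mulrCA ler_wpM2l//.
rewrite ts -exprM mulnC exprM; set v := s ^+ k.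
have v0 : 0 < v by rewrite exprn_gt0.
have v1 : v <= 1 by rewrite exprn_ile1// ltW.
rewrite -(powR_mulrn 2 (ltW v0)) -powRD; last by rewrite (gt_eqF v0) implybT.
rewrite -[leRHS](powRr1 (ltW v0)); apply: ger_powR; first by rewrite v0.
lra.
Qed.

Let integral_tail_le n N :
  (\int[P]_t ((\sum_(n <= k < N) D k t) `^ p)%:E <=
   (c1 * C / (1 - s) * s ^+ n)%:E)%E.
Proof.
have /andP[p1 p2] := p12.
have mDp k : measurable_fun setT (fun t => w k `^ (1 - p) * D k t `^ p).
  apply: measurable_funM => //; exact: (measurableT_comp (measurable_powR p)).
have Dp0 k t : 0 <= w k `^ (1 - p) * D k t `^ p by rewrite mulr_ge0// powR_ge0.
apply: (@le_trans _ _ (\int[P]_t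
    (\sum_(n <= k < N) (w k `^ (1 - p) * D k t `^ p)%:E)))%E.
  apply: ge0_le_integral => //.
  - by move=> t _; rewrite lee_fin powR_ge0.
  - by apply: measurable_powR_EFin; exact: measurable_sum.
  - by apply: emeasurable_sum => k; exact/measurable_EFinP.
  move=> t _; rewrite sumEFin lee_fin.
  exact: (powR_weighted_sum_le p1 w0 (fun k => D0 k t) (w_sum n N)).
rewrite ge0_integral_sum//; [|by move=> k; exact/measurable_EFinP
  |by move=> k t _; rewrite lee_fin].
apply: (@le_trans _ _ (\sum_(n <= k < N) (c1 * C * s ^+ k)%:E)%E).
  apply: lee_sum => k _; apply: le_trans (_ : _ <= (w k `^ (1 - p))%:E *
      (C * tau ^+ k)%:E)%E _; last by rewrite -EFinM lee_fin weight_le.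
  under eq_integral do rewrite EFinM.
  rewrite ge0_integralZl_EFin ?powR_ge0//.
  - by apply: lee_wpmul2l; [rewrite lee_fin powR_ge0|exact: dZ].
  - by move=> t _; rewrite lee_fin powR_ge0.
  - by apply: measurable_powR_EFin.
rewrite sumEFin lee_fin -mulr_sumr -[leRHS]mulrA ler_wpM2l ?mulr_ge0//.
by rewrite mulrC geometric_sum_le// (ltW s0) s1.
Qed.

Let ae_summable_D : {ae P, forall t, (\esum_(k in setT) (D k t)%:E < +oo)%E}.
Proof.
have /andP[p1 p2] := p12.
have mDE k : measurable_fun setT (fun t => (D k t)%:E) by exact/measurable_EFinP.
have sm : (\esum_(k in setT) \int[P]_t `|(D k t)%:E| < +oo)%E.
  apply: (@le_lt_trans _ _ (\esum_(k in setT) (1 + c1 * C)%:E * (s ^+ k)%:E)%E).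
    apply: le_esum => k _.
    apply: (@le_trans _ _ (\int[P]_t ((w k)%:E +
        (w k `^ (1 - p))%:E * (D k t `^ p)%:E))%E).
      apply: ge0_le_integral => //.
      - exact: measurableT_comp.
      - apply: emeasurable_funD => //; apply: measurable_funeM; apply/measurable_EFinP.
        exact: (measurableT_comp (measurable_powR p)).
      move=> t _; rewrite abse_EFin -EFinM -EFinD lee_fin ger0_norm//.
      have wD : 0 <= D k t / w k by rewrite divr_ge0// ltW.
      have := @powR_le1D _ 1 p _ _ wD; rewrite ler01 p1 => /(_ isT).
      rewrite powRr1// powRM ?invr_ge0 ?(ltW (w0 k))//.
      rewrite ler_pdivrMr//; move/le_trans; apply.
      rewrite mulrDl mul1r lerD2l.
      rewrite -[(w k)^-1]powR_inv1 ?(ltW (w0 k))// -powRrM mulN1r -mulrA mulrC.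
      rewrite -{2}[w k]powRr1 ?(ltW (w0 k))// -powRD; last first.
        by rewrite (gt_eqF (w0 k)) implybT.
      by rewrite addrC.
    rewrite ge0_integralD//; last 3 first.
    - by move=> t _; rewrite lee_fin ltW.
    - by move=> t _; rewrite -EFinM lee_fin mulr_ge0// powR_ge0.
    - apply: measurable_funeM; apply/measurable_EFinP.
      exact: (measurableT_comp (measurable_powR p)).
    rewrite integral_cst// [X in (_ * X + _)%E]probability_setT mule1.
    rewrite ge0_integralZl_EFin ?powR_ge0//; last 2 first.
    - by move=> t _; rewrite lee_fin powR_ge0.
    - by apply: measurable_powR_EFin.
    apply: (@le_trans _ _ ((w k)%:E + (w k `^ (1 - p))%:E * (C * tau ^+ k)%:E)%E).
      by apply: leeD => //; apply: lee_wpmul2l; [rewrite lee_fin powR_ge0|exact: dZ].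
    rewrite -!EFinM -EFinD lee_fin mulrDl mul1r; apply: lerD; last exact: weight_le.
    by rewrite /w ler_piMl ?exprn_ge0 ?(ltW s0)// gerBl ltW.
  rewrite esumZl; [|by rewrite addr_ge0// mulr_ge0|by move=> k; rewrite lee_fin exprn_ge0// ltW].
  apply: lte_mul_pinfty; [by rewrite lee_fin addr_ge0// mulr_ge0|by []|].
  by apply: esum_geometric_lty; rewrite (ltW s0) s1.
apply: filterS (ae_abs_summable mD sm) => t.
by apply: le_lt_trans; apply: le_esum => k _; rewrite lee_fin ler_norm.
Qed.

Let Zoo t := Z 0%N t + csum setT (fun k => Z k.+1 t - Z k t).

Let mZoo : Cmeasurable Zoo.
Proof.
apply: CmeasurableD => //; apply: Cmeasurable_csum => k; exact: CmeasurableB.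
Qed.

Let cvg_part (f : R[i] -> R) t : (forall z w, f (z - w) = f z - f w) ->
  (forall z, `|f z| <= normc z) ->
  (\esum_(k in setT) (D k t)%:E < +oo)%E ->
  f (Z n t) @[n --> \oo] -->
    f (Z 0%N t) + rsum setT (fun k => f (Z k.+1 t - Z k t)).
Proof.
move=> fB fle fin.
have -> : (fun n => f (Z n t)) =
    fun n => f (Z 0%N t) + \sum_(k < n) f (Z k.+1 t - Z k t).
  apply/funext => n; rewrite -(big_mkord xpredT (fun k => f (Z k.+1 t - Z k t))).
  rewrite (eq_bigr (fun k => f (Z k.+1 t) - f (Z k t))); last by move=> k _.
  by rewrite telescope_sumr// addrC subrK.
apply: cvgD; first exact: cvg_cst.
apply: cvg_rsum; apply: le_lt_trans fin; apply: le_esum => k _.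
by rewrite lee_fin; exact: fle.
Qed.

Let part_le (f : R[i] -> R) t n N : (forall z w, f (z - w) = f z - f w) ->
  (forall z, `|f z| <= normc z) ->
  `|f (Z (N + n)%N t) - f (Z n t)| <= \sum_(n <= k < N + n) D k t.
Proof.
move=> fB fle; rewrite -(telescope_sumr (fun k => f (Z k t))) ?leq_addl//.
apply: le_trans (ler_norm_sum _ _ _) _; apply: ler_sum => k _.
by rewrite -fB; exact: fle.
Qed.

Let integral_remainder_le n :
  (\int[P]_t (normc (Z n t - Zoo t) `^ p)%:E <=
   (2 `^ p * (c1 * C / (1 - s)) * s ^+ n)%:E)%E.
Proof.
have /andP[p1 p2] := p12; have p0 : 0 <= p := le_trans ler01 p1.
pose h (z w : R[i]) : R := (`|complex.Re z - complex.Re w| +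
  `|complex.Im z - complex.Im w|) `^ p.
have mh (X Y : T -> R[i]) : Cmeasurable X -> Cmeasurable Y ->
    measurable_fun setT (fun t => h (X t) (Y t)).
  move=> [x1 x2] [y1 y2]; apply: (measurableT_comp (measurable_powR p)).
  by apply: measurable_funD; apply: measurableT_comp => //; exact: measurable_funB.
apply: (@le_trans _ _ (\int[P]_t (h (Zoo t) (Z n t))%:E)%E).
  apply: ge0_le_integral => //.
  - by move=> t _; rewrite lee_fin powR_ge0.
  - apply: measurable_powR_EFin.
    by apply: measurable_normc; exact: CmeasurableB.
  - by apply/measurable_EFinP; exact: mh.
  move=> t _; rewrite lee_fin /h; apply: ge0_ler_powR => //.
  - by rewrite nnegrE normc_ge0.
  - by rewrite nnegrE addr_ge0.
  apply: le_trans (normc_le_ReIm _) _; rewrite Re_subc Im_subc.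
  by rewrite distrC [X in _ + X]distrC.
apply: (@fatou_bound _ _ _ P (fun N t => h (Z (N + n)%N t) (Z n t))) => //.
- by move=> N; exact: mh.
- by apply: mh.
- by move=> N t; exact: powR_ge0.
- by move=> t; exact: powR_ge0.
- apply: filterS ae_summable_D => t fin.
  apply: (@cvg_powR _ (fun N =>
      `|complex.Re (Z (N + n)%N t) - complex.Re (Z n t)| +
      `|complex.Im (Z (N + n)%N t) - complex.Im (Z n t)|) _ p) => //.
  have cR := cvg_part Re_subc norm_Re_le fin.
  have cI := cvg_part Im_subc norm_Im_le fin.
  have -> : complex.Re (Zoo t) = complex.Re (Z 0%N t) +
      rsum setT (fun k => complex.Re (Z k.+1 t - Z k t)).
    by rewrite /Zoo; case: (Z 0%N t).
  have -> : complex.Im (Zoo t) = complex.Im (Z 0%N t) +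
      rsum setT (fun k => complex.Im (Z k.+1 t - Z k t)).
    by rewrite /Zoo; case: (Z 0%N t).
  apply: cvgD; apply: cvg_norm; apply: cvgB; try exact: cvg_cst.
    by have := cR; rewrite -(cvg_shiftn n).
  by have := cI; rewrite -(cvg_shiftn n).
move=> N; apply: (@le_trans _ _ ((2 `^ p)%:E *
    \int[P]_t ((\sum_(n <= k < N + n) D k t) `^ p)%:E)%E); last first.
  rewrite -mulrA EFinM; apply: lee_wpmul2l; first by rewrite lee_fin powR_ge0.
  exact: integral_tail_le.
have mS : measurable_fun setT (fun t => ((\sum_(n <= k < N + n) D k t) `^ p)%:E).
  apply: measurable_powR_EFin.
  exact: measurable_sum.
rewrite -ge0_integralZl_EFin ?powR_ge0//; last by move=> t _; rewrite lee_fin powR_ge0.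
apply: ge0_le_integral => //.
- by move=> t _; rewrite lee_fin powR_ge0.
- by apply/measurable_EFinP; apply: mh.
- exact: measurable_funeM.
move=> t _; rewrite -EFinM lee_fin /h -powRM//; last exact: sumr_ge0.
apply: ge0_ler_powR => //.
- by rewrite nnegrE addr_ge0.
- by rewrite nnegrE mulr_ge0// sumr_ge0.
rewrite mulr_natl mulr2n; apply: lerD.
  exact: part_le Re_subc norm_Re_le.
exact: part_le Im_subc norm_Im_le.
Qed.

Lemma converges_in_Lp_geometric : converges_in_Lp P p Z.
Proof.
have /andP[p1 p2] := p12; have p0 : 0 < p := lt_le_trans ltr01 p1.
pose K := 2 `^ p * (c1 * C / (1 - s)).
have K0 : 0 <= K by rewrite !mulr_ge0 ?powR_ge0// invr_ge0 subr_ge0 ltW.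
have nrm (X Y : T -> R[i]) : Cmeasurable X -> Cmeasurable Y ->
    (\int[P]_t (normc (X t) `^ p)%:E < +oo)%E ->
    (\int[P]_t (normc (X t - Y t) `^ p)%:E < +oo)%E ->
    (\int[P]_t (normc (Y t) `^ p)%:E < +oo)%E.
  move=> mX mY Xf XYf.
  have mXp : measurable_fun setT (fun t => (normc (X t) `^ p)%:E).
    by apply: measurable_powR_EFin; exact: measurable_normc.
  have mXYp : measurable_fun setT (fun t => (normc (X t - Y t) `^ p)%:E).
    by apply: measurable_powR_EFin; apply: measurable_normc; exact: CmeasurableB.
  apply: (@le_lt_trans _ _ (\int[P]_t ((2 `^ p)%:E *
      ((normc (X t) `^ p)%:E + (normc (X t - Y t) `^ p)%:E)))%E).
    apply: ge0_le_integral => //.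
    - by move=> t _; rewrite lee_fin powR_ge0.
    - apply: measurable_powR_EFin.
      exact: measurable_normc.
    - by apply: measurable_funeM; exact: emeasurable_funD.
    move=> t _; rewrite -EFinD -EFinM lee_fin.
    apply: le_trans (powRD_le (ltW p0) (normc_ge0 _) (normc_ge0 _)).
    apply: ge0_ler_powR; rewrite ?nnegrE ?addr_ge0 ?normc_ge0// ?(ltW p0)//.
    have {1}-> : Y t = X t - (X t - Y t) by rewrite opprB addrC subrK.
    by apply: le_trans (le_normcD _ _) _; rewrite normcN.
  rewrite ge0_integralZl_EFin ?powR_ge0//; last 2 first.
  - by move=> t _; rewrite adde_ge0// lee_fin powR_ge0.
  - exact: emeasurable_funD.
  rewrite ge0_integralD//; [|by move=> t _; rewrite lee_fin powR_ge0
    |by move=> t _; rewrite lee_fin powR_ge0].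
  apply: lte_mul_pinfty; [by rewrite lee_fin powR_ge0|by []|].
  by move: Xf XYf; move: (integral P _ _) (integral P _ _) => a b; exact: lte_add_pinfty.
have inLp X : Cmeasurable X -> (\int[P]_t (normc (X t) `^ p)%:E < +oo)%E ->
    in_Lp P p X.
  move=> mX Xf; split=> //; rewrite CLnormE ?gt_eqF//.
  exact: poweR_lty.
have Z0f : (\int[P]_t (normc (Z 0%N t) `^ p)%:E < +oo)%E.
  rewrite -CLnorm_powR ?gt_eqF//; apply: poweR_lty.
  by case: Z0.
have Zoof : (\int[P]_t (normc (Zoo t) `^ p)%:E < +oo)%E.
  apply: nrm (mZ 0%N) mZoo Z0f _.
  exact: le_lt_trans (integral_remainder_le 0) (ltry _).
have symm (X Y : T -> R[i]) : (\int[P]_t (normc (X t - Y t) `^ p)%:E =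
    \int[P]_t (normc (Y t - X t) `^ p)%:E)%E.
  by apply: eq_integral => t _; rewrite -opprB normcN.
split.
  move=> n; apply: (inLp _ (mZ n)); apply: nrm mZoo (mZ n) Zoof _.
  by rewrite symm; exact: le_lt_trans (integral_remainder_le n) (ltry _).
exists Zoo; first exact: inLp mZoo Zoof.
apply: (@squeeze_cvge _ _ _ _ (fun=> 0%E) _
    (fun n => ((K `^ p^-1) * (s `^ p^-1) ^+ n)%:E)).
- near=> n; rewrite Lnorm_ge0 /= CLnormE ?gt_eqF//.
  have -> : K `^ p^-1 * (s `^ p^-1) ^+ n = (K * s ^+ n) `^ p^-1.
    by rewrite powRM ?exprn_ge0 ?(ltW s0)// powR_exprn// ltW.
  rewrite -poweR_EFin; apply: gt0_ler_poweR.
  - by rewrite invr_ge0 ltW.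
  - by rewrite in_itv/= leey andbT integral_ge0// => t _; rewrite lee_fin powR_ge0.
  - by rewrite in_itv/= leey andbT lee_fin mulr_ge0// exprn_ge0// ltW.
  exact: integral_remainder_le.
- exact: cvg_cst.
apply: cvg_EFin; first by near=> n.
rewrite -[X in _ --> X](mulr0 (K `^ p^-1)); apply: cvgM; first exact: cvg_cst.
apply: cvg_expr; rewrite ger0_norm ?powR_ge0//.
have : s `^ p^-1 < 1 `^ p^-1.
  by apply: gt0_ltr_powR; rewrite ?nnegrE ?invr_gt0// ltW.
by rewrite powR1.
Unshelve. all: by end_near. Qed.

End Lp_convergence.

Section Lp_convergence_criteria.
Context d (T : measurableType d) (R : realType) (P : probability T R).

Lemma measurable_normcB_powR (p : R) (X Y : T -> R[i]) :
  Cmeasurable X -> Cmeasurable Y ->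
  measurable_fun setT (fun t => (normc (X t - Y t) `^ p)%:E).
Proof.
move=> mX mY; apply: measurable_powR_EFin; apply: measurable_normc.
exact: CmeasurableB.
Qed.

Lemma converges_in_Lp_increments (p q C rho : R) (Z : nat -> T -> R[i]) :
  1 <= p <= q -> q <= 2 -> 0 <= C -> 0 <= rho < 1 ->
  (forall n, Cmeasurable (Z n)) -> in_Lp P p (Z 0%N) ->
  (forall n, \int[P]_t (normc (Z n.+1 t - Z n t) `^ q)%:E <=
     (C * rho ^+ n)%:E)%E ->
  converges_in_Lp P p Z.
Proof.
move=> /andP[p1 pq] q2 C0 /andP[rho0 rho1] mZ Z0 dZ.
have p0 : 0 <= p by rewrite (le_trans ler01).
pose r : R := Num.max rho 2^-1.
have r0 : 0 < r by rewrite lt_max; apply/orP; right; rewrite invr_gt0.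
have r1 : r < 1 by rewrite gt_max rho1/=; lra.
pose s : R := Num.sqrt r.
have s0 : 0 < s by rewrite sqrtr_gt0.
have sr : r = s ^+ 2 by rewrite sqr_sqrtr// ltW.
have s1 : s < 1 by rewrite -(ltr_pXn2r (n := 2)) ?nnegrE ?(ltW s0)// expr1n -sr.
apply: (@converges_in_Lp_geometric _ _ _ P p (1 + C) s Z) => //.
- by rewrite p1 (le_trans pq).
- by rewrite addr_ge0.
- by rewrite s0.
move=> n; set w := s ^+ n.
have w0 : 0 < w by rewrite exprn_gt0.
have w1 : w <= 1 by rewrite exprn_ile1// ltW.
have mq := measurable_normcB_powR q (mZ n.+1) (mZ n).
apply: (@le_trans _ _ (\int[P]_t ((w `^ p)%:E + (w `^ (p - q))%:E *
    (normc (Z n.+1 t - Z n t) `^ q)%:E))%E).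
  apply: ge0_le_integral => //.
  - by move=> t _; rewrite lee_fin powR_ge0.
  - exact: measurable_normcB_powR.
  - by apply: emeasurable_funD => //; exact: measurable_funeM.
  move=> t _; rewrite -EFinM -EFinD lee_fin; set x := normc _.
  have x0 : 0 <= x by exact: normc_ge0.
  have xw : 0 <= x / w by rewrite divr_ge0// ltW.
  have := @powR_le1D _ p q _ _ xw; rewrite p0 pq => /(_ isT) h.
  have -> : x `^ p = w `^ p * (x / w) `^ p.
    by rewrite -powRM ?(ltW w0)// mulrCA divff ?mulr1// gt_eqF.
  apply: le_trans (ler_wpM2l (powR_ge0 _ _) h) _.
  rewrite mulrDr mulr1 lerD2l powRM ?invr_ge0 ?(ltW w0)// mulrCA mulrC.
  rewrite -[w^-1]powR_inv1 ?(ltW w0)// -powRrM mulN1r -powRD//.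
  by rewrite (gt_eqF w0) implybT.
rewrite ge0_integralD//; last 3 first.
- by move=> t _; rewrite lee_fin powR_ge0.
- by move=> t _; rewrite -EFinM lee_fin mulr_ge0// powR_ge0.
- exact: measurable_funeM.
rewrite integral_cst// [X in (_ * X + _)%E]probability_setT mule1.
rewrite ge0_integralZl_EFin ?powR_ge0//; last first.
  by move=> t _; rewrite lee_fin powR_ge0.
apply: (@le_trans _ _ ((w `^ p)%:E + (w `^ (p - q))%:E * (C * rho ^+ n)%:E)%E).
  by apply: leeD2l; apply: lee_wpmul2l; [rewrite lee_fin powR_ge0|exact: dZ].
rewrite -EFinM -EFinD lee_fin mulrDl mul1r; apply: lerD.
  by rewrite -[leRHS](powRr1 (ltW w0)); apply: ger_powR => //; rewrite w0.
rewrite mulrCA ler_wpM2l//.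
apply: (@le_trans _ _ (w `^ (p - q) * w ^+ 2)).
  rewrite ler_wpM2l ?powR_ge0// /w -exprM mulnC exprM -sr.
  by rewrite lerXn2r ?nnegrE ?(ltW r0)// le_max lexx.
rewrite -(powR_mulrn 2 (ltW w0)) -powRD; last by rewrite (gt_eqF w0) implybT.
rewrite -[leRHS](powRr1 (ltW w0)); apply: ger_powR; first by rewrite w0.
lra.
Qed.

Lemma converges_in_Lp_increment_lt (p e : R) (Z : nat -> T -> R[i]) :
  0 < p -> 0 < e -> converges_in_Lp P p Z ->
  exists N, forall n, (N <= n)%N ->
    (\int[P]_t (normc (Z n.+1 t - Z n t) `^ p)%:E < e%:E)%E.
Proof.
move=> p0 e0 [ZLp [Zoo [mZoo _] cZ]].
have mZ n : Cmeasurable (Z n) := (ZLp n).1.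
pose e1 : R := e / (2 `^ p * 2) / 2.
have pp0 : 0 < 2 `^ p :> R by exact: powR_gt0.
have e10 : 0 < e1 by rewrite !divr_gt0// mulr_gt0.
have /fine_cvgP[_ /cvgr0Pnorm_lt/(_ (e1 `^ p^-1))] := cZ.
rewrite powR_gt0// => /(_ isT) near1.
have /fine_cvgP[near2 _] := cZ.
have [N _ HN] : \forall n \near \oo, (\int[P]_t (normc (Z n t - Zoo t) `^ p)%:E <= e1%:E)%E.
  near=> n; rewrite -CLnorm_powR ?gt_eqF//.
  have f1 : CLnorm P p (fun t => Z n t - Zoo t) \is a fin_num by near: n.
  rewrite -(fineK f1) poweR_EFin lee_fin.
  have -> : e1 = (e1 `^ p^-1) `^ p by rewrite -powRrM mulVf ?gt_eqF// powRr1// ltW.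
  apply: ge0_ler_powR; rewrite ?nnegrE ?powR_ge0 ?fine_ge0 ?Lnorm_ge0 ?(ltW p0)//.
  by apply: le_trans (ler_norm _) _; apply: ltW; near: n.
exists N => n nN.
apply: (@le_lt_trans _ _ (\int[P]_t ((2 `^ p)%:E *
    ((normc (Z n.+1 t - Zoo t) `^ p)%:E + (normc (Z n t - Zoo t) `^ p)%:E)))%E).
  apply: ge0_le_integral => //.
  - by move=> t _; rewrite lee_fin powR_ge0.
  - exact: measurable_normcB_powR.
  - by apply: measurable_funeM; apply: emeasurable_funD; exact: measurable_normcB_powR.
  move=> t _; rewrite -EFinD -EFinM lee_fin.
  apply: le_trans (powRD_le (ltW p0) (normc_ge0 _) (normc_ge0 _)).
  apply: ge0_ler_powR; rewrite ?nnegrE ?addr_ge0 ?normc_ge0// ?(ltW p0)//.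
  have -> : Z n.+1 t - Z n t = (Z n.+1 t - Zoo t) - (Z n t - Zoo t).
    by rewrite opprB addrA subrK.
  by apply: le_trans (le_normcD _ _) _; rewrite normcN.
have mp k := measurable_normcB_powR p (mZ k) mZoo.
have np k t : (0 <= (normc (Z k t - Zoo t) `^ p)%:E)%E by rewrite lee_fin powR_ge0.
rewrite ge0_integralZl_EFin ?powR_ge0//; last 2 first.
- by move=> t _; rewrite adde_ge0.
- exact: emeasurable_funD.
rewrite ge0_integralD//.
apply: (@le_lt_trans _ _ ((2 `^ p)%:E * (e1%:E + e1%:E))%E).
  apply: lee_wpmul2l; first by rewrite lee_fin powR_ge0.
  by apply: leeD; apply: HN => //=; exact: leqW.
rewrite -EFinD -EFinM lte_fin /e1.
have -> : 2 `^ p * (e / (2 `^ p * 2) / 2 + e / (2 `^ p * 2) / 2) = e / 2.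
  by field; rewrite gt_eqF.
lra.
Unshelve. all: by end_near. Qed.

Lemma moment_of_tail (X : T -> R) (q al K x0 : R) : 0 <= q < al -> 0 < x0 ->
  measurable_fun setT X -> (forall t, 0 <= X t) ->
  (forall x, x0 <= x ->
    (P [set t | (x < X t)%R] <= (K * x `^ (- al))%:E)%E) ->
  (\int[P]_t (X t `^ q)%:E < +oo)%E.
Proof.
move=> /andP[q0 qal] x00 mX X0 tail.
have K0 : 0 <= K.
  have := le_trans (measure_ge0 P [set t | (x0 < X t)%R]) (tail x0 (lexx _)).
  by rewrite lee_fin pmulr_lge0// powR_gt0.
pose x j : R := 2 ^+ j * x0.
have xp j : 0 < x j by rewrite mulr_gt0// exprn_gt0.
pose a j t : \bar R := ((x j.+1 `^ q)%:E * (\1_[set t | (x j < X t)%R] t)%:E)%E.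
have mA j : measurable [set t | (x j < X t)%R].
  rewrite -[X in measurable X]setTI.
  by apply: measurable_fun_ltr => //; exact: measurable_cst.
have a0 j t : (0 <= a j t)%E by rewrite /a -EFinM lee_fin mulr_ge0// powR_ge0.
have ma j : measurable_fun setT (a j).
  by apply: measurable_funeM; apply/measurable_EFinP; exact: measurable_indic.
have mE : measurable_fun setT (fun t => \esum_(j in setT) a j t)%E.
  by apply: measurable_esum => // j.
apply: (@le_lt_trans _ _ (\int[P]_t ((x0 `^ q)%:E + \esum_(j in setT) a j t))%E).
  apply: ge0_le_integral => //.
  - by move=> t _; rewrite lee_fin powR_ge0.
  - by apply: measurable_powR_EFin.
  - exact: emeasurable_funD.
  move=> t _.
  have e0 : (0 <= \esum_(j in setT) a j t)%E by apply: esum_ge0.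
  have [le0|gt0] := leP (X t) x0.
    rewrite -[leLHS]adde0; apply: leeD => //.
    by rewrite lee_fin; apply: ge0_ler_powR; rewrite ?nnegrE ?(ltW x00).
  have ex : exists j, X t <= x j.
    have [n hn] : exists n : nat, X t / x0 <= n%:R.
      exists (Num.truncn (X t / x0)).+1; apply: ltW.
      exact: truncnS_gt.
    exists n; rewrite /x -ler_pdivrMr//; apply: le_trans hn _.
    by rewrite -natrX ler_nat ltnW// ltn_expl.
  case: (ex_minnP ex) => -[|j] hj jmin.
    by move: hj; rewrite /x expr0 mul1r leNgt gt0.
  have xj : x j < X t.
    by rewrite ltNge; apply/negP => /jmin; rewrite ltnn.
  rewrite -[leLHS]add0e; apply: leeD; first by rewrite lee_fin powR_ge0.
  apply: (@le_trans _ _ (a j t)).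
    rewrite /a indicE mem_set//= mule1 lee_fin.
    by apply: ge0_ler_powR; rewrite ?nnegrE ?(ltW (xp _)).
  by apply: esum_ge; exists [set j]; [split|rewrite fsbig_set1].
rewrite ge0_integralD//; [|by move=> t _; rewrite lee_fin powR_ge0
  |by move=> t _; apply: esum_ge0].
rewrite integral_cst// [X in (_ * X + _)%E]probability_setT mule1.
apply: lte_add_pinfty; first exact: ltry.
rewrite integral_esum//.
pose s : R := 2 `^ (q - al).
have s01 : 0 <= s < 1.
  rewrite powR_ge0/= /s /powR pnatr_eq0 /= expR_lt1 pmulr_llt0 ?subr_lt0//.
  by rewrite ln_gt0// ltr1n.
apply: (@le_lt_trans _ _
    (\esum_(j in setT) (K * 2 `^ q * x0 `^ (q - al))%:E * (s ^+ j)%:E)%E).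
  apply: le_esum => j _.
  rewrite ge0_integralZl_EFin ?powR_ge0//; last first.
    by apply/measurable_EFinP; exact: measurable_indic.
  rewrite integral_indic// setIT.
  apply: (@le_trans _ _ ((x j.+1 `^ q)%:E * (K * x j `^ (- al))%:E)%E).
    apply: lee_wpmul2l; first by rewrite lee_fin powR_ge0.
    apply: tail; rewrite /x ler_peMl ?(ltW x00)// exprn_ege1//; lra.
  rewrite -!EFinM lee_fin /x exprS -mulrA powRM ?mulr_ge0 ?exprn_ge0 ?(ltW x00)//.
  rewrite le_eqVlt; apply/predU1P; left.
  transitivity (K * 2 `^ q * ((2 ^+ j * x0) `^ q * (2 ^+ j * x0) `^ (- al))).
    by ring.
  rewrite -powRD; last by rewrite (gt_eqF (xp j)) implybT.
  rewrite powRM ?exprn_ge0 ?(ltW x00)// powR_exprn// -/s.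
  by ring.
rewrite esumZl; last 2 first.
- by rewrite !mulr_ge0// powR_ge0.
- by move=> k; rewrite lee_fin exprn_ge0//; case/andP: s01.
apply: lte_mul_pinfty; [by rewrite lee_fin !mulr_ge0// powR_ge0|by []|].
exact: esum_geometric_lty.
Qed.

End Lp_convergence_criteria.

Section exponents.
Context {R : realType}.

Lemma powR_interpolation (q al D x : R) : 1 <= q <= al -> 0 < D -> 0 <= x ->
  x `^ q <= D `^ (q - al) * x `^ al + D `^ (q - 1) * x.
Proof.
move=> /andP[q1 qal] D0 x0.
have [->|xn0] := eqVneq x 0.
  by rewrite !powR0 ?mulr0 ?addr0//; lra.
have {xn0}x0' : 0 < x by rewrite lt0r xn0.
have [xD|Dx] := leP x D.
  apply: (@le_trans _ _ (D `^ (q - 1) * x)); last first.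
    by rewrite lerDr mulr_ge0// powR_ge0.
  rewrite -(@mulr_powRB1 _ x q)//; last by lra.
  rewrite mulrC ler_wpM2r//; apply: ge0_ler_powR; rewrite ?nnegrE ?subr_ge0//.
  exact: ltW.
apply: (@le_trans _ _ (D `^ (q - al) * x `^ al)); last first.
  by rewrite lerDl mulr_ge0// powR_ge0.
have -> : x `^ q = x `^ (q - al) * x `^ al.
  by rewrite -powRD ?subrK// (gt_eqF x0') implybT.
rewrite ler_wpM2r ?powR_ge0// -[q - al]opprB !powRN.
rewrite lef_pV2 ?posrE ?powR_gt0//.
by apply: ge0_ler_powR; rewrite ?nnegrE ?subr_ge0// ltW.
Qed.

Lemma exponent_below (p al kap k1 : R) : 1 < p < al -> 0 <= kap < 1 ->
  0 <= k1 -> exists q D : R, [/\ p <= q < al, 0 < D &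
    D `^ (q - al) * kap + D `^ (q - 1) * k1 < 1].
Proof.
move=> /andP[p1 pal] /andP[kap0 kap1] k10.
pose g : R := (1 - kap) / (2 * (k1 + 1)).
have g0 : 0 < g by rewrite divr_gt0//; lra.
have g1 : g < 1 by rewrite /g ltr_pdivrMr; lra.
pose D : R := g `^ (p - 1)^-1.
have D0 : 0 < D by exact: powR_gt0.
have p10 : 0 < (p - 1)^-1 by rewrite invr_gt0 subr_gt0.
have D1 : D < 1.
  by rewrite /D /powR (gt_eqF g0) expR_lt1 pmulr_rlt0// ln_lt0// g0.
pose L : R := - ln D.
have L0 : 0 < L by rewrite oppr_gt0 ln_lt0// D0.
pose e : R := Num.min (al - p) ((1 - kap) / (2 * L)).
have e0 : 0 < e.
  by rewrite lt_min subr_gt0 pal divr_gt0// ?subr_gt0// mulr_gt0.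
have eL : e * L <= (1 - kap) / 2.
  apply: (@le_trans _ _ ((1 - kap) / (2 * L) * L)).
    by rewrite ler_wpM2r ?(ltW L0)// ge_min lexx orbT.
  by rewrite invfM !mulrA divfK ?gt_eqF// lexx.
exists (al - e), D; split=> //.
  rewrite gtrBl e0 andbT lerBrDl -lerBrDr.
  by rewrite ge_min lexx.
have De : (1 + kap) / 2 <= D `^ e.
  rewrite /powR (gt_eqF D0); apply: le_trans (expR_ge1Dx _).
  have -> : ln D = - L by rewrite opprK.
  lra.
have h1 : D `^ (al - e - al) * kap <= 2 * kap / (1 + kap).
  have -> : al - e - al = - e by ring.
  rewrite powRN mulrC ler_pdivrMr ?powR_gt0//.
  apply: (@le_trans _ _ (2 * kap / (1 + kap) * ((1 + kap) / 2))).
    by rewrite le_eqVlt; apply/orP; left; apply/eqP; field; lra.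
  by rewrite ler_wpM2l// divr_ge0//; lra.
have h2 : D `^ (al - e - 1) * k1 <= g * k1.
  rewrite ler_wpM2r//.
  have -> : g = D `^ (p - 1) by rewrite -powRrM mulVf ?powRr1 ?(ltW g0)//; lra.
  apply: ger_powR; first by rewrite D0 ltW.
  have : e <= al - p by rewrite ge_min lexx.
  lra.
have h3 : g * k1 < (1 - kap) / 2.
  rewrite /g mulrAC ltr_pdivrMr; last lra.
  have : 0 < 1 - kap by rewrite subr_gt0.
  lra.
have h4 : 2 * kap / (1 + kap) <= 1 - (1 - kap) / 2.
  rewrite ler_pdivrMr; last lra.
  nra.
lra.
Qed.

End exponents.

Section sufficiency.
Context d (T : measurableType d) (R : realType) (P : probability T R)
  (M : seq nat -> T -> point_process_space R).
Hypothesis hM : iid P M.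

Lemma mR_interpolation (q al D th : R) : 1 <= q <= al -> 0 < D ->
  (mR P M (q * th) <= (D `^ (q - al))%:E * mR P M (al * th) +
     (D `^ (q - 1))%:E * mR P M th)%E.
Proof.
move=> qal D0; have /andP[q1 qal'] := qal.
rewrite !(mR_esum hM _ [::]).
pose S s t := (\esum_(i in setT) (child_rweight s (M [::] t) i)%:E)%E.
have S0 s t : (0 <= S s t)%E by apply: esum_ge0 => i _; rewrite lee_fin child_rweight_ge0.
have mS s : measurable_fun setT (S s).
  exact: measurable_esum_child_rweight hM _ _.
rewrite -!ge0_integralZl_EFin ?powR_ge0//; try by move=> t _; exact: S0.
  rewrite -ge0_integralD//; last 4 first.
  - by move=> t _; apply: mule_ge0; [rewrite lee_fin powR_ge0|exact: S0].
  - by apply: measurable_funeM; exact: mS.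
  - by move=> t _; apply: mule_ge0; [rewrite lee_fin powR_ge0|exact: S0].
  - by apply: measurable_funeM; exact: mS.
  apply: ge0_le_integral => //.
  - by move=> t _; exact: S0.
  - exact: mS.
  - by apply: emeasurable_funD; apply: measurable_funeM; exact: mS.
  move=> t _; rewrite -!esumZl ?powR_ge0//; try by move=> i; rewrite lee_fin child_rweight_ge0.
  rewrite -esumD; try by move=> i _; rewrite mule_ge0// lee_fin ?powR_ge0 ?child_rweight_ge0.
  apply: le_esum => i _; rewrite -!EFinM -EFinD lee_fin.
  have pw r : 1 <= r -> child_rweight (r * th) (M [::] t) i =
      child_rweight th (M [::] t) i `^ r.
    move=> r1; rewrite /child_rweight; case: ifP => _; last by rewrite powR0//; lra.
    by rewrite -expRM; congr expR; ring.
  rewrite !pw ?(le_trans q1)//.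
  apply: powR_interpolation => //; exact: child_rweight_ge0.
all: exact: mS.
Qed.

Variable l : R[i].
Local Notation m := (mC P M l).
Local Notation th := (complex.Re l).
Hypothesis m0 : m != 0.
Hypothesis mRfin : (mR P M th < +oo)%E.

Lemma biggins_converges_in_Lp (p q : R) : 1 <= p <= q -> q <= 2 ->
  (\int[P]_t (normc (centered_offspring l m (M [::] t)) `^ q)%:E < +oo)%E ->
  (mR P M (q * th) < +oo)%E ->
  fine (mR P M (q * th)) / normc m `^ q < 1 ->
  converges_in_Lp P p (biggins P M l).
Proof.
move=> pq q2 xif mRq kap1; have /andP[p1 pq'] := pq.
have p0 : p != 0 by lra.
set I := (\int[P]_t _)%E in xif.
have I0 : (0 <= I)%E by apply: integral_ge0 => t _; rewrite lee_fin powR_ge0.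
have If : I \is a fin_num by rewrite ge0_fin_numE.
apply: (@converges_in_Lp_increments _ _ _ P p q
  (2 `^ q * 2 `^ (q + 3) * fine I) (fine (mR P M (q * th)) / normc m `^ q)) => //.
- by rewrite !mulr_ge0 ?powR_ge0 ?fine_ge0.
- by rewrite kap1 andbT divr_ge0 ?powR_ge0 ?fine_ge0 ?(mR_ge0 hM).
- by move=> n; exact: Cmeasurable_biggins.
- split; first exact: Cmeasurable_biggins.
  rewrite CLnormE//; apply: poweR_lty.
  under eq_integral do rewrite biggins0 normc1 powR1.
  by rewrite integral_cst// [X in (_ * X)%E]probability_setT mule1 ltry.
move=> n; apply: integral_increment_le => //.
  by rewrite (le_trans p1).
by rewrite fineK.
Qed.

End sufficiency.

(** * Necessity *)

Section uniform_integrability.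
Context d (T : measurableType d) (R : realType) (P : probability T R).

Lemma uniformly_integrable_lower_bound (X : nat -> T -> R) (eta : R) :
  0 < eta -> 2 * eta < 1 ->
  (forall n, measurable_fun setT (X n)) -> (forall n t, 0 <= X n t) ->
  (forall n, \int[P]_t (X n t)%:E = 1)%E ->
  ereal_sup [set (\int[P]_(t in [set t | (a < X n t)%R]) (X n t)%:E)%E
    | n in [set: nat]] @[a --> (+oo)%R] --> 0%E ->
  exists2 pi0 : R, 0 < pi0 & forall n, (pi0%:E <= P [set t | (eta < X n t)%R])%E.
Proof.
move=> eta0 eta1 mX X0 X1 /fine_cvgP[fin /cvgr0Pnorm_lt/(_ eta eta0) ltn].
have [a [a0 afin alt]] : exists a : R, [/\ 0 < a,
    ereal_sup [set (\int[P]_(t in [set t | (a < X n t)%R]) (X n t)%:E)%E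
      | n in [set: nat]] \is a fin_num &
    `|fine (ereal_sup [set (\int[P]_(t in [set t | (a < X n t)%R]) (X n t)%:E)%E
      | n in [set: nat]])| < eta].
  have H : \forall a \near +oo%R, [/\ 0 < a,
    ereal_sup [set (\int[P]_(t in [set t | (a < X n t)%R]) (X n t)%:E)%E
      | n in [set: nat]] \is a fin_num &
    `|fine (ereal_sup [set (\int[P]_(t in [set t | (a < X n t)%R]) (X n t)%:E)%E
      | n in [set: nat]])| < eta].
    near=> a; split; near: a => //.
    exact: nbhs_pinfty_gt.
  by have [B [_ /(_ (B + 1))]] := H; rewrite ltrDl ltr01 => /(_ isT); exists (B + 1).
exists ((1 - 2 * eta) / a); first by rewrite divr_gt0// subr_gt0.
move=> n; pose A b := [set t | (b < X n t)%R].
have mA b : measurable (A b).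
  by rewrite -[A b]setTI; apply: measurable_fun_ltr => //; exact: measurable_cst.
have mXE : measurable_fun setT (fun t => (X n t)%:E) by exact/measurable_EFinP.
have tail : (\int[P]_(t in A a) (X n t)%:E <= eta%:E)%E.
  apply: (@le_trans _ _ (ereal_sup [set (\int[P]_(t in [set t | (a < X n t)%R])
      (X n t)%:E)%E | n in [set: nat]])).
    by apply: ereal_sup_ubound; exists n.
  by rewrite -(fineK afin) lee_fin (le_trans (ler_norm _))// ltW.
have mI b : measurable_fun setT (fun t => (\1_(A b) t)%:E : \bar R).
  by apply/measurable_EFinP; exact: measurable_indic.
have : (1 <= eta%:E + (eta%:E + a%:E * P (A eta)))%E.
  rewrite -{1}(X1 n); apply: le_trans (leeD2r _ tail).
  rewrite [X in (_ <= X + _)%E]integral_mkcond.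
  have -> : P (A eta) = (\int[P]_t (\1_(A eta) t)%:E)%E.
    by rewrite integral_indic// setIT.
  rewrite -ge0_integralZl_EFin ?(ltW a0)//.
  rewrite -[X in (_ <= _ + (X + _))%E]mule1 -(@probability_setT _ _ _ P).
  rewrite -integral_cst// -ge0_integralD//; last 3 first.
  - by move=> t _; rewrite lee_fin ltW.
  - by move=> t _; rewrite -EFinM lee_fin mulr_ge0// ltW.
  - exact: measurable_funeM.
  rewrite -ge0_integralD//; last 4 first.
  - by move=> t _; rewrite patchE; case: ifP => // _; rewrite lee_fin.
  - apply/(measurable_restrictT _ (mA a)); exact: measurable_funS mXE.
  - by move=> t _; rewrite -EFinM -EFinD lee_fin addr_ge0 ?mulr_ge0 ?(ltW eta0) ?(ltW a0).
  - by apply: emeasurable_funD => //; exact: measurable_funeM.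
  apply: ge0_le_integral => //.
  - by move=> t _; rewrite lee_fin.
  - apply: emeasurable_funD.
      apply/(measurable_restrictT _ (mA a)); exact: measurable_funS mXE.
    by apply: emeasurable_funD => //; exact: measurable_funeM.
  move=> t _; rewrite patchE -EFinM -EFinD.
  case: ifPn => [_|/negP Xa].
    by rewrite -EFinD lee_fin lerDl addr_ge0 ?mulr_ge0 ?(ltW eta0) ?(ltW a0).
  rewrite add0e lee_fin indicE.
  have {}Xa : X n t <= a by rewrite leNgt; apply/negP => h; apply: Xa; exact: mem_set.
  case: (boolP (t \in A eta)) => [_|/negP Xe]; first by rewrite mulr1; lra.
  by rewrite mulr0 addr0 leNgt; apply/negP => h; apply: Xe; exact: mem_set.
have Pf : P (A eta) \is a fin_num by exact: fin_num_measure.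
rewrite -(fineK Pf) -EFinM -!EFinD !lee_fin ler_pdivrMr//.
lra.
Unshelve. all: by end_near. Qed.

End uniform_integrability.

Section real_parameter.
Context d (T : measurableType d) (R : realType) (P : probability T R)
  (M : seq nat -> T -> point_process_space R).
Hypothesis hM : iid P M.

Lemma integral_fine_ge0 (g : T -> \bar R) : measurable_fun setT g ->
  (forall t, 0 <= g t)%E -> (\int[P]_t g t < +oo)%E ->
  (\int[P]_t (fine (g t))%:E = \int[P]_t g t)%E.
Proof.
move=> mg g0 gf; apply: ae_eq_integral => //.
  by apply/measurable_EFinP; exact: measurableT_comp.
have /integrable_ae : P.-integrable setT g.
  by apply/integrableP; split=> //; under eq_integral do rewrite gee0_abs//.
by move=> /(_ measurableT); apply: filterS => t h _; rewrite fineK// h.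
Qed.

Lemma csum_real (I : choiceType) (D : set I) (f : I -> R) :
  (forall i, 0 <= f i) ->
  csum D (fun i => (f i)%:C%C) = (fine (\esum_(i in D) (f i)%:E))%:C%C.
Proof.
move=> f0; rewrite /csum /=; congr (_ +i* _)%C; rewrite /rsum.
  rewrite [X in _ - fine X]esum1 ?subr0.
    by congr fine; apply: eq_esum => i _; rewrite max_l.
  by move=> i _; rewrite max_r// oppr_le0.
by rewrite !esum1 ?subr0// => i _; rewrite ?oppr0 maxxx.
Qed.

Lemma cexp_real (s x : R) : cexp (- s%:C%C * x%:C%C) = (expR (- s * x))%:C%C.
Proof.
have -> : - s%:C%C * x%:C%C = (- s * x +i* 0)%C.
  by simpc.
by rewrite /cexp cos0 sin0 mulr1 mulr0.
Qed.

Lemma mC_real (s : R) : (mR P M s < +oo)%E -> mC P M s%:C%C = (fine (mR P M s))%:C%C.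
Proof.
move=> mRs; pose S t := (\esum_(i in setT) (child_rweight s (M [::] t) i)%:E)%E.
have S0 t : (0 <= S t)%E by apply: esum_ge0 => i _; rewrite lee_fin child_rweight_ge0.
have mS : measurable_fun setT S.
  exact: measurable_esum_child_rweight hM _ _.
have mRE : mR P M s = (\int[P]_t S t)%E by rewrite (mR_esum hM s [::]).
have offE t : offspring s%:C%C (M [::] t) = (fine (S t))%:C%C.
  rewrite /offspring -csum_real; last by move=> i; exact: child_rweight_ge0.
  apply: eq_csum => i _; rewrite /child_weight /child_rweight.
  by case: ifP => // _; exact: cexp_real.
have hR := integral_Re_offspring hM (l := s%:C%C) mRs.
have hI := integral_Im_offspring hM (l := s%:C%C) mRs.
have -> : mC P M s%:C%C = (complex.Re (mC P M s%:C%C) +i* complex.Im (mC P M s%:C%C))%C.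
  by case: (mC _ _ _).
congr (_ +i* _)%C.
  rewrite -[LHS]/(fine (complex.Re (mC P M s%:C%C))%:E) -hR mRE; congr fine.
  rewrite -(integral_fine_ge0 mS S0) -?mRE//.
  by apply: eq_integral => t _; rewrite offE.
rewrite -[LHS]/(fine (complex.Im (mC P M s%:C%C))%:E) -hI.
by under eq_integral do rewrite offE /=; rewrite integral0.
Qed.

Lemma normc_real (x : R) : normc x%:C%C = `|x|.
Proof. by rewrite /= expr0n addr0 sqrtr_sqr. Qed.

Lemma normc_biggins_real (s : R) n t : (mR P M s < +oo)%E ->
  normc (biggins P M s%:C%C n t) =
  (fine (mR P M s) ^+ n)^-1 *
    fine (\esum_(u in [set u | size u = n]) (rweight M s u t)%:E).
Proof.
move=> mRs; rewrite /biggins csum_generation mC_real//.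
have -> : csum [set u | size u = n] (weight M s%:C%C ^~ t) =
    (fine (\esum_(u in [set u | size u = n]) (rweight M s u t)%:E))%:C%C.
  rewrite -csum_real; last by move=> u; exact: rweight_ge0.
  apply: eq_csum => u _; rewrite /weight /rweight.
  by case: ifP => // _; exact: cexp_real.
have r0 : 0 <= fine (mR P M s) by rewrite fine_ge0 ?(mR_ge0 hM).
rewrite normcM normcV normc_real [X in _ * X]ger0_norm; last first.
  by rewrite fine_ge0// esum_ge0// => u _; rewrite lee_fin rweight_ge0.
congr (_^-1 * _); elim: n => [|n IH]; first by rewrite !expr0 normc1.
by rewrite !exprS normcM IH normc_real ger0_norm.
Qed.

Lemma integral_normc_biggins_real (s : R) n : (mR P M s < +oo)%E ->
  0 < fine (mR P M s) ->
  (\int[P]_t (normc (biggins P M s%:C%C n t))%:E = 1)%E.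
Proof.
move=> mRs mR0.
have mRf : mR P M s \is a fin_num by rewrite ge0_fin_numE// (mR_ge0 hM).
pose S t := (\esum_(u in [set u | size u = n]) (rweight M s u t)%:E)%E.
have S0 t : (0 <= S t)%E by apply: esum_ge0 => i _; rewrite lee_fin rweight_ge0.
have mS : measurable_fun setT S.
  exact: measurable_esum_rweight hM _ _.
have SE : (\int[P]_t S t = (fine (mR P M s) ^+ n)%:E)%E.
  by rewrite (integral_esum_rweight hM) EFin_expe fineK.
under eq_integral do rewrite normc_biggins_real// EFinM.
rewrite ge0_integralZl_EFin//; last 3 first.
- by move=> t _; rewrite lee_fin fine_ge0//; exact: S0.
- by apply/measurable_EFinP; exact: (measurableT_comp _ mS).
- by rewrite invr_ge0 exprn_ge0// ltW.
rewrite (integral_fine_ge0 mS S0); last by rewrite SE ltry.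
by rewrite SE -EFinM mulVf// gt_eqF// exprn_gt0.
Qed.

Variable l : R[i].
Local Notation m := (mC P M l).
Local Notation th := (complex.Re l).
Hypothesis m0 : m != 0.
Hypothesis mRfin : (mR P M th < +oo)%E.

(* Uniform integrability keeps [\sum_(|u| = n) |Y_u|^al] above 1/4 with a
   probability bounded from below if m(al theta) >= |m(lambda)|^al; then so is
   the p-th moment of the increments. *)
Lemma biggins_converges_kappa_lt1 (p al c : R) :
  1 <= p <= 2 -> al != 0 -> 0 < c ->
  (mR P M (al * th) < +oo)%E ->
  uniformly_integrable P (biggins P M (al * th)%:C%C) ->
  (forall N (r : nat -> R), (forall k, 0 <= r k) ->
    4^-1 < \sum_(k < N) r k `^ al ->
    (c%:E <= \int[P]_t ((\sum_(k < N)
      (r k * normc (centered_offspring l m (M (word k) t))) ^+ 2) `^ (p / 2))%:E)%E) ->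
  converges_in_Lp P p (biggins P M l) ->
  fine (mR P M (al * th)) / normc m `^ al < 1.
Proof.
move=> p12 al0 c0 mRal UI hc cvgZ; have /andP[p1 p2] := p12.
rewrite ltNge; apply/negP => kap1.
have nm0 : 0 < normc m.
  by rewrite lt0r normc_ge0 andbT; apply: contra_neq m0 => /eq0_normc.
have nmal : 0 < normc m `^ al by exact: powR_gt0.
have mle : normc m `^ al <= fine (mR P M (al * th)).
  by move: kap1; rewrite ler_pdivlMr// mul1r.
have mRpos : 0 < fine (mR P M (al * th)) := lt_le_trans nmal mle.
have mRalf : mR P M (al * th) \is a fin_num by rewrite ge0_fin_numE// (mR_ge0 hM).
have mW n : measurable_fun setT (fun t => normc (biggins P M (al * th)%:C%C n t)) :=
  measurable_normc (Cmeasurable_biggins hM _ n).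
have [pi0 pi00 hpi] := @uniformly_integrable_lower_bound _ _ _ P
  (fun n t => normc (biggins P M (al * th)%:C%C n t)) 4^-1 ltac:(lra) ltac:(lra)
  mW (fun n t => normc_ge0 _) (fun n => integral_normc_biggins_real n mRal mRpos) UI.
pose e := 4 / 9 * c * pi0 / 2 `^ (p + 2).
have pp : 0 < 2 `^ (p + 2) :> R by exact: powR_gt0.
have e0 : 0 < e by rewrite divr_gt0// !mulr_gt0//; lra.
have [N /(_ N (leqnn N))] := converges_in_Lp_increment_lt (lt_le_trans ltr01 p1) e0 cvgZ.
apply/negP; rewrite -leNgt.
have := integral_increment_ge hM m0 mRfin N p12 al0 (ltW c0) hc.
set I := (\int[P]_t _)%E => hI.
have I0 : (0 <= I)%E by apply: integral_ge0 => t _; rewrite lee_fin powR_ge0.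
have {}hI : ((4 / 9 * c * pi0)%:E <= (2 `^ (p + 2))%:E * I)%E.
  apply: le_trans hI; rewrite EFinM; apply: lee_wpmul2l.
    by rewrite lee_fin mulr_ge0 ?(ltW c0)//; lra.
  apply: le_trans (hpi N) _; apply: le_measure.
  - rewrite inE -[X in measurable X]setTI.
    by apply: measurable_fun_ltr => //; exact: measurable_cst.
  - rewrite inE -[X in measurable X]setTI; apply: emeasurable_fun_o_infty => //.
    apply: measurable_funeM; exact: measurable_esum_rweight hM _ _.
  move=> t /=; rewrite normc_biggins_real// -lte_fin => /lt_le_trans; apply.
  rewrite EFinM; set S := (\esum_(u in _) _)%E.
  have S0 : (0 <= S)%E by apply: esum_ge0 => u _; rewrite lee_fin rweight_ge0.
  have Sf : ((fine S)%:E <= S)%E by move: S0; case: (S) => //= x _; rewrite leey.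
  apply: lee_pmul => //.
  - by rewrite lee_fin invr_ge0 exprn_ge0// ltW.
  - by rewrite lee_fin fine_ge0.
  rewrite lee_fin lef_pV2 ?posrE ?exprn_gt0//.
  by rewrite lerXn2r ?nnegrE ?(ltW nmal) ?(ltW mRpos).
move: hI; have [->|] := eqVneq I +oo%E; first by rewrite leey.
rewrite -ltey => If; have {}If : I \is a fin_num by rewrite ge0_fin_numE.
rewrite -(fineK If) -EFinM !lee_fin /e ler_pdivrMr// => h.
by rewrite [leRHS]mulrC.
Qed.

End real_parameter.

Section tails.
Context d (T : measurableType d) (R : realType) (P : probability T R).
Implicit Types f : R -> \bar R.

Lemma limf_einf_pinfty_gt0 f : (0 < limf_einf f (pinfty_nbhs R))%E ->
  exists c x0 : R, 0 < c /\ forall x, x0 < x -> (c%:E <= f x)%E.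
Proof.
rewrite limf_einfE => /ereal_sup_gt[_ [V [x0 [_ x0V]] <-]] i0.
have [c c0 ci] : exists2 c : R, 0 < c & (c%:E <= ereal_inf (f @` V))%E.
  move: i0; case: (ereal_inf _) => [r| |//].
    by rewrite lte_fin => r0; exists r.
  by move=> _; exists 1 => //; rewrite leey.
exists c, x0; split=> // x x0x; apply: le_trans ci _.
by apply: ereal_inf_lbound; exists x => //; exact: x0V.
Qed.

Lemma limf_esup_pinfty_lty f : (limf_esup f (pinfty_nbhs R) < +oo)%E ->
  exists K x0 : R, forall x, x0 < x -> (f x <= K%:E)%E.
Proof.
rewrite limf_esupE => /ereal_inf_lt[_ [V [x0 [_ x0V]] <-]] i0.
have [K Ki] : exists K : R, (ereal_sup (f @` V) <= K%:E)%E.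
  by move: i0; case: (ereal_sup _) => [r _|//|_]; [exists r|exists 0; rewrite leNye].
exists K, x0 => x x0x; apply: le_trans Ki.
by apply: ereal_sup_ubound; exists x => //; exact: x0V.
Qed.

Lemma measurable_gt (X : T -> R) a : measurable_fun setT X ->
  measurable [set t | (a < X t)%R].
Proof.
move=> mX; rewrite -[X in measurable X]setTI.
by apply: measurable_fun_ltr => //; exact: measurable_cst.
Qed.

Lemma exists_gt_positive_probability (X : T -> R) : measurable_fun setT X ->
  (forall t, 0 <= X t) -> ~ {ae P, forall t, X t = 0} ->
  exists eps pi0 : R, [/\ 0 < eps, 0 < pi0 &
    (pi0%:E <= P [set t | (eps < X t)%R])%E].
Proof.
move=> mX X0 nX; apply: contrapT => H; apply: nX.
have An0 k : P [set t | (k.+1%:R^-1 < X t)%R] = 0%E.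
  apply/eqP; rewrite eq_le measure_ge0 andbT leNgt; apply/negP => h; apply: H.
  exists k.+1%:R^-1, (fine (P [set t | (k.+1%:R^-1 < X t)%R])).
  have Pf : P [set t | (k.+1%:R^-1 < X t)%R] \is a fin_num.
    exact/fin_num_measure/measurable_gt.
  by split; [rewrite invr_gt0| rewrite fine_gt0// h ltey_eq Pf | rewrite fineK].
rewrite /almost_everywhere /=.
apply: negligibleS (@negligible_bigcup _ _ _ P
  (fun k => [set t | (k.+1%:R^-1 < X t)%R]) _); last first.
  by move=> k; apply/negligibleP; [exact: measurable_gt|exact: An0].
move=> t /= /eqP Xt; have {}Xt : 0 < X t by rewrite lt0r Xt X0.
exists (Num.truncn (X t)^-1) => //=.
rewrite invf_plt ?posrE//; exact: truncnS_gt.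
Qed.

Lemma moment_infinite_of_tail (X : T -> R) (al c x0 : R) : 0 < al -> 0 < c ->
  measurable_fun setT X -> (forall t, 0 <= X t) ->
  (forall x, x0 < x -> (c%:E <= (x `^ al)%:E * P [set t | (x < X t)%R])%E) ->
  (\int[P]_t (X t `^ al)%:E = +oo)%E.
Proof.
move=> al0 c0 mX X0 tail; apply/eqP; apply/negPn; rewrite -ltey; apply/negP => Xf.
have mXa : measurable_fun setT (fun t => (X t `^ al)%:E).
  by apply: measurable_powR_EFin.
have iX : P.-integrable setT (fun t => (X t `^ al)%:E).
  apply/integrableP; split=> //.
  by under eq_integral do rewrite abse_EFin ger0_norm ?powR_ge0//.
pose A n := [set t | (n%:R < X t)%R].
have mA n : measurable (A n) by exact: measurable_gt.
pose f n t := (X t `^ al * \1_(A n) t)%:E.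
have mf n : measurable_fun setT (f n).
  apply/measurable_EFinP; apply: measurable_funM; last exact: measurable_indic.
  exact: (measurableT_comp (measurable_powR al)).
have cf : (\int[P]_t f n t @[n --> \oo] --> \int[P]_t (cst 0 t : \bar R))%E.
  apply: (@dominated_cvg _ _ _ P setT measurableT f (cst 0%E)
    (fun t => (X t `^ al)%:E)) => //.
  - move=> t _; apply: cvg_near_cst; near=> n.
    rewrite /f indicE memNset ?mulr0//= /A /=; apply/negP; rewrite -leNgt.
    by near: n; exact: nbhs_infty_ger.
  move=> n t _; rewrite /f abse_EFin lee_fin ger0_norm ?mulr_ge0 ?powR_ge0//.
  by rewrite indicE; case: (_ \in _); rewrite ?mulr1// mulr0 powR_ge0.
rewrite integral0 in cf.
have /fine_cvgP[_ /cvgr0Pnorm_lt/(_ c c0) cfc] := cf.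
have /fine_cvgP[cff _] := cf.
near \oo => n.
have fn : (\int[P]_t f n t)%E \is a fin_num by near: n.
have : fine (\int[P]_t f n t)%E < c.
  by apply: le_lt_trans (ler_norm _) _; near: n.
apply/negP; rewrite -leNgt -lee_fin fineK//.
have nx : x0 < n%:R by near: n; exact: nbhs_infty_gtr.
apply: le_trans (tail _ nx) _.
have -> : P [set t | (n%:R < X t)%R] = (\int[P]_t (\1_(A n) t)%:E)%E.
  by rewrite integral_indic// setIT.
have mi : measurable_fun setT (fun t => (\1_(A n) t)%:E : \bar R).
  by apply/measurable_EFinP; exact: measurable_indic.
have i0 t : setT t -> (0 <= (\1_(A n) t)%:E :> \bar R)%E.
  by move=> _; rewrite lee_fin.
rewrite -(ge0_integralZl_EFin _ measurableT i0 mi (powR_ge0 _ _)).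
apply: ge0_le_integral => //; first exact: measurable_funeM.
move=> t _; rewrite -EFinM lee_fin indicE.
case: (boolP (t \in A n)) => [/set_mem /= nX|_]; last by rewrite !mulr0.
by rewrite !mulr1; apply: ge0_ler_powR; rewrite ?nnegrE// ltW.
Unshelve. all: by end_near. Qed.

End tails.

Section square_function_of_offspring.
Context d (T : measurableType d) (R : realType) (P : probability T R)
  (M : seq nat -> T -> point_process_space R).
Hypothesis hM : iid P M.
Variable l : R[i].
Local Notation m := (mC P M l).
Local Notation xi u t := (centered_offspring l m (M u t)).

Let mxi u : measurable_fun setT (fun t => normc (xi u t)).
Proof.
exact: (measurableT_comp (measurable_normc (Cmeasurable_centered l m)) (iid_measurable hM u)).
Qed.

Let iid_xi (B : set R) u v : measurable B ->
  P [set t | B (normc (xi u t))] = P [set t | B (normc (xi v t))].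
Proof.
move=> mB; have [_ eM _] := hM.
apply: (eM u v [set c : point_process_space R | B (normc (centered_offspring l m c))]).
rewrite -[X in measurable X]setTI.
exact: (measurable_normc (Cmeasurable_centered l m)).
Qed.

Let gt_itv a : [set x : R | a < x] = `]a, +oo[%classic.
Proof. by apply/seteqP; split=> x /=; rewrite in_itv/= andbT. Qed.

Lemma square_function_of_offspring_ge (p delta : R) : 1 <= p <= 2 -> 0 < delta ->
  ~ {ae P, forall t, biggins P M l 1 t = 1} ->
  exists2 c : R, 0 < c & forall N (r : nat -> R), (forall k, 0 <= r k) ->
    delta < \sum_(k < N) r k `^ 2 ->
    (c%:E <= \int[P]_t
      ((\sum_(k < N) (r k * normc (xi (word k) t)) ^+ 2) `^ (p / 2))%:E)%E.
Proof.
move=> p12 delta0 nondeg; have /andP[p1 p2] := p12.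
have [||eps [pi0 [eps0 pi00 hpi]]] := @exists_gt_positive_probability _ _ _ P
    (fun t => normc (xi [::] t)) (mxi _).
- by move=> t; exact: normc_ge0.
- move=> xi0; apply: nondeg; apply: filterS xi0 => t /eq0_normc.
  by rewrite -biggins1_centered => /eqP; rewrite subr_eq0 => /eqP.
exists (eps `^ p * delta `^ (p / 2) * pi0); first by rewrite !mulr_gt0// powR_gt0.
move=> N r r0; rewrite (eq_bigr (fun k : 'I_N => r k ^+ 2)); last first.
  by move=> k _; rewrite -powR_mulrn.
move=> hr; apply: le_trans (@integral_square_function_ge _ _ _ P p eps pi0 r
  (fun k t => normc (xi (word k) t)) N p12 eps0 _ _ _).
- rewrite lee_fin ler_wpM2r ?(ltW pi00)// ler_wpM2l ?powR_ge0//.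
  apply: ge0_ler_powR; rewrite ?nnegrE ?(ltW delta0) ?(ltW hr)//; first lra.
  by rewrite sumr_ge0// => k _; rewrite sqr_ge0.
- exact: ltW.
- by move=> k; exact: mxi.
move=> k; apply: le_trans hpi _.
by rewrite (@iid_xi [set x | eps < x] [::] (word k))// gt_itv.
Qed.

Lemma square_function_of_offspring_ge_tail (p al delta c0 x0 : R) :
  1 <= p -> 0 < al -> 0 < delta -> 0 < c0 ->
  (forall x, x0 < x ->
    (c0%:E <= (x `^ al)%:E * P [set t | (x < normc (biggins P M l 1 t))%R])%E) ->
  exists2 c : R, 0 < c & forall N (r : nat -> R), (forall k, 0 <= r k) ->
    delta < \sum_(k < N) r k `^ al ->
    (c%:E <= \int[P]_t
      ((\sum_(k < N) (r k * normc (xi (word k) t)) ^+ 2) `^ (p / 2))%:E)%E.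
Proof.
move=> p1 al0 delta0 c00 tail.
pose x1 : R := Num.max x0 1; pose c1 : R := c0 * 2 `^ (- al).
pose b : R := x1 `^ (- al).
have x11 : 1 <= x1 by rewrite le_max lexx orbT.
have x10 : 0 < x1 := lt_le_trans ltr01 x11.
have c10 : 0 < c1 by rewrite mulr_gt0// powR_gt0.
have b0 : 0 < b by exact: powR_gt0.
have mgt u x : measurable [set t | (x < normc (xi u t))%R] by exact: measurable_gt.
have tail1 u x : x1 <= x -> ((c1 * x `^ (- al))%:E <=
    P [set t | (x < normc (xi u t))%R])%E.
  move=> xx1; have x_gt0 : 0 < x := lt_le_trans x10 xx1.
  have x0x : x0 < x + 1.
    by rewrite (@le_lt_trans _ _ x) ?ltrDl// (le_trans _ xx1)// le_max lexx.
  have := tail _ x0x; rewrite (@iid_xi [set y | x < y] u [::]) ?gt_itv// -gt_itv.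
  set p1' := P _; set p2' := P _ => h.
  have p12 : (p1' <= p2')%E.
    apply: le_measure; rewrite ?inE; last 2 first.
    - exact: mgt.
    - move=> t xt; change (x < normc (xi [::] t)).
      have {}xt : x + 1 < normc (biggins P M l 1 t) by exact: xt.
      rewrite -biggins1_centered -(ltrD2r 1); apply: lt_le_trans xt _.
      have {1}-> : biggins P M l 1 t = (biggins P M l 1 t - 1) + 1 by rewrite subrK.
      by apply: le_trans (le_normcD _ _) _; rewrite normc1.
    - by apply: measurable_gt; exact: measurable_normc (Cmeasurable_biggins hM l 1).
  have p2f : p2' \is a fin_num by apply: fin_num_measure; exact: mgt.
  have {h} : (c0%:E <= ((x + 1) `^ al)%:E * p2')%E.
    by apply: le_trans h _; apply: lee_wpmul2l => //; rewrite lee_fin powR_ge0.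
  have p20 : 0 <= fine p2' by apply: fine_ge0; exact: measure_ge0.
  rewrite -(fineK p2f) -EFinM !lee_fin => h.
  have {}h : c0 <= (2 * x) `^ al * fine p2'.
    apply: le_trans h _; rewrite ler_wpM2r//.
    apply: ge0_ler_powR; rewrite ?nnegrE ?(ltW al0)//; have := le_trans x11 xx1; lra.
  rewrite /c1 -mulrA -powRM// ?(ltW x_gt0)// powRN.
  by rewrite ler_pdivrMr ?powR_gt0 ?mulr_gt0// mulrC.
have cb : c1 * b <= 1.
  by rewrite -lee_fin; apply: le_trans (tail1 [::] _ (lexx _)) (probability_le1 _ _).
pose c : R := 1 - (1 + c1 * Num.min delta b)^-1.
have md0 : 0 < Num.min delta b by rewrite lt_min delta0.
exists c.
  by rewrite subr_gt0 invf_lt1 ?addr_gt0 ?mulr_gt0// ltrDl mulr_gt0.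
move=> N r r0 hr.
have mMw k : measurable_fun setT (M (word k)) := iid_measurable hM (word k).
apply: le_trans (integral_square_function_ge_tail (al := al) mMw
  (mutually_independent_words hM) N p1 (measurable_normc (Cmeasurable_centered l m)) r0
  (ltW c10) (ltW b0) cb _).
  rewrite lee_fin lerD2l lerN2 lef_pV2 ?posrE ?addr_gt0 ?mulr_gt0//; last first.
    by rewrite lt_min b0 (lt_trans delta0 hr).
  rewrite lerD2l ler_wpM2l ?(ltW c10)//.
  by rewrite le_min !ge_min lexx (ltW hr) orbT.
move=> k; have [rk0|rk_neq0] := eqVneq (r k) 0.
  rewrite rk0 powR0 ?gt_eqF// min_l ?(ltW b0)// mulr0.
  exact: measure_ge0.
have rk : 0 < r k by rewrite lt0r rk_neq0 r0.
pose x : R := Num.max (r k)^-1 x1.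
apply: (@le_trans _ _ (P [set t | (x < normc (xi (word k) t))%R])).
  apply: le_trans (tail1 _ x _); last by rewrite le_max lexx orbT.
  rewrite lee_fin ler_wpM2l ?(ltW c10)// /x.
  have [_|_] := leP (r k)^-1 x1; first by rewrite ge_min lexx orbT.
  by rewrite -powR_inv1 ?(ltW rk)// -powRrM mulN1r opprK ge_min lexx.
apply: le_measure; rewrite ?inE//.
  by apply: measurable_gt; exact: measurable_funM.
move=> t xt; change (1 < r k * normc (xi (word k) t)).
have : x < normc (xi (word k) t) by exact: xt.
by rewrite gt_max => /andP[h _]; rewrite mulrC -ltr_pdivrMr// div1r.
Qed.

End square_function_of_offspring.

Section moments.
Context d (T : measurableType d) (R : realType) (P : probability T R)
  (M : seq nat -> T -> point_process_space R).
Hypothesis hM : iid P M.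
Variable l : R[i].
Local Notation m := (mC P M l).
Local Notation th := (complex.Re l).

Lemma mR_exponent_below (p al : R) : m != 0 -> 1 < p < al ->
  (mR P M th < +oo)%E -> (mR P M (al * th) < +oo)%E ->
  fine (mR P M (al * th)) / normc m `^ al < 1 ->
  exists q : R, [/\ p <= q < al, (mR P M (q * th) < +oo)%E &
    fine (mR P M (q * th)) / normc m `^ q < 1].
Proof.
move=> m0 pal mR1 mRal kap1; have /andP[p1 pal'] := pal.
have nm0 : 0 < normc m.
  by rewrite lt0r normc_ge0 andbT; apply: contra_neq m0 => /eq0_normc.
set kap := (_ / _) in kap1; pose k1 := fine (mR P M th) / normc m.
have fin s : (mR P M s < +oo)%E -> mR P M s \is a fin_num.
  by move=> ?; rewrite ge0_fin_numE// (mR_ge0 hM).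
have kap0 : 0 <= kap by rewrite divr_ge0 ?powR_ge0// fine_ge0// (mR_ge0 hM).
have k10 : 0 <= k1 by rewrite divr_ge0 ?(ltW nm0)// fine_ge0// (mR_ge0 hM).
have [|q [D [/andP[pq qal] D0 hD]]] := @exponent_below _ p al kap k1 pal _ k10.
  by rewrite kap0.
have q1 : 1 <= q by rewrite (le_trans (ltW p1)).
have := mR_interpolation hM (q := q) (al := al) (D := normc m * D) th.
rewrite q1 (ltW qal) mulr_gt0// => /(_ isT isT).
rewrite -(fineK (fin _ mR1)) -(fineK (fin _ mRal)) -!EFinM -EFinD => h.
have mRq : (mR P M (q * th) < +oo)%E by apply: le_lt_trans h (ltry _).
exists q; split=> //; first by rewrite pq.
move: h; rewrite -(fineK (fin _ mRq)) lee_fin => h.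
apply: le_lt_trans hD; rewrite ler_pdivrMr ?powR_gt0//.
apply: le_trans h _; rewrite le_eqVlt; apply/predU1P; left.
rewrite !powRM ?(ltW nm0) ?(ltW D0)// /kap /k1.
have -> : normc m `^ q = normc m `^ (q - al) * normc m `^ al.
  by rewrite -powRD ?subrK// (gt_eqF nm0) implybT.
have -> : normc m `^ (q - 1) = normc m `^ (q - al) * normc m `^ al / normc m.
  rewrite -powRD; last by rewrite (gt_eqF nm0) implybT.
  rewrite subrK -(@powR_inv1 _ (normc m)) ?(ltW nm0)// -powRD//.
  by rewrite (gt_eqF nm0) implybT.
have identity (A B n a b x y : R) : B != 0 -> n != 0 ->
    A * a * x + A * B / n * b * y = (a * (x / B) + b * (y / n)) * (A * B).
  by move=> B0 n0; field; apply/andP.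
by apply: identity; rewrite gt_eqF// powR_gt0.
Qed.

Lemma centered_offspring_moment (q : R) : 0 <= q ->
  (\int[P]_t (normc (biggins P M l 1 t) `^ q)%:E < +oo)%E ->
  (\int[P]_t (normc (centered_offspring l m (M [::] t)) `^ q)%:E < +oo)%E.
Proof.
move=> q0 Zf; have mZ : measurable_fun setT (fun t => (normc (biggins P M l 1 t) `^ q)%:E).
  apply: measurable_powR_EFin.
  exact: measurable_normc (Cmeasurable_biggins hM l 1).
apply: (@le_lt_trans _ _ (\int[P]_t ((2 `^ q)%:E *
    ((normc (biggins P M l 1 t) `^ q)%:E + 1)))%E).
  apply: ge0_le_integral => //.
  - by move=> t _; rewrite lee_fin powR_ge0.
  - apply: measurable_powR_EFin.
    exact: (measurableT_comp (measurable_normc (Cmeasurable_centered l m)) (iid_measurable hM [::])).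
  - by apply: measurable_funeM; exact: emeasurable_funD.
  move=> t _; rewrite -biggins1_centered -EFinD -EFinM lee_fin.
  have := powRD_le q0 (normc_ge0 (biggins P M l 1 t)) ler01.
  rewrite powR1; apply: le_trans.
  apply: ge0_ler_powR => //; rewrite ?nnegrE ?addr_ge0 ?normc_ge0//.
  by apply: le_trans (le_normcD _ _) _; rewrite normcN normc1.
have Z0 t : setT t -> (0 <= (normc (biggins P M l 1 t) `^ q)%:E)%E.
  by move=> _; rewrite lee_fin powR_ge0.
rewrite ge0_integralZl_EFin ?powR_ge0//; last 2 first.
- by move=> t tT; rewrite adde_ge0// Z0.
- exact: emeasurable_funD.
rewrite ge0_integralD// integral_cst// mul1e.
apply: lte_mul_pinfty; [by rewrite lee_fin powR_ge0|by []|].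
by rewrite [X in (_ + X)%E]probability_setT; apply: lte_add_pinfty => //; exact: ltry.
Qed.

End moments.

Unset Implicit Arguments.
Local Open Scope complex_scope.

Theorem theorem3p4 (R : realType) (d : measure_display) (T : measurableType d)
    (P : probability T R) (M : seq nat -> T -> point_process_space R)
    (hM : iid P M) (hJ : (1 < mean_offspring P M)%E)
    (p theta gamma alpha : R) (lambda : R[i])
    (hp1 : 1 < p) (hp2 : p < 2) (htheta : theta != 0) (hgamma : gamma != 0)
    (hlambda : lambda = theta +i* gamma)
    (hm0 : 0 < normc (mC P M lambda))
    (hmlt : ((normc (mC P M lambda))%:E < mR P M theta)%E)
    (hmfin : (mR P M theta < +oo)%E)
    (* Needed for the necessity part in case alpha = 2: if Z_1(lambda) = 1 a.s.,
       then Z_n(lambda) = 1 a.s. for all n, whatever the value of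
       m(2 theta) / |m(lambda)|^2.  When alpha < 2 it follows from the tail
       assumption. *)
    (hnondeg : ~ {ae P, forall t, biggins P M lambda 1 t = 1})
    (htail :
      (alpha = 2 /\
       ('E_P[fun t => (normc (biggins P M lambda 1 t) ^+ 2)%R] < +oo)%E)
      \/
      (let tail (x : R) : \bar R :=
         ((x `^ alpha)%R%:E *
          P [set t | (x < normc (biggins P M lambda 1 t))%R])%E in
       [/\ 1 < alpha < 2,
           (0 < limf_einf tail (pinfty_nbhs R))%E,
           (limf_einf tail (pinfty_nbhs R)
              <= limf_esup tail (pinfty_nbhs R))%E
         & (limf_esup tail (pinfty_nbhs R) < +oo)%E]))
    (hmalpha : (mR P M (alpha * theta) < +oo)%E)
    (hUI : uniformly_integrable P (biggins P M (alpha * theta)%:C)) :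
  converges_in_Lp P p (biggins P M lambda) <->
  p < alpha /\
  fine (mR P M (alpha * theta)) / normc (mC P M lambda) `^ alpha < 1.
Proof.
have mZ1 : measurable_fun setT (fun t => normc (biggins P M lambda 1 t)) :=
  measurable_normc (Cmeasurable_biggins hM lambda 1).
have th : theta = complex.Re lambda by rewrite hlambda.
have m0 : mC P M lambda != 0.
  by apply: contraTneq hm0 => ->; rewrite normc0 ltxx.
have p12 : 1 <= p <= 2 by rewrite !ltW.
have delta0 : 0 < 4^-1 :> R by rewrite invr_gt0.
rewrite th in hmfin hmalpha hUI *.
case: htail => [[al2 sq]|[/andP[al1 al2]]].
  rewrite al2 in hmalpha hUI *; split=> [cvgZ|[_ kap]].
    split=> //.
    have [c c0 hc] := square_function_of_offspring_ge hM p12 delta0 hnondeg.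
    exact: (@biggins_converges_kappa_lt1 _ _ _ _ _ hM lambda m0 hmfin p 2 c).
  apply: (biggins_converges_in_Lp hM m0 hmfin (q := 2)) => //.
  apply: (centered_offspring_moment hM) => //; move: sq; rewrite unlock.
  by under eq_integral do rewrite -powR_mulrn ?normc_ge0//.
move=> /limf_einf_pinfty_gt0[c0 [x0 [c00 tailge]]] _.
move=> /limf_esup_pinfty_lty[K [x1 taille]].
have al0 : 0 < alpha := lt_trans ltr01 al1.
split=> [cvgZ|[pal kap]].
  split.
    rewrite ltNge; apply/negP => alp.
    have infinite := moment_infinite_of_tail al0 c00 mZ1 (fun t => normc_ge0 _) tailge.
    have [_] := cvgZ.1 1%N; apply/negP; rewrite -leNgt leye_eq.
    have mp : measurable_fun setT (fun t => (normc (biggins P M lambda 1 t) `^ p)%:E).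
      by apply: measurable_powR_EFin.
    apply/eqP; rewrite CLnormE ?gt_eqF ?(lt_trans ltr01)//.
    apply: eqy_poweR; first by rewrite invr_gt0 (lt_trans ltr01).
    apply/eqP; rewrite -leye_eq leNgt; apply/negP => pf.
    suff : (\int[P]_t (normc (biggins P M lambda 1 t) `^ alpha)%:E < +oo)%E.
      by rewrite infinite ltxx.
    apply: (@le_lt_trans _ _ (\int[P]_t (1 + (normc (biggins P M lambda 1 t) `^ p)%:E))%E).
      apply: ge0_le_integral => //.
      - by move=> t _; rewrite lee_fin powR_ge0.
      - by apply: measurable_powR_EFin.
      - exact: emeasurable_funD.
      move=> t _; rewrite -EFinD lee_fin powR_le1D ?normc_ge0// (ltW al0).
      exact: alp.
    rewrite ge0_integralD//; last by move=> t _; rewrite lee_fin powR_ge0.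
    rewrite integral_cst// mul1e [X in (X + _)%E]probability_setT.
    by apply: lte_add_pinfty => //; exact: ltry.
  have [c c0' hc] := square_function_of_offspring_ge_tail hM (ltW hp1) al0 delta0 c00 tailge.
  exact: (@biggins_converges_kappa_lt1 _ _ _ _ _ hM lambda m0 hmfin p alpha c p12
    (lt0r_neq0 al0) c0').
have [|q [/andP[pq qal] mRq kapq]] := mR_exponent_below hM m0 _ hmfin hmalpha kap (p := p).
  by rewrite hp1.
have q0 : 0 <= q by rewrite (le_trans _ pq)// (le_trans ler01)// ltW.
apply: (biggins_converges_in_Lp hM m0 hmfin (q := q)) => //.
- by rewrite pq ltW.
- by rewrite ltW// (lt_trans qal).
apply: (centered_offspring_moment hM) => //.
pose y : R := Num.max x1 0 + 1.
have y0 : 0 < y by rewrite ltr_pwDr// le_max lexx orbT.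
apply: (@moment_of_tail _ _ _ P _ q alpha K y) => //.
- by rewrite q0.
- by move=> t; exact: normc_ge0.
move=> x yx; have x_gt0 : 0 < x := lt_le_trans y0 yx.
have /taille : x1 < x.
  by apply: lt_le_trans yx; rewrite ltr_pwDr// le_max lexx.
set S := [set t | _]; have mS : measurable S by exact: measurable_gt.
have PS : P S \is a fin_num by exact: fin_num_measure.
rewrite -(fineK PS) -EFinM !lee_fin powRN => h.
by rewrite ler_pdivlMr ?powR_gt0// mulrC.
Qed.
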